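(* Let $\Theta=\theta_1^2$ be a degree $(2,2)$ rational inner function, where $\theta_1=\tilde p/p$ for a polynomial $p(z)=a-z_1+cz_2$ with no zeros on $\mathbb{D}^2$, a zero on $\mathbb{T}^2$, and $a,c>0$. Let $\mathcal{K}_\Theta=\mathcal{S}_1\oplus\mathcal{S}_2$ be an orthogonal decomposition into closed subspaces with $\mathcal{S}_1$ invariant under $M_{z_1}$ and $\mathcal{S}_2$ invariant under $M_{z_2}$, and let $S^1_\Theta=P_{\mathcal{S}_2}M_{z_1}|_{\mathcal{S}_2}$. Then the boundary of $\mathcal{W}(S^1_\Theta)$ is the curve $E=\{(x(\theta),y(\theta)):\theta\in[0,2\pi)\}$, where \[x(\theta)=\frac{a+c\cos\theta}{a+c}+\frac{ac(1-\cos\theta)}{(a+c)^2}\cos\Big(\theta-\arcsin\Big(\frac{a}{a+c}\sin\theta\Big)\Big),\] \[y(\theta)=\frac{c\sin\theta}{a+c}+\frac{ac(1-\cos\theta)}{(a+c)^2}\sin\Big(\theta-\arcsin\Big(\frac{a}{a+c}\sin\theta\Big)\Big).\]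
   Context: $\mathbb{D}$ is the open unit disk, $\mathbb{T}$ the unit circle, $H^2(\mathbb{D}^2)$ the Hardy space of the bidisk. $\tilde p(z)=z_1z_2\overline{p(1/\bar z_1,1/\bar z_2)}$, so $\theta_1=\tilde p/p$ is a rational inner function of degree $(1,1)$. $\mathcal{K}_\Theta=H^2(\mathbb{D}^2)\ominus\Theta H^2(\mathbb{D}^2)$. $\mathcal{W}(T)=\{\langle Th,h\rangle:\|h\|=1\}$ is the numerical range; the complex plane is identified with $\mathbb{R}^2$. *)

(* Defs.v *)
From mathcomp Require Import all_boot all_order all_algebra.
From mathcomp Require Import all_classical all_reals all_analysis.
From mathcomp Require Import complex.
Import Order.TTheory GRing.Theory Num.Theory.
Import numFieldNormedType.Exports.

Set Implicit Arguments.
Unset Strict Implicit.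
Unset Printing Implicit Defensive.

Local Open Scope classical_set_scope.
Local Open Scope ring_scope.

Section Hardy.
Variable R : realType.

(* An element of H^2(D^2) is represented by its Taylor coefficients:
   f(z) = \sum_{j,k} f (j,k) z1^j z2^k. *)
Definition coef2 := (nat * nat)%type -> R[i].

Definition cabs2 (z : R[i]) : R := (complex.Re z) ^+ 2 + (complex.Im z) ^+ 2.

Definition H2 : set coef2 :=
  [set f | (\esum_(k in [set: nat * nat]) (cabs2 (f k))%:E < +oo)%E].

Definition coef_add (f g : coef2) : coef2 := fun k => f k + g k.
Definition coef_sub (f g : coef2) : coef2 := fun k => f k - g k.
Definition coef_scale (l : R[i]) (f : coef2) : coef2 := fun k => l * f k.
Definition coef_zero : coef2 := fun _ => 0.

Definition ip_part (f g : coef2) (N : nat) : R[i] :=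
  \sum_(j < N) \sum_(k < N) f (j : nat, k : nat) * (g (j : nat, k : nat))^*.

Definition ip (f g : coef2) : R[i] :=
  Complex (limn (fun N => complex.Re (ip_part f g N)))
          (limn (fun N => complex.Im (ip_part f g N))).

Definition nrm2 (f : coef2) : R := complex.Re (ip f f).

Definition Mz1 (f : coef2) : coef2 :=
  fun k => if k.1 is j.+1 then f (j, k.2) else 0.
Definition Mz2 (f : coef2) : coef2 :=
  fun k => if k.2 is j.+1 then f (k.1, j) else 0.

Definition p_eval (a c : R) (z1 z2 : R[i]) : R[i] := (a%:C)%C - z1 + (c%:C)%C * z2.

(* multiplication by p and by p~(z) = z1 z2 conj(p(1/conj z1, 1/conj z2))
   = c z1 - z2 + a z1 z2 (a, c real), on Taylor coefficients *)
Definition mul_p (a c : R) (f : coef2) : coef2 :=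
  fun k => (a%:C)%C * f k - Mz1 f k + (c%:C)%C * Mz2 f k.
Definition mul_pt (a c : R) (f : coef2) : coef2 :=
  fun k => (c%:C)%C * Mz1 f k - Mz2 f k + (a%:C)%C * Mz1 (Mz2 f) k.

(* Theta H^2 with Theta = (p~/p)^2: h = Theta g  iff  p^2 h = p~^2 g
   as power series (p(0) = a <> 0, so p^2 is invertible). *)
Definition ThetaH2 (a c : R) : set coef2 :=
  [set h | H2 h /\ exists g, H2 g /\
     mul_p a c (mul_p a c h) = mul_pt a c (mul_pt a c g)].

Definition KTheta (a c : R) : set coef2 :=
  [set f | H2 f /\ forall g, ThetaH2 a c g -> ip f g = 0].

Definition closed_subspace (S : set coef2) : Prop :=
  [/\ S `<=` H2, S coef_zero,
      (forall f g, S f -> S g -> S (coef_add f g)),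
      (forall l f, S f -> S (coef_scale l f)) &
      (forall (u : nat -> coef2) f, H2 f -> (forall n, S (u n)) ->
          (fun n => nrm2 (coef_sub (u n) f)) @ \oo --> (0 : R) -> S f)].

Definition is_proj (S : set coef2) (x y : coef2) : Prop :=
  S y /\ forall s, S s -> ip (coef_sub x y) s = 0.

Definition numrange_S1 (S2 : set coef2) : set R[i] :=
  [set w | exists h y, [/\ S2 h, ip h h = 1, is_proj S2 (Mz1 h) y & w = ip y h]].

Definition toR2 (z : R[i]) : R * R := (complex.Re z, complex.Im z).


Definition boundary (A : set (R * R)) : set (R * R) :=
  closure A `\` interior A.

Definition curve_x (a c t : R) : R :=
  (a + c * cos t) / (a + c)
  + a * c * (1 - cos t) / (a + c) ^+ 2 * cos (t - asin (a / (a + c) * sin t)).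
Definition curve_y (a c t : R) : R :=
  c * sin t / (a + c)
  + a * c * (1 - cos t) / (a + c) ^+ 2 * sin (t - asin (a / (a + c) * sin t)).

Definition curveE (a c : R) : set (R * R) :=
  [set z | exists t, 0 <= t < 2 * pi /\ z = (curve_x a c t, curve_y a c t)].

End Hardy.
Arguments toR2 {R}.

(* Main.v *)
From HB Require Import structures.
Require Import Defs.
From mathcomp Require Import all_boot all_order all_algebra.
From mathcomp Require Import all_classical all_reals all_analysis.
From mathcomp Require Import complex ring lra.
Import Order.TTheory GRing.Theory Num.Theory.
Import numFieldNormedType.Exports.
Set Implicit Arguments.
Unset Strict Implicit.
Unset Printing Implicit Defensive.
Local Open Scope classical_set_scope.
Local Open Scope ring_scope.

(* The zero conditions on [p] force [a = c + 1]. With [k = a / (a + c)], [X = 1 / (a + c z2)] and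
   the inner function [V = (X - k) / (1 - k)] of [z2], the function [theta1] has a conservative
   realisation in [z1] whose state, input and output operators are multiplications by functions
   of [z2]; the cascade of two copies realises [theta1^2]. Its observability map is, up to a
   scalar, an isometry of [H^2(z2) (+) H^2(z2)] onto the space of all [f] in [H^2(D^2)] such that
   [p^2 f] has degree at most [1] in [z1]. This space is forced to be [S2]: it contains [S2] and
   lies in [K_Theta], and it meets the analogous space containing [S1] trivially.
   The adjoint of the compression becomes
   [(F, G) |-> (X F + k (1 - k) (1 - V)^2 G, X G)]. As [V] is an isometry with approximate
   eigenvectors at every point of the circle, the support function of the numerical range in the
   direction [e^(i phi)] is [k cos phi + k (1 - k) + (1 - k) |e^(i phi) - k|]. By the
   Toeplitz-Hausdorff theorem this determines the boundary; the curve touches the support line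
   in direction [t - arcsin (k sin t)] at parameter [t]. *)

(** * Square-summable coefficient arrays *)

(** The number [k] comes from the image of the unit circle under [1 / (a + c z2)]: as [a - c = 1],
    it is the circle with centre [k] and radius [1 - k], internally tangent to the unit circle at
    [1]. The point of tangency, reached at [z2 = -1], belongs to the zero [(1, -1)] of [p] and is
    the source of the analytic difficulty: [1 - V] vanishes there, so dividing by it can leave
    [H^2]. Such divisions are needed both to recover the state of a given function and to place the
    model space inside [K_Theta]. One device serves both times: [1 - X^n] is divisible by [1 - V]
    and [X^n] tends to [0], so an argument can be run for [(1 - X^n) f] and passed to the limit.
    Conversely, membership in [K_Theta] only controls the coefficients of [p^2 f] of degree at least
    [2] in both variables; invariance under a shift, applied twice, removes the restriction on the
    degree in that variable. *)

#[global] Arguments ip : simpl never.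

Section HardySpace.
Variable R : realType.
Local Notation E := (nat * nat -> R[i]^o).
Local Notation Re := complex.Re.
Local Notation Im := complex.Im.
Implicit Types (f g h : E) (z w : R[i]).

Lemma ReD z w : Re (z + w) = Re z + Re w. Proof. by case: z w => ? ? [? ?]. Qed.
Lemma ImD z w : Im (z + w) = Im z + Im w. Proof. by case: z w => ? ? [? ?]. Qed.
Lemma ReN z : Re (- z) = - Re z. Proof. by case: z. Qed.
Lemma ImN z : Im (- z) = - Im z. Proof. by case: z. Qed.
Lemma ReM z w : Re (z * w) = Re z * Re w - Im z * Im w.
Proof. by case: z w => ? ? [? ?]. Qed.
Lemma ImM z w : Im (z * w) = Re z * Im w + Im z * Re w.
Proof. by case: z w => ? ? [? ?]. Qed.
Lemma ReJ z : Re z^* = Re z. Proof. by case: z. Qed.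
Lemma ImJ z : Im z^* = - Im z. Proof. by case: z. Qed.
Lemma Re1 : Re (1 : R[i]) = 1. Proof. by []. Qed.
Lemma Im1 : Im (1 : R[i]) = 0. Proof. by []. Qed.
(* Locked, since unification otherwise recognises [Complex _ 0] in unrelated complex terms. *)
Definition rc (x : R) : R[i] := locked (Complex x 0).
Lemma ReC (x : R) : Re (rc x) = x. Proof. by rewrite /rc -lock. Qed.
Lemma ImC (x : R) : Im (rc x) = 0. Proof. by rewrite /rc -lock. Qed.
Definition ci : R[i] := ('i)%C.
Lemma Reci : Re ci = 0. Proof. by []. Qed.
Lemma Imci : Im ci = 1. Proof. by []. Qed.
Definition ReImE := (Reci, Imci, ReD, ImD, ReN, ImN, ReM, ImM, ReJ, ImJ, ReC, ImC, Re1, Im1).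

Lemma complexP z w : Re z = Re w -> Im z = Im w -> z = w.
Proof. by case: z w => a b [c d] /= -> ->. Qed.

Lemma rc0 : rc 0 = 0. Proof. by apply: complexP; rewrite !ReImE. Qed.
Lemma rc1 : rc 1 = 1. Proof. by apply: complexP; rewrite !ReImE. Qed.
Lemma rcD (x y : R) : rc (x + y) = rc x + rc y.
Proof. by apply: complexP; rewrite !ReImE ?addr0. Qed.
Lemma rcN (x : R) : rc (- x) = - rc x.
Proof. by apply: complexP; rewrite !ReImE ?oppr0. Qed.
Lemma rcM (x y : R) : rc (x * y) = rc x * rc y.
Proof. by apply: complexP; rewrite !ReImE; ring. Qed.
Lemma rcV (x : R) : rc x^-1 = (rc x)^-1.
Proof.
have [->|x0] := eqVneq x 0; first by rewrite invr0 rc0 invr0.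
have : rc x * rc x^-1 = 1 by rewrite -rcM divff // rc1.
move=> h; have r0 : rc x != 0.
  by apply: contra_eq_neq h => ->; rewrite mul0r eq_sym oner_eq0.
by apply: (mulfI r0); rewrite h divff.
Qed.
Lemma Re_rcM (x : R) z : Re (rc x * z) = x * Re z.
Proof. by rewrite !ReImE mul0r subr0. Qed.
Lemma Im_rcM (x : R) z : Im (rc x * z) = x * Im z.
Proof. by rewrite !ReImE mul0r addr0. Qed.
Lemma rcJ (x : R) : (rc x)^* = rc x.
Proof. by apply: complexP; rewrite !ReImE ?oppr0. Qed.
Lemma rc_eq0 (x : R) : (rc x == 0) = (x == 0).
Proof.
apply/eqP/eqP => [h|->]; last exact: rc0.
by rewrite -(ReC x) h.
Qed.

(** As [Re (b (i u)) = - Im (b u)], equality of real parts on a set stable under [i] is full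
    equality. This upgrades norm identities to identities of inner products. *)
Lemma polarization (U : lmodType R[i]) (S : U -> Prop) (b1 b2 : U -> R[i]) :
  (forall u, S u -> S (ci *: u)) ->
  (forall u, S u -> b1 (ci *: u) = ci * b1 u) ->
  (forall u, S u -> b2 (ci *: u) = ci * b2 u) ->
  (forall u, S u -> Re (b1 u) = Re (b2 u)) -> forall u, S u -> b1 u = b2 u.
Proof.
move=> SZ b1Z b2Z re u Su; apply: complexP; first exact: re.
by have := re _ (SZ u Su); rewrite b1Z // b2Z // !ReImE; lra.
Qed.

Lemma ReS I (r : seq I) (P : pred I) (F : I -> R[i]) :
  Re (\sum_(i <- r | P i) F i) = \sum_(i <- r | P i) Re (F i).
Proof. by elim/big_ind2: _ => // x y z w <- <-; rewrite ReD. Qed.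
Lemma ImS I (r : seq I) (P : pred I) (F : I -> R[i]) :
  Im (\sum_(i <- r | P i) F i) = \sum_(i <- r | P i) Im (F i).
Proof. by elim/big_ind2: _ => // x y z w <- <-; rewrite ImD. Qed.

Lemma evD f g k : (f + g) k = f k + g k. Proof. by []. Qed.
Lemma evN f k : (- f) k = - f k. Proof. by []. Qed.
Lemma evZ (l : R[i]) f k : (l *: f) k = (l : R[i]) * f k. Proof. by []. Qed.
Definition evE := (evD, evN, evZ).

Lemma cabs2_ge0 z : 0 <= cabs2 z. Proof. by rewrite addr_ge0 ?sqr_ge0. Qed.
Lemma cabs2_eq0 z : cabs2 z = 0 -> z = 0.
Proof.
move=> /eqP; rewrite paddr_eq0 ?sqr_ge0 // !sqrf_eq0 => /andP[/eqP h1 /eqP h2].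
exact: complexP.
Qed.
Lemma cabs20 : cabs2 (0 : R[i]) = 0.
Proof. by rewrite /cabs2 /= expr0n addr0. Qed.
Lemma cabs2M z w : cabs2 (z * w) = cabs2 z * cabs2 w.
Proof. rewrite /cabs2 !ReImE; ring. Qed.
Lemma cabs2J z : cabs2 z^* = cabs2 z.
Proof. rewrite /cabs2 !ReImE; ring. Qed.
Lemma cabs2N z : cabs2 (- z) = cabs2 z.
Proof. rewrite /cabs2 !ReImE; ring. Qed.
Lemma cabs2C (x : R) : cabs2 (rc x) = x ^+ 2.
Proof. by rewrite /cabs2 ReC ImC expr0n addr0. Qed.
Lemma cabs21 : cabs2 (1 : R[i]) = 1. Proof. by rewrite /cabs2 Re1 Im1; ring. Qed.
Lemma mulcJ z : z * z^* = rc (cabs2 z).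
Proof. by apply: complexP; rewrite !ReImE /cabs2; ring. Qed.
Lemma cabs2D_le z w : cabs2 (z + w) <= 2 * cabs2 z + 2 * cabs2 w.
Proof.
rewrite -subr_ge0; have -> : 2 * cabs2 z + 2 * cabs2 w - cabs2 (z + w) =
  cabs2 (z - w) by rewrite /cabs2 !ReImE; ring.
exact: cabs2_ge0.
Qed.

(** The limit defining [ip] is taken separately on real and imaginary parts. Both are instances of
    this one real form, the imaginary part with [g] multiplied by [i]. *)
Definition rpart f g (N : nat) : R :=
  \sum_(j < N) \sum_(k < N) (Re (f (j : nat, k : nat)) * Re (g (j : nat, k : nat))
    + Im (f (j : nat, k : nat)) * Im (g (j : nat, k : nat))).
Definition psum f (N : nat) : R :=
  \sum_(j < N) \sum_(k < N) cabs2 (f (j : nat, k : nat)).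

Lemma Re_ip_part f g N : Re (ip_part f g N) = rpart f g N.
Proof.
rewrite /ip_part ReS; apply: eq_bigr => j _; rewrite ReS; apply: eq_bigr => k _.
by rewrite !ReImE; ring.
Qed.

Lemma Im_ip_part f g N : Im (ip_part f g N) = rpart f (ci *: g) N.
Proof.
rewrite /ip_part ImS; apply: eq_bigr => j _; rewrite ImS; apply: eq_bigr => k _.
rewrite ?evE !ReImE. ring.
Qed.

Lemma rpart_lin (x y : R) f g h N :
  rpart (rc x *: f + rc y *: g) h N = x * rpart f h N + y * rpart g h N.
Proof.
rewrite /rpart !mulr_sumr -big_split; apply: eq_bigr => j _.
rewrite !mulr_sumr -big_split; apply: eq_bigr => k _ /=.
by rewrite ?evE !ReImE; ring.
Qed.

Lemma rpartC f g N : rpart f g N = rpart g f N.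
Proof. by apply: eq_bigr => j _; apply: eq_bigr => k _; ring. Qed.

Lemma rpart_ci f g N : rpart (ci *: f) g N = - rpart f (ci *: g) N.
Proof.
rewrite /rpart -sumrN; apply: eq_bigr => j _; rewrite -sumrN; apply: eq_bigr => k _.
by rewrite ?evE !ReImE; ring.
Qed.

Lemma rpartff f N : rpart f f N = psum f N.
Proof. by apply: eq_bigr => j _; apply: eq_bigr => k _; rewrite /cabs2; ring. Qed.

Lemma psumD f g N : psum (f + g) N = psum f N + psum g N + 2 * rpart f g N.
Proof.
rewrite /psum /rpart mulr_sumr -!big_split; apply: eq_bigr => j _.
rewrite mulr_sumr -!big_split; apply: eq_bigr => k _ /=.
by rewrite /cabs2 !evE !ReImE; ring.
Qed.

Lemma psumZ (l : R[i]) f N : psum (l *: f) N = cabs2 l * psum f N.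
Proof.
rewrite /psum mulr_sumr; apply: eq_bigr => j _; rewrite mulr_sumr.
by apply: eq_bigr => k _; rewrite -cabs2M.
Qed.

Lemma psum_ge0 f N : 0 <= psum f N.
Proof. by apply: sumr_ge0 => j _; apply: sumr_ge0 => k _; exact: cabs2_ge0. Qed.

Lemma psumD_le f g N : psum (f + g) N <= 2 * psum f N + 2 * psum g N.
Proof.
rewrite /psum !mulr_sumr -big_split /=; apply: ler_sum => j _.
rewrite !mulr_sumr -big_split /=; apply: ler_sum => k _; exact: cabs2D_le.
Qed.

Lemma le_sum_ord (F G : nat -> R) (m n : nat) : (m <= n)%N ->
  (forall i, 0 <= G i) -> (forall i, F i <= G i) ->
  \sum_(i < m) F i <= \sum_(i < n) G i.
Proof.
move=> mn G0 FG; rewrite -(big_mkord xpredT F) -(big_mkord xpredT G).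
rewrite (@big_cat_nat _ _ _ m 0%N n) //=.
rewrite -[leLHS]addr0; apply: lerD; first exact: ler_sum.
exact: sumr_ge0.
Qed.

Lemma le_psum f g M N : (M <= N)%N -> (forall k, cabs2 (f k) <= cabs2 (g k)) ->
  psum f M <= psum g N.
Proof.
move=> MN fg.
apply: (@le_sum_ord (fun j => \sum_(k < M) cabs2 (f (j, k : nat)))
    (fun j => \sum_(k < N) cabs2 (g (j, k : nat)))) => // i.
  by apply: sumr_ge0 => k _; exact: cabs2_ge0.
apply: (@le_sum_ord (fun k => cabs2 (f (i, k))) (fun k => cabs2 (g (i, k)))) => // k.
exact: cabs2_ge0.
Qed.

Lemma psum_nd f M N : (M <= N)%N -> psum f M <= psum f N.
Proof. by move=> MN; exact: le_psum. Qed.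

Lemma cabs2_psum f j l N : (j < N)%N -> (l < N)%N -> cabs2 (f (j, l)) <= psum f N.
Proof.
move=> jN lN; rewrite /psum (bigD1 (Ordinal jN)) //= (bigD1 (Ordinal lN)) //=.
rewrite -addrA lerDl addr_ge0 // ?sumr_ge0 // => i _; rewrite ?sumr_ge0 // => *;
  exact: cabs2_ge0.
Qed.

Let sqr N : seq (nat * nat) := [seq (j, l) | j <- iota 0 N, l <- iota 0 N].

Let psum_sqr f N : psum f N = \sum_(k <- sqr N) cabs2 (f k).
Proof.
have ordE (F : nat -> R) : \sum_(j < N) F j = \sum_(j <- iota 0 N) F j.
  by rewrite -(big_mkord xpredT) /index_iota subn0.
rewrite /sqr big_allpairs /psum (ordE (fun j => \sum_(k < N) cabs2 (f (j, k : nat)))).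
by apply: eq_bigr => j _; exact: (ordE (fun l => cabs2 (f (j, l)))).
Qed.

(** Every finite index set lies in a square, so the supremum over finite sets in [esum] is governed
    by the square partial sums that also define [ip]. *)
Lemma H2P f : H2 f <-> exists C, forall N, psum f N <= C.
Proof.
have fin N : ((psum f N)%:E = \sum_(k \in [set` sqr N]) (cabs2 (f k))%:E)%E.
  rewrite psum_sqr -fsbig_seq ?sumEFin //.
  by apply: allpairs_uniq; rewrite ?iota_uniq // => -[? ?] [? ?].
rewrite /H2 /=; split=> [lty|[C hC]].
- have ge0 : (0%E <= \esum_(k in [set: nat * nat]) (cabs2 (f k))%:E)%E.
    by apply: esum_ge0 => k _; rewrite lee_fin cabs2_ge0.
  exists (fine (\esum_(k in [set: nat * nat]) (cabs2 (f k))%:E)%E) => N.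
  rewrite -lee_fin fineK ?ge0_fin_numE // fin; apply: esum_ge.
  by exists [set` sqr N] => //; split=> //; exact: finite_seq.
- apply: (@le_lt_trans _ _ (C%:E)); last exact: ltry.
  apply: ge_ereal_sup => _ [A [finA _] <-].
  have [N AN] : exists N, forall k, A k -> (k.1 < N)%N /\ (k.2 < N)%N.
    have [s ->] := (finite_seqP A).1 finA.
    exists (\max_(k <- s) maxn k.1 k.2).+1 => k /= ks.
    rewrite !ltnS; move: (ks) => /(@leq_bigmax_seq _ s xpredT (fun k => maxn k.1 k.2) k).
    by move=> /(_ isT); rewrite geq_max => /andP.
  apply: (@le_trans _ _ (psum f N)%:E); last by rewrite lee_fin.
  rewrite fin; apply: lee_fsum_nneg_subset => //; first exact: finite_seq.
    move=> [j l]; rewrite !inE /= => /AN /= [jN lN].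
    by apply/allpairsP; exists (j, l); rewrite !mem_iota.
  by move=> k _; rewrite lee_fin cabs2_ge0.
Qed.

Lemma psum_cvg f : H2 f -> cvgn (psum f).
Proof.
move=> /H2P[C hC]; apply: nondecreasing_is_cvgn; first by move=> m n; exact: psum_nd.
by exists C => _ [n _ <-].
Qed.

Lemma nrm2E f : nrm2 f = limn (psum f).
Proof. by rewrite /nrm2 /=; congr (limn _); apply/funext => N; rewrite Re_ip_part rpartff. Qed.

Lemma psum_cvg_nrm2 f : H2 f -> psum f @ \oo --> nrm2 f.
Proof. by move=> /psum_cvg; rewrite nrm2E. Qed.

Lemma psum_le_nrm2 f N : H2 f -> psum f N <= nrm2 f.
Proof.
move=> hf; rewrite nrm2E; apply: nondecreasing_cvgn_le; last exact: psum_cvg.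
by move=> m n; exact: psum_nd.
Qed.

Lemma bounded_H2 f (C : R) : (forall N, psum f N <= C) -> H2 f /\ nrm2 f <= C.
Proof.
move=> hC; have hf : H2 f by apply/H2P; exists C.
split=> //; rewrite nrm2E; apply: limr_le; first exact: psum_cvg.
by near=> N.
Unshelve. all: end_near. Qed.

Lemma nrm2_ge0 f : H2 f -> 0 <= nrm2 f.
Proof. by move=> hf; exact: le_trans (psum_ge0 f 0%N) (psum_le_nrm2 0%N hf). Qed.

Lemma coef_le_nrm2 f k : H2 f -> cabs2 (f k) <= nrm2 f.
Proof.
case: k => j l hf; apply: le_trans (psum_le_nrm2 (maxn j l).+1 hf).
by apply: cabs2_psum; rewrite ltnS ?leq_maxl ?leq_maxr.
Qed.

Lemma nrm2_eq0 f : H2 f -> nrm2 f <= 0 -> f = 0.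
Proof.
move=> hf f0; apply/funext => k; apply: cabs2_eq0; apply: le_anti.
by rewrite cabs2_ge0 andbT (le_trans (coef_le_nrm2 k hf)).
Qed.

Lemma H2D f g : H2 f -> H2 g -> H2 (f + g).
Proof.
move=> /H2P[C hC] /H2P[D hD]; apply/H2P; exists (2 * C + 2 * D) => N.
by apply: le_trans (psumD_le _ _ _) _; rewrite lerD // ler_pM2l.
Qed.
Lemma H2Z (l : R[i]) f : H2 f -> H2 (l *: f).
Proof.
move=> /H2P[C hC]; apply/H2P; exists (cabs2 l * C) => N.
by rewrite psumZ ler_wpM2l // cabs2_ge0.
Qed.
Lemma H2N f : H2 f -> H2 (- f). Proof. by rewrite -scaleN1r; exact: H2Z. Qed.
Lemma H2B f g : H2 f -> H2 g -> H2 (f - g).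
Proof. by move=> hf hg; apply: H2D => //; exact: H2N. Qed.
Lemma H20 : H2 (0 : E).
Proof.
apply/H2P; exists 0 => N; rewrite /psum big1 // => j _; rewrite big1 // => k _.
by rewrite /cabs2 /= expr0n addr0.
Qed.

End HardySpace.

Ltac h2 := match goal with
  | |- H2 (_ - _) => apply: H2B; h2
  | |- H2 (_ + _) => apply: H2D; h2
  | |- H2 (- _) => apply: H2N; h2
  | |- H2 (_ *: _) => apply: H2Z; h2
  | |- H2 0 => exact: H20
  | H : H2 ?f |- H2 ?f => exact: H
  | H : forall n, H2 _ |- H2 _ => solve [apply: H]
  end.
#[local] Hint Extern 0 (@H2 _ _) => solve [h2] : core.

(** * The inner product and the Cauchy-Schwarz inequality *)

Section InnerProduct.
Variable R : realType.
Local Notation E := (nat * nat -> R[i]^o).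
Local Notation Re := complex.Re.
Local Notation Im := complex.Im.
Local Notation ci := (ci R).
Implicit Types (f g h : E) (z w : R[i]).

Lemma rpartE f g N : rpart f g N = (psum (f + g) N - psum f N - psum g N) / 2.
Proof. by rewrite psumD; field. Qed.

(** By polarisation the form is a combination of the partial sums of three squared norms, which are
    monotone and bounded. *)
Lemma rpart_cvg f g : H2 f -> H2 g -> cvgn (rpart f g).
Proof.
move=> hf hg; have -> : rpart f g = fun N => (psum (f + g) N - psum f N - psum g N) / 2.
  by apply/funext => N; exact: rpartE.
apply: is_cvgMl; apply: is_cvgB; last exact: psum_cvg.
by apply: is_cvgB; apply: psum_cvg => //; exact: H2D.
Qed.

Definition rip f g : R := limn (rpart f g).

Lemma rip_cvg f g : H2 f -> H2 g -> rpart f g @ \oo --> rip f g.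
Proof. by move=> hf hg; exact: rpart_cvg. Qed.

Lemma Re_ip f g : Re (ip f g) = rip f g.
Proof. by rewrite /ip /= /rip; congr (limn _); apply/funext => N; rewrite Re_ip_part. Qed.
Lemma Im_ip f g : Im (ip f g) = rip f (ci *: g).
Proof. by rewrite /ip /= /rip; congr (limn _); apply/funext => N; rewrite Im_ip_part. Qed.

Lemma rip_lin (x y : R) f g h : H2 f -> H2 g -> H2 h ->
  rip (rc x *: f + rc y *: g) h = x * rip f h + y * rip g h.
Proof.
move=> hf hg hh; apply/cvg_lim => //.
have -> : rpart (rc x *: f + rc y *: g) h =
  fun N => x * rpart f h N + y * rpart g h N.
  by apply/funext => N; exact: rpart_lin.
by apply: cvgD; apply: cvgMr; exact: rip_cvg.
Qed.

Lemma ripC f g : rip f g = rip g f.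
Proof. by rewrite /rip; congr (limn _); apply/funext => N; exact: rpartC. Qed.

Lemma rip_ci f g : H2 f -> H2 g -> rip (ci *: f) g = - rip f (ci *: g).
Proof.
move=> hf hg; apply/cvg_lim => //.
have -> : rpart (ci *: f) g = fun N => - rpart f (ci *: g) N.
  by apply/funext => N; exact: rpart_ci.
by apply: cvgN; apply: rip_cvg => //.
Qed.

Lemma ripff f : rip f f = nrm2 f. Proof. by rewrite /nrm2 Re_ip. Qed.

Lemma ripDl f g h : H2 f -> H2 g -> H2 h -> rip (f + g) h = rip f h + rip g h.
Proof.
move=> hf hg hh; have := rip_lin 1 1 hf hg hh.
by rewrite !mul1r => <-; rewrite !rc1 !scale1r.
Qed.

Lemma ipDl f g h : H2 f -> H2 g -> H2 h -> ip (f + g) h = ip f h + ip g h.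
Proof.
move=> hf hg hh; apply: complexP; rewrite !(ReImE, Re_ip, Im_ip) ripDl //.
Qed.

Lemma cciE (l : R[i]) f : l *: f = rc (Re l) *: f + rc (Im l) *: (ci *: f).
Proof.
apply/funext => k; apply: complexP.
  by rewrite !evE !ReImE; ring.
by rewrite !evE !ReImE; ring.
Qed.

Lemma ipC f g : H2 f -> H2 g -> ip g f = (ip f g)^*.
Proof.
move=> hf hg; apply: complexP; rewrite !(ReImE, Re_ip, Im_ip); first exact: ripC.
by rewrite ripC; apply: rip_ci.
Qed.

Lemma ipZl (l : R[i]) f g : H2 f -> H2 g -> ip (l *: f) g = l * ip f g.
Proof.
move=> hf hg; apply: complexP; rewrite !(ReImE, Re_ip, Im_ip) (cciE l f).
  by rewrite rip_lin // rip_ci //; ring.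
rewrite rip_lin // rip_ci //.
have -> : ci *: (ci *: g) = rc (-1) *: g + rc 0 *: g.
  apply/funext => k; apply: complexP;
  by rewrite !evE !ReImE; ring.
by rewrite (ripC f (_ + _)) rip_lin // (ripC g); ring.
Qed.

Lemma ipNl f g : H2 f -> H2 g -> ip (- f) g = - ip f g.
Proof. by move=> hf hg; rewrite -scaleN1r ipZl // mulN1r. Qed.
Lemma ipBl f g h : H2 f -> H2 g -> H2 h -> ip (f - g) h = ip f h - ip g h.
Proof. by move=> hf hg hh; rewrite ipDl ?ipNl //. Qed.
Lemma ipDr f g h : H2 f -> H2 g -> H2 h -> ip f (g + h) = ip f g + ip f h.
Proof.
move=> hf hg hh; rewrite (ipC (H2D hg hh) hf) ipDl // rmorphD /=.
by rewrite -!ipC.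
Qed.
Lemma ipZr (l : R[i]) f g : H2 f -> H2 g -> ip f (l *: g) = l^* * ip f g.
Proof. by move=> hf hg; rewrite (ipC (H2Z l hg) hf) ipZl // rmorphM /= -ipC. Qed.
Lemma ipNr f g : H2 f -> H2 g -> ip f (- g) = - ip f g.
Proof. by move=> hf hg; rewrite -scaleN1r ipZr // rmorphN1 mulN1r. Qed.
Lemma ipBr f g h : H2 f -> H2 g -> H2 h -> ip f (g - h) = ip f g - ip f h.
Proof. by move=> hf hg hh; rewrite ipDr ?ipNr //. Qed.

Lemma ipff f : H2 f -> ip f f = rc (nrm2 f).
Proof.
move=> hf; apply: complexP; rewrite !(ReImE, Re_ip, Im_ip) ?ripff //.
by have := rip_ci hf hf; rewrite ripC => e; lra.
Qed.

Lemma nrm2Z (l : R[i]) f : H2 f -> nrm2 (l *: f) = cabs2 l * nrm2 f.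
Proof.
move=> hf; rewrite /nrm2 ipZl ?ipZr // mulrA mulcJ ipff //.
by rewrite !ReImE; ring.
Qed.

Lemma nrm2N f : H2 f -> nrm2 (- f) = nrm2 f.
Proof. by move=> hf; rewrite -scaleN1r nrm2Z // cabs2N cabs21 mul1r. Qed.

Lemma nrm2D f g : H2 f -> H2 g ->
  nrm2 (f + g) = nrm2 f + nrm2 g + 2 * Re (ip f g).
Proof.
move=> hf hg; rewrite /nrm2 ipDl // ipDr // ipDr //. rewrite !ReImE (ipC hf hg) ReJ; ring.
Qed.

Lemma nrm2B f g : H2 f -> H2 g ->
  nrm2 (f - g) = nrm2 f + nrm2 g - 2 * Re (ip f g).
Proof.
move=> hf hg; rewrite nrm2D ?ipNr ?nrm2N ?ReN //.
by rewrite mulrN.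
Qed.

Lemma nrm2BC f g : H2 f -> H2 g -> nrm2 (f - g) = nrm2 (g - f).
Proof. by move=> hf hg; rewrite -nrm2N ?opprB //; exact: H2B. Qed.

Lemma nrm2D_le f g : H2 f -> H2 g -> nrm2 (f + g) <= 2 * nrm2 f + 2 * nrm2 g.
Proof.
move=> hf hg; have := nrm2_ge0 (H2B hf hg); rewrite nrm2B // nrm2D //; lra.
Qed.

Lemma nrm2B_le f g : H2 f -> H2 g -> nrm2 (f - g) <= 2 * nrm2 f + 2 * nrm2 g.
Proof. by move=> hf hg; rewrite -(nrm2N hg); apply: nrm2D_le => //. Qed.

Lemma cauchy_schwarz f g : H2 f -> H2 g -> cabs2 (ip f g) <= nrm2 f * nrm2 g.
Proof.
move=> hf hg; set z := ip f g.
have [g0|g0] := eqVneq (nrm2 g) 0.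
  have -> : z = 0.
    have gz : g = (0 : R[i]) *: g by rewrite scale0r; apply: nrm2_eq0; rewrite ?g0.
    by rewrite /z gz ipZr // rmorph0 mul0r.
  by rewrite g0 mulr0 /cabs2 /= expr0n addr0.
have gp : 0 < nrm2 g by rewrite lt_def g0 nrm2_ge0.
have := nrm2_ge0 (H2B (H2Z (rc (nrm2 g)) hf) (H2Z z hg)).
rewrite nrm2B // !nrm2Z // ipZl ?ipZr // -/z.
rewrite (mulrC z^*) mulcJ cabs2C !ReImE.
have -> : nrm2 g ^+ 2 * nrm2 f + cabs2 z * nrm2 g -
  2 * (nrm2 g * cabs2 z - 0 * 0) = nrm2 g * (nrm2 f * nrm2 g - cabs2 z) by ring.
by rewrite pmulr_rge0 // subr_ge0.
Qed.

End InnerProduct.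

#[local] Hint Extern 0 (@H2 _ _) => solve [h2] : core.

(** * Completeness and orthogonal projections *)

Section Limits.
Variable R : realType.
Local Notation E := (nat * nat -> R[i]^o).
Local Notation Re := complex.Re.
Local Notation Im := complex.Im.
Implicit Types (f g h : E) (z w : R[i]) (u v : nat -> R).

(** One-sided convergence to [0], used for nonnegative sequences such as squared norms. *)
Definition null u := forall e : R, 0 < e -> exists N, forall n, (N <= n)%N -> u n < e.

Lemma null_le u v (C : R) : (forall n, u n <= C * v n) -> (forall n, 0 <= v n) ->
  null v -> null u.
Proof.
move=> uv v0 hv e e0; have C0 : 0 < `|C| + 1 by rewrite ltr_wpDl.
have [N hN] := hv (e / (`|C| + 1)) (divr_gt0 e0 C0); exists N => n /hN.
rewrite ltr_pdivlMr // => h; apply: le_lt_trans (uv n) _.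
apply: le_lt_trans h; rewrite mulrC ler_wpM2l //.
by apply: le_trans (ler_norm C) _; rewrite lerDl.
Qed.

Lemma null_eq u v : u =1 v -> null u -> null v.
Proof. by move=> uv; have -> : v = u by apply/funext => n; rewrite uv. Qed.

Lemma nullD u v : null u -> null v -> null (fun n => u n + v n).
Proof.
move=> hu hv e e0; have e2 : 0 < e / 2 by rewrite divr_gt0.
have [N hN] := hu _ e2; have [M hM] := hv _ e2.
exists (maxn N M) => n; rewrite geq_max => /andP[/hN h1 /hM h2].
by rewrite (splitr e); exact: ltrD.
Qed.

Lemma null_sum m (F : nat -> nat -> R) : (forall i, null (F i)) ->
  null (fun n => \sum_(i < m) F i n).
Proof.
move=> hF; elim: m => [|m IH] e e0; first by exists 0%N => n _; rewrite big_ord0.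
by have [N hN] := nullD IH (hF m) e0; exists N => n /hN; rewrite big_ord_recr.
Qed.

Lemma null_harmonic (C : R) : null (fun n => C / n.+1%:R).
Proof.
have h : null (fun n => n.+1%:R^-1 : R).
  move=> e e0; have := @cvg_harmonic R.
  move=> /cvgrPdist_lt /(_ e e0) [N _ hN]; exists N => n /hN /=.
  by rewrite sub0r normrN ger0_norm // invr_ge0.
by apply: (@null_le _ (fun n => n.+1%:R^-1) C) => // n; rewrite invr_ge0.
Qed.

Lemma null_cvg u : (forall n, 0 <= u n) -> null u -> u @ \oo --> (0 : R).
Proof.
move=> u0 hu; apply/cvgrPdist_lt => e /hu[N hN]; exists N => // n /hN.
by rewrite sub0r normrN ger0_norm.
Qed.

Lemma null_const (x y : R) u : (forall n, x <= y + u n) -> null u -> x <= y.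
Proof.
move=> xy hu; apply/ler_addgt0Pr => e /hu[N hN].
by apply: le_trans (xy N) _; rewrite lerD2l ltW // hN.
Qed.

Lemma cauchy_limit u :
  (forall e : R, 0 < e -> exists N, forall m n, (N <= m)%N -> (N <= n)%N ->
    `|u m - u n| < e) ->
  exists l, null (fun n => `|u n - l|).
Proof.
move=> hu; have : cvgn u.
  apply/cauchy_cvgP/cauchy_ballP => e /hu[N hN].
  pose A := [set x | exists2 n, (N <= n)%N & x = u n].
  have hA : (u @ \oo) A by exists N => // n Nn; exists n.
  exists (A, A) => //= -[_ _] [[m Nm ->] [n Nn ->]]; exact: hN.
move=> /cvgrPdist_lt hl; exists (limn u) => e /hl[N _ hN]; exists N => n /hN.
by rewrite distrC.
Qed.

(** The constant [2] of [cabs2D_le] would lose a factor in the limit; here the weight of the main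
    term can be taken arbitrarily close to [1]. *)
Lemma cabs2_add_eps (e : R) z w : 0 < e ->
  cabs2 (z + w) <= (1 + e) * cabs2 z + (1 + e^-1) * cabs2 w.
Proof.
move=> e0; rewrite -subr_ge0.
suff -> : (1 + e) * cabs2 z + (1 + e^-1) * cabs2 w - cabs2 (z + w) =
  e * cabs2 (z - rc (e^-1) * w) by rewrite mulr_ge0 ?cabs2_ge0 // ltW.
rewrite /cabs2 !ReImE; field; exact: lt0r_neq0.
Qed.

Lemma psum_add_eps (e : R) f g N : 0 < e ->
  psum (f + g) N <= (1 + e) * psum f N + (1 + e^-1) * psum g N.
Proof.
move=> e0; rewrite /psum !mulr_sumr -big_split /=; apply: ler_sum => j _.
rewrite !mulr_sumr -big_split /=; apply: ler_sum => k _; exact: cabs2_add_eps.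
Qed.

(** Each partial sum involves finitely many coefficients, so it passes to the coefficientwise limit;
    the bound is uniform in the size of the square. *)
Lemma fatou (u : nat -> E) f (C : R) :
  (forall n, H2 (u n)) -> (forall n, nrm2 (u n) <= C) ->
  (forall k, null (fun n => cabs2 (u n k - f k))) -> H2 f /\ nrm2 f <= C.
Proof.
move=> hu uC uf; apply: bounded_H2 => N.
have C0 : 0 <= C := le_trans (nrm2_ge0 (hu 0%N)) (uC 0%N).
apply/ler_addgt0Pr => e e0; pose d := e / (C + 1).
have d0 : 0 < d by rewrite divr_gt0 // ltr_wpDl.
have dC : (1 + d) * C <= C + e.
  rewrite mulrDl mul1r lerD2l /d mulrAC ler_pdivrMr ?ltr_wpDl //.
  by rewrite ler_pM2l // lerDl.
apply: le_trans dC; apply: (@null_const _ _ (fun n => (1 + d^-1) * psum (f - u n) N)).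
  move=> n; rewrite -{1}[f](subrK (u n)) [X in psum X](addrC (f - u n)).
  apply: le_trans (psum_add_eps (u n) (f - u n) N d0) _.
  rewrite lerD2r ler_pM2l ?addr_gt0 //; exact: le_trans (psum_le_nrm2 _ (hu n)) (uC n).
apply: (@null_le _ (fun n => psum (f - u n) N) (1 + d^-1)) => // [n|].
  exact: psum_ge0.
rewrite /psum; apply: (@null_sum _ (fun j n => \sum_(k < N) cabs2 ((f - u n) (j, k : nat)))).
move=> j; apply: (@null_sum _ (fun k n => cabs2 ((f - u n) (j, k)))) => l e' e'0.
have [M hM] := uf (j, l) e' e'0; exists M => n /hM.
by rewrite -cabs2N opprB.
Qed.

Lemma sqr_small (x e : R) : 0 < e -> x ^+ 2 < e ^+ 2 -> `|x| < e.
Proof.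
by move=> e0; rewrite -real_normK ?num_real // ltr_pXn2r // ?nnegrE ?normr_ge0 // ltW.
Qed.

Lemma H2_complete (u : nat -> E) : (forall n, H2 (u n)) ->
  (forall e : R, 0 < e -> exists N, forall m n, (N <= m)%N -> (N <= n)%N ->
    nrm2 (u m - u n) < e) ->
  exists2 f, H2 f & null (fun n => nrm2 (u n - f)).
Proof.
move=> hu cu.
have coefP (p : R[i] -> R) k : (forall z w, p (z - w) = p z - p w) ->
    (forall z, p z ^+ 2 <= cabs2 z) -> exists l, null (fun n => `|p (u n k) - l|).
  move=> pB p2; apply: cauchy_limit => e e0.
  have [N hN] := cu (e ^+ 2) (exprn_gt0 2 e0); exists N => m n Nm Nn.
  apply: sqr_small => //; apply: le_lt_trans (hN m n Nm Nn).
  rewrite -pB; apply: le_trans (p2 _) _; exact: (coef_le_nrm2 k (H2B (hu m) (hu n))).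
have hRe k : exists l, null (fun n => `|Re (u n k) - l|).
  by apply: coefP => [z w|z]; rewrite ?ReD ?ReN // lerDl sqr_ge0.
have hIm k : exists l, null (fun n => `|Im (u n k) - l|).
  by apply: coefP => [z w|z]; rewrite ?ImD ?ImN // lerDr sqr_ge0.
have [a ha] := choice hRe; have [b hb] := choice hIm.
pose f : E := fun k => Complex (a k) (b k).
have uf k : null (fun n => cabs2 (u n k - f k)).
  have sq v : null (fun n => `|v n|) -> null (fun n => v n ^+ 2).
    move=> hv e e0; have e1 : 0 < Num.min e 1 by rewrite lt_min e0 ltr01.
    have [N hN] := hv _ e1; exists N => n /hN h.
    rewrite -real_normK ?num_real //; apply: le_lt_trans (_ : `|v n| < e).
      by rewrite expr2 ler_piMl // ltW // (lt_le_trans h) // ge_min lexx orbT.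
    by apply: lt_le_trans h _; rewrite ge_min lexx.
  have := nullD (sq _ (ha k)) (sq _ (hb k)).
  by move=> h e /h [N hN]; exists N => n /hN; rewrite /cabs2 !ReImE.
have lim e : 0 < e -> exists N, forall n, (N <= n)%N ->
    H2 (u n - f) /\ nrm2 (u n - f) <= e.
  move=> e0; have [N hN] := cu e e0; exists N => n Nn.
  (* The index is shifted by [N] because the bound must hold for every term of the sequence. *)
  apply: (@fatou (fun m => u n - u (m + N)%N)) => // [m|k e' e'0].
    by rewrite ltW // hN // leq_addl.
  have [M hM] := uf k e' e'0; exists M => m Mm.
  suff -> : (u n - u (m + N)%N) k - (u n - f) k = - (u (m + N)%N k - f k).
    by rewrite cabs2N hM // (leq_trans Mm) // leq_addr.
  by rewrite !evE; ring.
exists f.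
  have [N hN] := lim 1 ltr01; have [h _] := hN N (leqnn N).
  by rewrite -[f](subKr (u N)); apply: H2B.
move=> e e0; have [N hN] := lim (e / 2) (divr_gt0 e0 (ltr0Sn R 1)).
exists N => n /hN[_ h]; apply: le_lt_trans h _.
by rewrite ltr_pdivrMr // mulr_natr mulr2n ltrDl.
Qed.

Lemma nrm2_parallelogram f g h : H2 f -> H2 g -> H2 h ->
  nrm2 (g - h) = 2 * nrm2 (f - g) + 2 * nrm2 (f - h)
    - 4 * nrm2 (f - rc (2^-1) *: (g + h)).
Proof.
move=> hf hg hh; rewrite !nrm2B //.
rewrite nrm2Z // nrm2D // cabs2C ipZr // ipDr // !ReImE.
by field.
Qed.

(** Membership in [numrange_S1] asks for a projection of [Mz1 h], so its existence has to be
    established. The parallelogram identity makes a minimising sequence Cauchy. *)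
Lemma projection_exists (S : set (coef2 R)) (x : E) : closed_subspace S -> H2 x ->
  exists y, is_proj S x y.
Proof.
move=> [SH S0 SD SZ Scl] hx.
pose A := [set nrm2 (x - s) | s in S]; pose D := inf A.
have lbA : has_lbound A.
  by exists 0 => _ [s Ss <-]; apply: nrm2_ge0; apply: H2B => //; exact: SH.
have A0 : A !=set0 by exists (nrm2 (x - 0)); exists 0.
have D_le s : S s -> D <= nrm2 (x - s) by move=> Ss; apply: ge_inf => //; exists s.
have ex n : exists s, S s /\ nrm2 (x - s) < D + n.+1%:R^-1.
  have e0 : 0 < n.+1%:R^-1 :> R by rewrite invr_gt0.
  by have [_ [s Ss <-] h] := inf_adherent e0 (conj A0 lbA); exists s.
have [s hs] := choice ex.
have Ss n : S (s n) by case: (hs n).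
have sH n : H2 (s n) by apply: SH.
have d2 m n : nrm2 (s m - s n) < 2 * m.+1%:R^-1 + 2 * n.+1%:R^-1.
  rewrite (nrm2_parallelogram hx (sH m) (sH n)).
  have := D_le _ (SZ (rc (2^-1)) _ (SD _ _ (Ss m) (Ss n))).
  have [_] := hs m; have [_] := hs n; rewrite -/(coef_add (s m) (s n)).
  set q1 := nrm2 _; set q2 := nrm2 _; set q3 := nrm2 _.
  move: (n.+1%:R^-1) (m.+1%:R^-1) => i1 i2; lra.
have [y hy sy] : exists2 y, H2 y & null (fun n => nrm2 (s n - y)).
  apply: H2_complete => // e e0.
  have [N hN] := @null_harmonic 2 (e / 2) (divr_gt0 e0 (ltr0Sn R 1)).
  exists N => m n /hN h1 /hN h2; apply: lt_trans (d2 m n) _.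
  by rewrite (splitr e); exact: ltrD.
have Sy : S y.
  apply: (Scl s y) => //; apply: null_cvg => // n.
  by apply: nrm2_ge0; exact: (H2B (sH n) hy).
have yD : nrm2 (x - y) <= D.
  apply/ler_addgt0Pr => e e0.
  have [N hN] := @null_harmonic 1 e e0.
  have [] := @fatou (fun n => x - s (n + N)%N) (x - y) (D + e) => //.
  - move=> n; have [_ h] := hs (n + N)%N; apply/ltW/(lt_trans h).
    by rewrite ltrD2l -[X in X < _]div1r; apply: hN; rewrite leq_addl.
  - move=> k e' /sy[M hM]; exists M => n Mn.
    apply: le_lt_trans (hM (n + N)%N (leq_trans Mn (leq_addr _ _))).
    have -> : (x - s (n + N)%N) k - (x - y) k = - (s (n + N)%N - y) k by rewrite !evE; ring.
    by rewrite cabs2N; apply: coef_le_nrm2; apply: H2B.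
exists y; split=> // t St; have ht : H2 t := SH _ St.
rewrite -[coef_sub x y]/(x - y); set z := ip _ t.
(* Step length of the variation [y + r z t]; it is short enough for the linear gain to exceed the
   quadratic loss, since [r * nrm2 t <= 1]. *)
pose r := (nrm2 t + 1)^-1; have nt := nrm2_ge0 ht.
have r0 : 0 < r by rewrite invr_gt0 ltr_wpDl.
have := D_le _ (SD _ _ Sy (SZ (rc r * z) _ St)).
have -> : nrm2 (x - coef_add y (coef_scale (rc r * z) t)) =
    nrm2 (x - y - (rc r * z) *: t).
  by congr nrm2; rewrite -addrA -opprD.
have hxy : H2 (x - y) by apply: H2B.
rewrite nrm2B // ?nrm2Z // ?ipZr //.
rewrite -/z rmorphM /= rcJ -mulrA (mulrC z^*) mulcJ cabs2M cabs2C !ReImE => h.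
apply: cabs2_eq0; apply: le_anti; rewrite cabs2_ge0 andbT.
have rt : r * nrm2 t <= 1 by rewrite mulrC ler_pdivrMr ?ltr_wpDl // mul1r lerDl.
have : r * cabs2 z * (2 - r * nrm2 t) <= 0 by move: (le_trans yD h); rewrite expr2; lra.
rewrite pmulr_lle0; last by lra.
by rewrite pmulr_rle0.
Qed.

End Limits.

(** * Shifts and division by linear factors *)

Section Shifts.
Variable R : realType.
Local Notation E := (nat * nat -> R[i]^o).
Local Notation Re := complex.Re.
Local Notation Im := complex.Im.
#[local] Hint Extern 0 (@H2 _ _) => solve [h2] : core.
Implicit Types (f g h : E) (z w : R[i]).

Definition S1 f : E := fun k => if k.1 is j.+1 then f (j, k.2) else 0.
Definition Sz f : E := fun k => if k.2 is l.+1 then f (k.1, l) else 0.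
Definition L1 f : E := fun k => f (k.1.+1, k.2).
Definition L2 f : E := fun k => f (k.1, k.2.+1).
Definition row0 f : E := fun k => if k.1 is 0%N then f k else 0.

Fixpoint divseq z w (u : nat -> R[i]) (l : nat) : R[i] :=
  if l is l'.+1 then (u l - w * divseq z w u l') / z else u 0%N / z.
(* [divz z w f] is [f] divided by the polynomial [z + w z2]. *)
Definition divz z w f : E := fun k => divseq z w (fun l => f (k.1, l)) k.2.

Lemma S1_0 f l : S1 f (0%N, l) = 0. Proof. by []. Qed.
Lemma S1_S f j l : S1 f (j.+1, l) = f (j, l). Proof. by []. Qed.
Lemma Sz_0 f j : Sz f (j, 0%N) = 0. Proof. by []. Qed.
Lemma Sz_S f j l : Sz f (j, l.+1) = f (j, l). Proof. by []. Qed.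
Lemma row0_0 f l : row0 f (0%N, l) = f (0%N, l). Proof. by []. Qed.
Lemma row0_S f j l : row0 f (j.+1, l) = 0. Proof. by []. Qed.
Definition ev_shift := (S1_0, S1_S, Sz_0, Sz_S, row0_0, row0_S).

Fact S1_linear : linear S1.
Proof. by move=> l f g; apply/funext => -[[|j] k]; rewrite !evE /= ?mulr0 ?addr0. Qed.
Fact Sz_linear : linear Sz.
Proof. by move=> l f g; apply/funext => -[j [|k]]; rewrite !evE /= ?mulr0 ?addr0. Qed.
Fact L1_linear : linear L1. Proof. by []. Qed.
Fact L2_linear : linear L2. Proof. by []. Qed.
Fact row0_linear : linear row0.
Proof. by move=> l f g; apply/funext => -[[|j] k]; rewrite !evE /= ?mulr0 ?addr0. Qed.
Fact divz_linear z w : linear (divz z w).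
Proof.
move=> l f g; apply/funext => -[j k]; rewrite !evE /divz /=.
by elim: k => [|k IH] /=; rewrite ?IH !evE; ring.
Qed.
HB.instance Definition _ := GRing.isLinear.Build _ _ _ _ S1 S1_linear.
HB.instance Definition _ := GRing.isLinear.Build _ _ _ _ Sz Sz_linear.
HB.instance Definition _ := GRing.isLinear.Build _ _ _ _ L1 L1_linear.
HB.instance Definition _ := GRing.isLinear.Build _ _ _ _ L2 L2_linear.
HB.instance Definition _ := GRing.isLinear.Build _ _ _ _ row0 row0_linear.
HB.instance Definition _ z w := GRing.isLinear.Build _ _ _ _ (divz z w) (divz_linear z w).

Lemma lin_rules (T : {linear E -> E}) : (forall f g, T (f - g) = T f - T g) *
  (forall f g, T (f + g) = T f + T g) * (forall f, T (- f) = - T f) *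
  (forall (l : R[i]) f, T (l *: f) = l *: T f) * (T 0 = 0).
Proof.
by do ?[split]; [exact: linearB|exact: linearD|exact: linearN|move=> l f; rewrite linearZ|exact: linear0].
Qed.
Lemma S1L : (forall f g, S1 (f - g) = S1 f - S1 g) *
  (forall f g, S1 (f + g) = S1 f + S1 g) * (forall f, S1 (- f) = - S1 f) *
  (forall (l : R[i]) f, S1 (l *: f) = l *: S1 f) * (S1 0 = 0).
Proof. exact: lin_rules. Qed.
Lemma SzL : (forall f g, Sz (f - g) = Sz f - Sz g) *
  (forall f g, Sz (f + g) = Sz f + Sz g) * (forall f, Sz (- f) = - Sz f) *
  (forall (l : R[i]) f, Sz (l *: f) = l *: Sz f) * (Sz 0 = 0).
Proof. exact: lin_rules. Qed.
Lemma L1L : (forall f g, L1 (f - g) = L1 f - L1 g) *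
  (forall f g, L1 (f + g) = L1 f + L1 g) * (forall f, L1 (- f) = - L1 f) *
  (forall (l : R[i]) f, L1 (l *: f) = l *: L1 f) * (L1 0 = 0).
Proof. exact: lin_rules. Qed.
Lemma L2L : (forall f g, L2 (f - g) = L2 f - L2 g) *
  (forall f g, L2 (f + g) = L2 f + L2 g) * (forall f, L2 (- f) = - L2 f) *
  (forall (l : R[i]) f, L2 (l *: f) = l *: L2 f) * (L2 0 = 0).
Proof. exact: lin_rules. Qed.
Lemma row0L : (forall f g, row0 (f - g) = row0 f - row0 g) *
  (forall f g, row0 (f + g) = row0 f + row0 g) * (forall f, row0 (- f) = - row0 f) *
  (forall (l : R[i]) f, row0 (l *: f) = l *: row0 f) * (row0 0 = 0).
Proof. exact: lin_rules. Qed.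
Fact iter_is_linear (U : lmodType R[i]) n (T : {linear U -> U}) : linear (iter n T).
Proof. by move=> l f g; elim: n => //= n ->; rewrite linearP. Qed.
HB.instance Definition _ (U : lmodType R[i]) n (T : {linear U -> U}) :=
  GRing.isLinear.Build _ _ _ _ (iter n T) (iter_is_linear n T).

Lemma divzK z w f : z != 0 -> z *: divz z w f + w *: Sz (divz z w f) = f.
Proof.
by move=> z0; apply/funext => -[j [|k]]; rewrite !evE ?ev_shift /divz /=; field.
Qed.

Lemma mulzK z w f : z != 0 -> divz z w (z *: f + w *: Sz f) = f.
Proof.
move=> z0; apply/funext => -[j k]; rewrite /divz /=.
elim: k => [|k IH] /=; first by rewrite !evE ev_shift; field.
by rewrite IH !evE ev_shift; field.
Qed.

Lemma L1S1 f : L1 (S1 f) = f. Proof. by apply/funext => -[]. Qed.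
Lemma L2Sz f : L2 (Sz f) = f. Proof. by apply/funext => -[]. Qed.
Lemma S1L1 f : S1 (L1 f) = f - row0 f.
Proof. by apply/funext => -[[|j] k]; rewrite !evE /= ?subrr ?subr0. Qed.
Lemma row0S1 f : row0 (S1 f) = 0. Proof. by apply/funext => -[[|j] k]. Qed.
Lemma row0K f : row0 (row0 f) = row0 f. Proof. by apply/funext => -[[|j] k]. Qed.
Lemma S1Sz f : S1 (Sz f) = Sz (S1 f).
Proof. by apply/funext => -[[|j] [|k]]. Qed.
Lemma L1Sz f : L1 (Sz f) = Sz (L1 f). Proof. by apply/funext => -[j [|k]]. Qed.
Lemma row0Sz f : row0 (Sz f) = Sz (row0 f).
Proof. by apply/funext => -[[|j] [|k]]. Qed.

(** An operator commuting with [Sz] commutes with multiplication by [z + w z2], hence with its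
    two-sided inverse. *)
Lemma comm_divz (T : {linear E -> E}) z w f : z != 0 ->
  (forall g, T (Sz g) = Sz (T g)) -> T (divz z w f) = divz z w (T f).
Proof.
move=> z0 TS; rewrite -{2}(divzK w f z0) linearD !linearZ /= TS.
by rewrite mulzK.
Qed.

Lemma le_sum_shift (F G : nat -> R) N : (forall i, 0 <= F i) -> G 0%N = 0 ->
  (forall i, G i.+1 = F i) ->
  \sum_(i < N) G i <= \sum_(i < N) F i <= \sum_(i < N.+1) G i.
Proof.
move=> F0 G0 GS; have e : \sum_(i < N.+1) G i = \sum_(i < N) F i.
  by rewrite big_ord_recl G0 add0r; apply: eq_bigr => i _; exact: GS.
rewrite e lexx andbT -e big_ord_recr /= lerDl.
by case: N {e} => [|N]; rewrite ?G0 ?GS.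
Qed.

Lemma psum_Sz f N : psum (Sz f) N <= psum f N <= psum (Sz f) N.+1.
Proof.
have h j M := @le_sum_shift (fun l => cabs2 (f (j, l))) (fun l => cabs2 (Sz f (j, l))) M
  (fun l => cabs2_ge0 _) (cabs20 R) (fun=> erefl).
apply/andP; split.
  by apply: ler_sum => j _; case/andP: (h j N).
rewrite /psum [leRHS]big_ord_recr /= -[leLHS]addr0 lerD //.
  by apply: ler_sum => j _; case/andP: (h j N).
by apply: sumr_ge0 => *; exact: cabs2_ge0.
Qed.

Lemma psum_S1 f N : psum (S1 f) N <= psum f N <= psum (S1 f) N.+1.
Proof.
have h M := @le_sum_shift (fun j => \sum_(l < M) cabs2 (f (j, l : nat)))
  (fun j => \sum_(l < M) cabs2 (S1 f (j, l : nat))).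
have G0 M : \sum_(l < M) cabs2 (S1 f (0%N, l : nat)) = 0.
  by rewrite big1 // => l _; exact: cabs20.
have F0 M j : 0 <= \sum_(l < M) cabs2 (f (j, l : nat)).
  by apply: sumr_ge0 => *; exact: cabs2_ge0.
have /andP[h1 h2] := h N N (F0 N) (G0 N) (fun=> erefl).
rewrite h1 /=; apply: le_trans h2 _; apply: ler_sum => j _.
by rewrite big_ord_recr /= lerDl cabs2_ge0.
Qed.

(** Interlacing partial sums have the same limit, so both shifts are isometric without any
    reindexing of infinite sums. *)
Lemma shift_H2 f g : (forall N, psum g N <= psum f N <= psum g N.+1) -> H2 f ->
  H2 g /\ nrm2 g = nrm2 f.
Proof.
move=> fg hf; have [hg le1] : H2 g /\ nrm2 g <= nrm2 f.
  apply: bounded_H2 => N; have /andP[h _] := fg N.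
  exact: le_trans h (psum_le_nrm2 N hf).
split=> //; apply: le_anti; rewrite le1 /=.
have [] // : H2 f /\ nrm2 f <= nrm2 g.
apply: bounded_H2 => N; have /andP[_ h] := fg N.
exact: le_trans h (psum_le_nrm2 N.+1 hg).
Qed.

Lemma H2_Sz f : H2 f -> H2 (Sz f).
Proof. by move=> /(shift_H2 (psum_Sz f))[]. Qed.
Lemma nrm2_Sz f : H2 f -> nrm2 (Sz f) = nrm2 f.
Proof. by move=> /(shift_H2 (psum_Sz f))[]. Qed.
Lemma H2_S1 f : H2 f -> H2 (S1 f).
Proof. by move=> /(shift_H2 (psum_S1 f))[]. Qed.
Lemma nrm2_S1 f : H2 f -> nrm2 (S1 f) = nrm2 f.
Proof. by move=> /(shift_H2 (psum_S1 f))[]. Qed.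

Lemma le_H2 f g : (forall k, cabs2 (f k) <= cabs2 (g k)) -> H2 g ->
  H2 f /\ nrm2 f <= nrm2 g.
Proof.
move=> fg hg; apply: bounded_H2 => N; apply: le_trans (psum_le_nrm2 N hg).
exact: le_psum.
Qed.

Lemma H2_row0 f : H2 f -> H2 (row0 f).
Proof.
move=> hf; have [] // := @le_H2 (row0 f) f _ hf.
by case=> [[|j] k] //; rewrite ev_shift cabs20 cabs2_ge0.
Qed.

Lemma H2_L1 f : H2 f -> H2 (L1 f).
Proof.
move=> /H2P[C hC]; apply/H2P; exists C => N; apply: le_trans (hC N.+1).
rewrite /psum [leRHS]big_ord_recl /= -[leLHS]add0r; apply: lerD.
  by apply: sumr_ge0 => *; exact: cabs2_ge0.
by apply: ler_sum => j _; rewrite [leRHS]big_ord_recr /= lerDl cabs2_ge0.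
Qed.

Lemma H2_L2 f : H2 f -> H2 (L2 f).
Proof.
move=> /H2P[C hC]; apply/H2P; exists C => N; apply: le_trans (hC N.+1).
rewrite /psum [leRHS]big_ord_recr /= -[leLHS]addr0; apply: lerD.
  by apply: ler_sum => j _; rewrite [leRHS]big_ord_recl /= lerDr cabs2_ge0.
by apply: sumr_ge0 => *; exact: cabs2_ge0.
Qed.

Lemma isometry_ip (T : {linear E -> E}) f g :
  (forall h, H2 h -> H2 (T h)) -> (forall h, H2 h -> nrm2 (T h) = nrm2 h) ->
  H2 f -> H2 g -> ip (T f) (T g) = ip f g.
Proof.
move=> hT nT hf hg; have re u v : H2 u -> H2 v -> Re (ip (T u) (T v)) = Re (ip u v).
  move=> hu hv; have := nT _ (H2D hu hv); rewrite linearD nrm2D ?nrm2D ?nT //; try exact: hT.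
  by lra.
apply: (@polarization R E (@H2 R) (fun h => ip (T h) (T g)) (fun h => ip h g)) => //.
- by move=> h hh; rewrite linearZ; apply: ipZl; exact: hT.
- by move=> h hh; exact: ipZl.
- by move=> h hh; exact: re.
Qed.

Lemma ip_disjoint f g : (forall k, f k = 0 \/ g k = 0) -> ip f g = 0.
Proof.
move=> fg; have h : ip_part f g = fun=> 0.
  apply/funext => N; rewrite /ip_part big1 // => j _; rewrite big1 // => k _.
  by case: (fg (j : nat, k : nat)) => ->; rewrite ?mul0r ?rmorph0 ?mulr0.
by rewrite /ip h; apply: complexP => /=; rewrite lim_cst.
Qed.

Lemma ip_S1l f g : H2 f -> H2 g -> ip (S1 f) g = ip f (L1 g).
Proof.
move=> hf hg; have e : g = row0 g + S1 (L1 g) by rewrite S1L1 addrC subrK.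
have hL := H2_L1 hg; rewrite {1}e ipDr; [|exact: H2_S1|exact: H2_row0|exact: H2_S1].
rewrite (@ip_disjoint (S1 f)) ?add0r; last by case=> [[|j] k]; [left|right].
by apply: isometry_ip => //; [exact: H2_S1|exact: nrm2_S1].
Qed.

Lemma ip_Szl f g : H2 f -> H2 g -> ip (Sz f) g = ip f (L2 g).
Proof.
move=> hf hg; have hL := H2_L2 hg.
have h0 : H2 (g - Sz (L2 g)) by apply: H2B => //; exact: H2_Sz.
rewrite -{1}(subrK (Sz (L2 g)) g) ipDr //; [|exact: H2_Sz|exact: H2_Sz].
rewrite (@ip_disjoint (Sz f)) ?add0r; last first.
  by case=> j [|k]; [left|right; rewrite !evE /= subrr].
by apply: isometry_ip => //; [exact: H2_Sz|exact: nrm2_Sz].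
Qed.

Lemma nrm2_L1 f : H2 f -> nrm2 f = nrm2 (row0 f) + nrm2 (L1 f).
Proof.
move=> hf; have hr := H2_row0 hf; have hL := H2_L1 hf.
have e : f = row0 f + S1 (L1 f) by rewrite S1L1 addrC subrK.
rewrite {1}e nrm2D //; last exact: H2_S1.
rewrite nrm2_S1 // ip_disjoint; first by ring.
by case=> [[|j] k]; [right|left].
Qed.

Lemma ip_delta f k0 : H2 f ->
  H2 ((fun k => (k == k0)%:R) : E) /\ ip f ((fun k => (k == k0)%:R) : E) = f k0.
Proof.
move=> hf; set e : E := fun k => _.
have eN N : psum e N <= 1.
  rewrite /psum; apply: (@le_trans _ _ (\sum_(j < N) ((j : nat) == k0.1)%:R)).
    apply: ler_sum => j _.
    apply: (@le_trans _ _ (\sum_(l < N) (((j : nat) == k0.1) && ((l : nat) == k0.2))%:R)).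
      apply: ler_sum => l _; rewrite /e [k0 in _ == k0]surjective_pairing.
      by rewrite xpair_eqE; case: (_ && _); rewrite ?cabs21 ?cabs20.
    case: eqP => _ /=; last by rewrite big1.
    have [kN|kN] := ltnP k0.2 N; last first.
      by rewrite big1 // => l _; case: eqP => // lk; rewrite -lk leqNgt ltn_ord in kN.
    rewrite (bigD1 (Ordinal kN)) //= eqxx big1 ?addr0 // => l lk.
    by case: eqP => // lk'; move: lk; rewrite -val_eqE /= lk' eqxx.
  have [kN|kN] := ltnP k0.1 N; last first.
    by rewrite big1 // => l _; case: eqP => // lk; rewrite -lk leqNgt ltn_ord in kN.
  rewrite (bigD1 (Ordinal kN)) //= eqxx big1 ?addr0 // => l lk.
  by case: eqP => // lk'; move: lk; rewrite -val_eqE /= lk' eqxx.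
have [he _] := bounded_H2 eN; split=> //.
have h0 : H2 (f - f k0 *: e) by [].
rewrite -[f in ip f _](subrK (f k0 *: e)) ipDl //.
rewrite ip_disjoint ?add0r; last first.
  move=> k; have [->|kk] := eqVneq k k0; last by right; rewrite /e (negbTE kk).
  by left; rewrite !evE /e eqxx mulr1 subrr.
rewrite ipZl // ipff //.
suff -> : nrm2 e = 1 by rewrite rc1 mulr1.
apply: le_anti; have [_ ->] := bounded_H2 eN.
by have := coef_le_nrm2 k0 he; rewrite /e eqxx cabs21.
Qed.

End Shifts.

(** * Convexity of the numerical range *)

Section ToeplitzHausdorff.
Variable R : realType.
Local Notation E := (nat * nat -> R[i]^o).
Local Notation Re := complex.Re.
Local Notation Im := complex.Im.
Implicit Types (f g h : E) (z w : R[i]).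
#[local] Hint Extern 0 (@H2 _ _) => solve [h2] : core.

(** The number [s = q - p^*] satisfies [Im (s p + s^* q) = 0], and [al] is [s] normalised. If
    [s = 0] then [q = p^*] and [p + q] is already real. *)
Lemma real_combination (p q : R[i]) :
  exists2 al : R[i], cabs2 al = 1 & Im (al * p + al^* * q) = 0.
Proof.
pose s := Complex (Re q - Re p) (Im p + Im q).
have ims : Im (s * p + s^* * q) = 0 by rewrite !ReImE /=; ring.
have [s0|s0] := eqVneq (cabs2 s) 0.
  exists 1; first exact: cabs21.
  move: s0 => /cabs2_eq0 [h1 h2']; rewrite !ReImE; lra.
have sp : 0 < cabs2 s by rewrite lt_def s0 cabs2_ge0.
exists (s * rc (Num.sqrt (cabs2 s))^-1).
  by rewrite cabs2M cabs2C exprVn sqr_sqrtr ?cabs2_ge0 // divff.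
have -> : s * rc (Num.sqrt (cabs2 s))^-1 * p + (s * rc (Num.sqrt (cabs2 s))^-1)^* * q =
  rc (Num.sqrt (cabs2 s))^-1 * (s * p + s^* * q).
  by rewrite rmorphM /= rcJ; ring.
by rewrite Im_rcM ims mulr0.
Qed.

Lemma quadratic_root (t b : R) : 0 < t -> t < 1 ->
  exists r, t * r ^+ 2 + b * r - (1 - t) = 0.
Proof.
move=> t0 t1; pose d := b ^+ 2 + 4 * t * (1 - t).
have d0 : 0 <= d by rewrite addr_ge0 ?sqr_ge0 // !mulr_ge0 // ?subr_ge0 ltW.
have ds := sqr_sqrtr d0; exists ((- b + Num.sqrt d) / (2 * t)).
have -> : t * ((- b + Num.sqrt d) / (2 * t)) ^+ 2 + b * ((- b + Num.sqrt d) / (2 * t)) -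
  (1 - t) = (Num.sqrt d ^+ 2 - d) / (4 * t) by rewrite /d; field; exact: lt0r_neq0.
by rewrite ds subrr mul0r.
Qed.

(** The form [B], divided by [del], takes the values [0] at [h1] and [1] at [h2']. The phase [al]
    makes its cross term real, so it is real along [r al h1 + h2'], and [r] is solved for the
    prescribed value [t]. *)
Lemma toeplitz_hausdorff (S : set E) h1 h2' (t : R) :
  S `<=` @H2 R -> (forall f g, S f -> S g -> S (f + g)) ->
  (forall (l : R[i]) f, S f -> S (l *: f)) -> 0 <= t <= 1 ->
  S h1 -> nrm2 h1 = 1 -> S h2' -> nrm2 h2' = 1 ->
  exists h, [/\ S h, nrm2 h = 1 &
    ip (S1 h) h = rc (1 - t) * ip (S1 h1) h1 + rc t * ip (S1 h2') h2'].
Proof.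
move=> SH SD SZ /andP[t0 t1] Sh1 n1 Sh2 n2.
set w1 := ip (S1 h1) h1; set w2 := ip (S1 h2') h2'.
have [->|tn0] := eqVneq t 0.
  by exists h1; split=> //; rewrite subr0 rc1 rc0 mul1r mul0r addr0.
have [->|tn1] := eqVneq t 1.
  by exists h2'; split=> //; rewrite subrr rc1 rc0 mul1r mul0r add0r.
have tp : 0 < t by rewrite lt_def tn0.
have tl : t < 1 by rewrite lt_def eq_sym tn1.
have [e12|ne] := eqVneq w1 w2.
  exists h1; split=> //; rewrite -e12 -mulrDl -rcD subrK rc1 mul1r //.
have H1 := SH _ Sh1; have H2' := SH _ Sh2.
pose del := w2 - w1; have del0 : del != 0 by rewrite subr_eq0 eq_sym.
pose B f g := ip (S1 f) g - w1 * ip f g.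
pose p := B h1 h2' / del; pose q := B h2' h1 / del.
have [al al1 im0] := real_combination p q.
set s := al * p + al^* * q in im0; pose b := Re s.
have sb : s = rc b by apply: complexP; rewrite ?ReC ?ImC.
pose sg := Re (al * ip h1 h2').
(* This is [r b + 1 = t * nrm2 g] with [nrm2 g = r ^+ 2 + 1 + 2 * r * sg] expanded. *)
have [r hr] := quadratic_root (2 * t * sg - b) tp tl.
pose g : E := (rc r * al) *: h1 + h2'.
have Sg : S g by apply: SD => //; exact: SZ.
have hg : H2 g := SH _ Sg.
have B11 : B h1 h1 = 0 by rewrite /B -/w1 ipff // n1 rc1 mulr1 subrr.
have B22 : B h2' h2' = del by rewrite /B -/w2 ipff // n2 rc1 mulr1.
have HS1 := H2_S1 H1; have HS2 := H2_S1 H2'.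
have Bexp : B g g = rc r ^+ 2 * B h1 h1 + rc r * (al * B h1 h2' + al^* * B h2' h1) + B h2' h2'.
  rewrite /B /g !S1L !ipDl ?ipDr // ?ipZl // ?ipZr // ?ipDr // ?ipZr //; try h2.
  rewrite !rmorphM /= rcJ.
  have : al * al^* = 1 by rewrite mulcJ al1 rc1.
  move: (al^*) => al' e.
  have -> : rc r ^+ 2 = rc r ^+ 2 * (al * al') by rewrite e mulr1.
  ring.
have Bg : B g g = del * rc (r * b + 1).
  rewrite Bexp B11 B22 mulr0 add0r.
  have -> : al * B h1 h2' + al^* * B h2' h1 = del * s by rewrite /s /p /q; field.
  by rewrite sb rcD rcM rc1; ring.
have ng : nrm2 g = r ^+ 2 + 1 + 2 * r * sg.
  rewrite /g nrm2D //.
  have e : Re (rc r * al * ip h1 h2') = r * sg by rewrite -mulrA Re_rcM.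
  rewrite nrm2Z // cabs2M cabs2C al1 n1 n2 ipZl // e; ring.
have key : r * b + 1 = t * nrm2 g by rewrite ng; lra.
have g0 : 0 < nrm2 g.
  rewrite lt_def nrm2_ge0 // andbT; apply/eqP => ng0.
  have gz : g = 0 by apply: nrm2_eq0 => //; rewrite ng0.
  have h2E : h2' = - (rc r * al) *: h1.
    by rewrite scaleNr; apply/eqP; rewrite -addr_eq0 addrC; apply/eqP.
  have : B h2' h2' = 0.
    rewrite h2E /B !S1L !ipZl // ?ipZr //; try h2.
    have := B11; rewrite /B => e.
    set l1 := - (rc r * al); set l2 := l1^*.
    have -> : l1 * (l2 * ip (S1 h1) h1) - w1 * (l1 * (l2 * ip h1 h1)) =
      l1 * l2 * (ip (S1 h1) h1 - w1 * ip h1 h1) by ring.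
    by rewrite e mulr0.
  by rewrite B22 => e; rewrite e eqxx in del0.
pose m := Num.sqrt (nrm2 g); have m0 : 0 < m by rewrite sqrtr_gt0.
have m2 : m^-1 ^+ 2 * nrm2 g = 1.
  by rewrite exprVn sqr_sqrtr ?mulVf ?gt_eqF // ltW.
have hSg := H2_S1 hg.
exists (rc m^-1 *: g); split; first exact: SZ.
  by rewrite nrm2Z // cabs2C.
rewrite S1L ipZl //.
rewrite ipZr // rcJ mulrA -rcM -expr2.
have -> : ip (S1 g) g = B g g + w1 * rc (nrm2 g) by rewrite /B ipff // subrK.
rewrite Bg key (rcM t) mulrDr.
have -> : rc (m^-1 ^+ 2) * (del * (rc t * rc (nrm2 g))) = del * rc t * rc (m^-1 ^+ 2 * nrm2 g).
  by rewrite (rcM (m^-1 ^+ 2)); ring.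
have -> : rc (m^-1 ^+ 2) * (w1 * rc (nrm2 g)) = w1 * rc (m^-1 ^+ 2 * nrm2 g).
  by rewrite (rcM (m^-1 ^+ 2)); ring.
rewrite m2 rc1 rcD rcN rc1 /del; ring.
Qed.

End ToeplitzHausdorff.

(** * Support functions in the plane *)

Section PlaneConvexity.
Variable R : realType.
Implicit Types (z w u : R * R) (W : set (R * R)).

Definition dot u z : R := u.1 * z.1 + u.2 * z.2.
Definition unit_vec u := u.1 ^+ 2 + u.2 ^+ 2 = 1.
Definition convex_comb (t : R) z w : R * R :=
  ((1 - t) * z.1 + t * w.1, (1 - t) * z.2 + t * w.2).
Definition convex_plane W := forall z w (t : R), 0 <= t <= 1 -> W z -> W w ->
  W (convex_comb t z w).

Lemma dot_convex u t z w : dot u (convex_comb t z w) = (1 - t) * dot u z + t * dot u w.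
Proof. rewrite /dot /=; ring. Qed.

Lemma scaled_unit_vec (n : R * R) : n.1 ^+ 2 + n.2 ^+ 2 != 0 ->
  exists r, 0 < r /\ unit_vec (r * n.1, r * n.2).
Proof.
move=> n0; have np : 0 < n.1 ^+ 2 + n.2 ^+ 2 by rewrite lt_def n0 addr_ge0 ?sqr_ge0.
exists (Num.sqrt (n.1 ^+ 2 + n.2 ^+ 2))^-1; split; first by rewrite invr_gt0 sqrtr_gt0.
by rewrite /unit_vec /= !exprMn -mulrDr exprVn sqr_sqrtr ?mulVf // ltW.
Qed.

(** In orthogonal coordinates [P], [Q] centred at [z], with [w0] on the positive [P]-axis, convexity
    keeps [W] off the closed negative [P]-axis. Hence the quotients [P / Q] in the upper half-plane
    dominate those in the lower one, and their infimum is the slope of a separating line. Closedness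
    of [W] is not assumed, so [z] may be a boundary point. *)
Lemma weak_separation W z : convex_plane W -> W !=set0 -> ~ W z ->
  exists2 u, unit_vec u & forall w, W w -> dot u w <= dot u z.
Proof.
move=> cW [w0 Ww0] nWz.
pose d1 := w0.1 - z.1; pose d2 := w0.2 - z.2.
pose P w := (w.1 - z.1) * d1 + (w.2 - z.2) * d2.
pose Q w := (w.2 - z.2) * d1 - (w.1 - z.1) * d2.
have d0 : 0 < d1 ^+ 2 + d2 ^+ 2.
  rewrite lt_def addr_ge0 ?sqr_ge0 // andbT paddr_eq0 ?sqr_ge0 // !sqrf_eq0.
  apply/negP => /andP[/eqP e1 /eqP e2]; apply: nWz.
  suff -> : z = w0 by [].
  move: e1 e2; rewrite /d1 /d2 => /eqP; rewrite subr_eq0 => /eqP e1 /eqP.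
  by rewrite subr_eq0 => /eqP e2; rewrite [z]surjective_pairing -e1 -e2 -surjective_pairing.
have PQz w : P w = 0 -> Q w = 0 -> w = z.
  move=> p0 q0.
  have e1 : (w.1 - z.1) * (d1 ^+ 2 + d2 ^+ 2) = 0.
    by transitivity (P w * d1 - Q w * d2); [rewrite /P /Q; ring|rewrite p0 q0; ring].
  have e2 : (w.2 - z.2) * (d1 ^+ 2 + d2 ^+ 2) = 0.
    by transitivity (P w * d2 + Q w * d1); [rewrite /P /Q; ring|rewrite p0 q0; ring].
  move: e1 e2 => /eqP; rewrite mulf_eq0 (gt_eqF d0) orbF subr_eq0 => /eqP e1 /eqP.
  rewrite mulf_eq0 (gt_eqF d0) orbF subr_eq0 => /eqP e2.
  by rewrite [w]surjective_pairing e1 e2 -surjective_pairing.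
have Pc t v w : P (convex_comb t v w) = (1 - t) * P v + t * P w by rewrite /P /=; ring.
have Qc t v w : Q (convex_comb t v w) = (1 - t) * Q v + t * Q w by rewrite /Q /=; ring.
have P0 : P w0 = d1 ^+ 2 + d2 ^+ 2 by rewrite /P -/d1 -/d2; ring.
have Q0 : Q w0 = 0 by rewrite /Q -/d1 -/d2; ring.
have axis w : W w -> Q w = 0 -> 0 < P w.
  move=> Ww qw; rewrite ltNge; apply/negP => pw; apply: nWz.
  have dd : 0 < P w0 - P w by rewrite P0; lra.
  have <- : convex_comb (- P w / (P w0 - P w)) w w0 = z.
    by apply: PQz; rewrite ?Pc ?Qc ?qw ?Q0; [field; exact: lt0r_neq0|ring].
  apply: cW => //; rewrite ler_pdivlMr // ler_pdivrMr // mul0r mul1r oppr_ge0 pw /=.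
  by rewrite lerDr P0 ltW.
(* The segment from the upper point to the lower one crosses the axis, where [P] is positive by
   [axis]. *)
have cross w w' : W w -> W w' -> 0 < Q w -> Q w' < 0 ->
    0 < P w / Q w + P w' / (- Q w').
  move=> Ww Ww' qw qw'; have dd : 0 < Q w - Q w' by lra.
  have := axis (convex_comb (Q w / (Q w - Q w')) w w').
  have -> : Q (convex_comb (Q w / (Q w - Q w')) w w') = 0.
    by rewrite Qc; field; exact: lt0r_neq0.
  have Wm : W (convex_comb (Q w / (Q w - Q w')) w w').
    apply: cW => //; rewrite ler_pdivlMr // ler_pdivrMr // mul0r mul1r ltW //=.
    by rewrite lerDl oppr_ge0 ltW.
  move=> /(_ Wm erefl); rewrite Pc.
  have -> : (1 - Q w / (Q w - Q w')) * P w + Q w / (Q w - Q w') * P w' =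
     (P w / Q w + P w' / (- Q w')) * (Q w * (- Q w') / (Q w - Q w')).
    field; rewrite ?oppr_eq0 ?(gt_eqF qw) ?(lt_eqF qw') ?(gt_eqF dd) //.
  rewrite pmulr_lgt0 // divr_gt0 // mulr_gt0 // oppr_gt0 //.
have [m [n [mn0 hmn]]] : exists m n : R, m ^+ 2 + n ^+ 2 != 0 /\
    forall w, W w -> 0 <= m * P w + n * Q w.
  have [[wu [Wu qu]]|nou] := pselect (exists w, W w /\ 0 < Q w); last first.
    exists 0, (-1); split; first by rewrite expr0n sqrrN expr1n add0r oner_eq0.
    move=> w Ww; rewrite mul0r add0r mulN1r oppr_ge0 leNgt; apply/negP => qw.
    by apply: nou; exists w.
  have [[wl [Wl ql]]|nol] := pselect (exists w, W w /\ Q w < 0); last first.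
    exists 0, 1; split; first by rewrite expr0n expr1n add0r oner_eq0.
    move=> w Ww; rewrite mul0r add0r mul1r leNgt; apply/negP => qw.
    by apply: nol; exists w.
  pose A := [set P w / Q w | w in [set w | W w /\ 0 < Q w]].
  have lbA w' : W w' -> Q w' < 0 -> lbound A (- (P w' / (- Q w'))).
    move=> Ww' qw' _ [w [Ww qw] <-]; have := cross _ _ Ww Ww' qw qw'; lra.
  have hlA : has_lbound A by exists (- (P wl / (- Q wl))); exact: lbA.
  have A0 : A !=set0 by exists (P wu / Q wu), wu.
  exists 1, (- inf A); split.
    by rewrite expr1n gt_eqF // ltr_pwDl // sqr_ge0.
  move=> w Ww; rewrite mul1r mulNr subr_ge0.
  have [qw|qw|qw] := ltgtP (Q w) 0.
  - have qn : 0 < - Q w by rewrite oppr_gt0.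
    have h : - inf A <= P w / - Q w by rewrite lerNl; exact: lb_le_inf A0 (lbA _ Ww qw).
    by move: h; rewrite ler_pdivlMr // mulrNN.
  - have h : inf A <= P w / Q w by apply: ge_inf => //; exists w.
    by move: h; rewrite ler_pdivlMr.
  - by rewrite qw mulr0 ltW // axis.
pose a1 := m * d1 - n * d2; pose a2 := m * d2 + n * d1.
have an : a1 ^+ 2 + a2 ^+ 2 != 0.
  have -> : a1 ^+ 2 + a2 ^+ 2 = (m ^+ 2 + n ^+ 2) * (d1 ^+ 2 + d2 ^+ 2).
    by rewrite /a1 /a2; ring.
  by rewrite mulf_neq0 // gt_eqF.
have an' : (- a1) ^+ 2 + (- a2) ^+ 2 != 0 by rewrite !sqrrN.
have [r [r0 ur]] := @scaled_unit_vec (- a1, - a2) an'.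
exists (r * - a1, r * - a2) => // w /hmn h.
rewrite -subr_ge0; have -> : dot (r * - a1, r * - a2) z - dot (r * - a1, r * - a2) w =
  r * (m * P w + n * Q w) by rewrite /dot /a1 /a2 /P /Q /=; ring.
by rewrite mulr_ge0 // ltW.
Qed.

Lemma unit_angle u : unit_vec u -> exists t, [/\ 0 <= t < 2 * pi, cos t = u.1 & sin t = u.2].
Proof.
case: u => x y; rewrite /unit_vec /= => xy.
have y20 := sqr_ge0 y; have x1 : -1 <= x <= 1 by apply/andP; split; nra.
have y2 : Num.sqrt (1 - x ^+ 2) = `|y| by rewrite -sqrtr_sqr; congr Num.sqrt; lra.
have p0 : 0 < pi :> R := pi_gt0 R.
have xin : x \in `[(-1), 1] by rewrite in_itv.
have [y0|y0] := lerP 0 y.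
  exists (acos x); split; [|by rewrite acosK|by rewrite sin_acos // y2 ger0_norm].
  by rewrite acos_ge0 //=; have := acos_lepi x1; lra.
have xn1 : x < 1.
  by move: x1 => /andP[_]; rewrite le_eqVlt => /orP[/eqP e|//]; move: xy; rewrite e; nra.
have ac0 : 0 < acos x by apply: acos_gt0; case/andP: x1 => ->.
exists (2 * pi - acos x).
have e2 : 2 * pi = pi *+ 2 :> R by rewrite mulr_natl.
split; first by have := acos_lepi x1; lra.
  by rewrite cosB e2 cos2pi sin2pi acosK // mul1r mul0r addr0.
by rewrite sinB e2 cos2pi sin2pi mul0r mul1r sub0r sin_acos // y2 ltr0_norm // opprK.
Qed.

End PlaneConvexity.

(** * The curve as the envelope of its support lines *)

Section Envelope.
Variables (R : realType) (k : R).
Hypotheses (k0 : 0 < k) (k1 : k < 1).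
Implicit Types (z w u : R * R).

Definition rad u : R := Num.sqrt ((u.1 - k) ^+ 2 + u.2 ^+ 2).
Definition supportf u : R := k * u.1 + k * (1 - k) + (1 - k) * rad u.
Definition phase (t : R) : R := asin (k * sin t).
(** The point where the ray from [(k, 0)] at angle [t] meets the unit circle: by the law of sines
    [e^(i (t - phase t)) - k] is a positive multiple of [e^(it)]. *)
Definition contact (t : R) : R * R := (cos (t - phase t), sin (t - phase t)).
Definition env (t : R) : R * R :=
  (k + (1 - k) * cos t + k * (1 - k) * (1 - cos t) * cos (t - phase t),
   (1 - k) * sin t + k * (1 - k) * (1 - cos t) * sin (t - phase t)).

Lemma unit_cossin (t : R) : unit_vec (cos t, sin t). Proof. exact: cos2Dsin2. Qed.

Lemma rad_sqr u : unit_vec u -> rad u ^+ 2 = 1 - 2 * k * u.1 + k ^+ 2.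
Proof.
move=> uu; rewrite sqr_sqrtr ?addr_ge0 ?sqr_ge0 //; move: uu; rewrite /unit_vec; lra.
Qed.

Lemma rad_ge0 u : 0 <= rad u. Proof. exact: sqrtr_ge0. Qed.

Lemma unit_vec_le1 u : unit_vec u -> -1 <= u.1 <= 1.
Proof. by rewrite /unit_vec => uu; have u20 := sqr_ge0 u.2; apply/andP; split; nra. Qed.

Lemma rad_gt0 u : unit_vec u -> 0 < rad u.
Proof.
move=> uu; rewrite lt_def rad_ge0 andbT; apply/eqP => r0.
have /andP[_ u1] := unit_vec_le1 uu.
have h1 : 0 <= k * (1 - u.1) by rewrite mulr_ge0 ?subr_ge0 // ltW.
have h2 : 0 < (1 - k) ^+ 2 by rewrite exprn_gt0 // subr_gt0.
by have := rad_sqr uu; rewrite r0 expr0n /= => e; move: h1 h2; lra.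
Qed.

Lemma phase_arg (t : R) : -1 <= k * sin t <= 1.
Proof.
have /andP[s1 s2] := @unit_vec_le1 (sin t, cos t) (esym (etrans (esym (cos2Dsin2 t)) (addrC _ _))).
have h1 : 0 <= k * (1 - sin t) by apply: mulr_ge0; [exact: ltW|rewrite subr_ge0].
have h2 : 0 <= k * (sin t - -1) by apply: mulr_ge0; [exact: ltW|rewrite subr_ge0].
by have kk := k1; apply/andP; split; lra.
Qed.

Lemma sin_phase (t : R) : sin (phase t) = k * sin t.
Proof. by rewrite /phase asinK // in_itv /= phase_arg. Qed.

Lemma cos_phase_ge0 (t : R) : 0 <= cos (phase t).
Proof. by rewrite /phase cos_asin ?phase_arg // sqrtr_ge0. Qed.

Lemma contact_rad t : rad (contact t) = cos (phase t) - k * cos t.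
Proof.
have cs := cos2Dsin2 t; have ps := cos2Dsin2 (phase t).
have p0 := cos_phase_ge0 t; have sp := sin_phase t.
have k2 : k ^+ 2 <= 1 by rewrite expr_le1 ?ltW // ltW.
have ge : 0 <= cos (phase t) - k * cos t.
  have h : (k * cos t) ^+ 2 <= cos (phase t) ^+ 2.
    have -> : cos (phase t) ^+ 2 = 1 - k ^+ 2 * sin t ^+ 2 by move: ps; rewrite sp; lra.
    have -> : sin t ^+ 2 = 1 - cos t ^+ 2 by lra.
    by move: k2; have := sqr_ge0 (cos t); rewrite exprMn; lra.
  rewrite subr_ge0; apply: le_trans (ler_norm _) _.
  by rewrite -(ler_pXn2r (n := 2)) ?nnegrE // real_normK ?num_real.
rewrite /rad -[RHS]ger0_norm // -sqrtr_sqr; congr Num.sqrt.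
rewrite /contact /= cosB sinB sp; move: cs ps; rewrite sp.
move: (cos t) (sin t) (cos (phase t)) => C S p cs ps.
have -> : C * p + S * (k * S) - k = C * p - k * C ^+ 2 by rewrite -[X in - X]mulr1 -cs; ring.
have -> : (C * p - k * C ^+ 2) ^+ 2 + (S * p - C * (k * S)) ^+ 2 =
  (C ^+ 2 + S ^+ 2) * (p - k * C) ^+ 2 by ring.
by rewrite cs mul1r.
Qed.

Lemma dot_le_rad (t : R) u : cos t * (u.1 - k) + sin t * u.2 <= rad u.
Proof.
apply: le_trans (ler_norm _) _; rewrite -sqrtr_sqr ler_sqrt; last first.
  by rewrite addr_ge0 ?sqr_ge0.
have cs := cos2Dsin2 t; rewrite -subr_ge0.
have -> : (u.1 - k) ^+ 2 + u.2 ^+ 2 - (cos t * (u.1 - k) + sin t * u.2) ^+ 2 =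
  (sin t * (u.1 - k) - cos t * u.2) ^+ 2 +
  (1 - (cos t ^+ 2 + sin t ^+ 2)) * ((u.1 - k) ^+ 2 + u.2 ^+ 2) by ring.
by rewrite cs subrr mul0r addr0 sqr_ge0.
Qed.

Lemma cos_le1' (t : R) : cos t <= 1.
Proof. by case/andP: (unit_vec_le1 (unit_cossin t)). Qed.

(** Two inequalities are added: [e^(it)] against [u - k] is at most [rad u], and [contact t] against
    [u] is at most [1]. The terms in [cos t] cancel. Both are equalities at [u = contact t]. *)
Lemma env_le_support t u : unit_vec u -> dot u (env t) <= supportf u.
Proof.
move=> uu; have h := dot_le_rad t u.
have -> : dot u (env t) = k * u.1 + (1 - k) * (cos t * u.1 + sin t * u.2) +
   k * (1 - k) * (1 - cos t) * dot u (contact t) by rewrite /dot /env /contact /=; ring.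
have c1 := cos_le1' t.
have d1 : dot u (contact t) <= 1.
  have cu : unit_vec (contact t) := unit_cossin _.
  have := sqr_ge0 (u.1 - (contact t).1); have := sqr_ge0 (u.2 - (contact t).2).
  move: uu cu; rewrite /unit_vec /dot; lra.
have kk : 0 <= k * (1 - k) * (1 - cos t) by rewrite !mulr_ge0 ?subr_ge0 // ltW.
have := ler_wpM2l kk d1; have k1' : 0 <= 1 - k by rewrite subr_ge0 ltW.
have := ler_wpM2l k1' h; rewrite /supportf; lra.
Qed.

Lemma env_support t : dot (contact t) (env t) = supportf (contact t).
Proof.
rewrite /supportf contact_rad /dot /contact /env /=.
have cs := cos2Dsin2 t; have ps := cos2Dsin2 (phase t).
have us := cos2Dsin2 (t - phase t); have cb := cosB t (t - phase t).
rewrite opprB addrC subrK in cb; rewrite cb.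
have -> : k * cos (t - phase t) + k * (1 - k) + (1 - k) *
   (cos t * cos (t - phase t) + sin t * sin (t - phase t) - k * cos t) =
   k * cos (t - phase t) + k * (1 - k) * (cos (t - phase t) ^+ 2 + sin (t - phase t) ^+ 2) +
   (1 - k) *
   (cos t * cos (t - phase t) + sin t * sin (t - phase t) -
    k * cos t * (cos (t - phase t) ^+ 2 + sin (t - phase t) ^+ 2)).
  by rewrite us !mulr1.
ring.
Qed.

(* Tangency at [u0] determines the point: [supportf] lies below an explicit affine function of
   [u] touching it at [u0], by concavity of the square root. *)
Lemma support_unique z w u0 : unit_vec u0 ->
  (forall u, unit_vec u -> dot u z <= supportf u) -> dot u0 z = supportf u0 ->
  (forall u, unit_vec u -> dot u w <= supportf u) -> dot u0 w = supportf u0 -> z = w.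
Proof.
move=> uu0; set r := rad u0; have r0 : 0 < r := rad_gt0 uu0.
(* On unit vectors [rad u <= (rad u ^+ 2 + r ^+ 2) / (2 * r)] with [rad u ^+ 2] affine in [u.1]; [A]
   and [B] are the resulting constant and linear coefficients. *)
pose B := k - (1 - k) * k / r.
pose A := k * (1 - k) + (1 - k) * (1 + k ^+ 2 + r ^+ 2) / (2 * r).
have le u : unit_vec u -> supportf u <= A + B * u.1.
  move=> uu; have e := rad_sqr uu; have rg := rad_ge0 u.
  have hp : 0 <= (1 - k) * ((rad u - r) ^+ 2 / (2 * r)).
    by apply: mulr_ge0; rewrite ?subr_ge0 ?divr_ge0 ?sqr_ge0 ?mulr_ge0 ?(ltW k1) // ltW.
  rewrite -subr_ge0.
  suff -> : A + B * u.1 - supportf u = (1 - k) * ((rad u - r) ^+ 2 / (2 * r)) by [].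
  have -> : (rad u - r) ^+ 2 = 1 - 2 * k * u.1 + k ^+ 2 - 2 * r * rad u + r ^+ 2.
    by rewrite -e; ring.
  by rewrite /A /B /supportf; field; exact: lt0r_neq0.
have eq0 : supportf u0 = A + B * u0.1.
  have e := rad_sqr uu0; rewrite -/r in e.
  have -> : A + B * u0.1 = k * u0.1 + k * (1 - k) +
     (1 - k) * ((1 - 2 * k * u0.1 + k ^+ 2 + r ^+ 2) / (2 * r)).
    by rewrite /A /B; field; exact: lt0r_neq0.
  rewrite -e /supportf -/r; congr (_ + _ * _); field; exact: lt0r_neq0.
(* [A + B * u.1] is the support function of the disc of radius [A] about [(B, 0)]. The point [v]
   lies in this disc, and equality at [u0] leaves a single point of its circle. *)
suff uniq v : (forall u, unit_vec u -> dot u v <= supportf u) ->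
    dot u0 v = supportf u0 -> v = (B + A * u0.1, A * u0.2).
  by move=> h1 h2 h3 h4; rewrite (uniq z) // (uniq w).
move=> hv ev; pose x := v.1 - B; pose y := v.2.
have dA : u0.1 * x + u0.2 * y = A.
  by move: ev; rewrite eq0 /dot /x /y => ev; lra.
have lA : x ^+ 2 + y ^+ 2 <= A ^+ 2.
  have [n0|n0] := eqVneq (x ^+ 2 + y ^+ 2) 0; first by rewrite n0 sqr_ge0.
  have [s [s0 us]] := @scaled_unit_vec R (x, y) n0.
  have h := hv _ us; have h' := le _ us; move: (le_trans h h').
  rewrite /dot /= => h2.
  have h3 : s * (x ^+ 2 + y ^+ 2) <= A by move: h2; rewrite /x /y; lra.
  have n1 : s ^+ 2 * (x ^+ 2 + y ^+ 2) = 1 by move: us; rewrite /unit_vec /=; lra.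
  have s3 : 0 <= s * (x ^+ 2 + y ^+ 2) by rewrite mulr_ge0 ?addr_ge0 ?sqr_ge0 // ltW.
  have : (s * (x ^+ 2 + y ^+ 2)) ^+ 2 <= A ^+ 2.
    by rewrite ler_pXn2r ?nnegrE // (le_trans s3).
  have -> : (s * (x ^+ 2 + y ^+ 2)) ^+ 2 = (s ^+ 2 * (x ^+ 2 + y ^+ 2)) * (x ^+ 2 + y ^+ 2) by ring.
  by rewrite n1 mul1r.
have : (x - A * u0.1) ^+ 2 + (y - A * u0.2) ^+ 2 <= 0.
  have -> : (x - A * u0.1) ^+ 2 + (y - A * u0.2) ^+ 2 = x ^+ 2 + y ^+ 2
    - 2 * A * (u0.1 * x + u0.2 * y) + A ^+ 2 * (u0.1 ^+ 2 + u0.2 ^+ 2) by ring.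
  by rewrite dA uu0; lra.
move=> h; have /andP[/eqP e1 /eqP e2] : (x - A * u0.1 == 0) && (y - A * u0.2 == 0).
  rewrite -[_ == 0]sqrf_eq0 -[y - _ == 0]sqrf_eq0 -paddr_eq0 ?sqr_ge0 //.
  by rewrite eq_le h addr_ge0 ?sqr_ge0.
rewrite [v]surjective_pairing; congr pair; move: e1 e2; rewrite /x /y; lra.
Qed.

(** The parameter is the argument of [u - k]. *)
Lemma contact_surj u : unit_vec u -> exists2 t, 0 <= t < 2 * pi & contact t = u.
Proof.
move=> uu; have r0 := rad_gt0 uu; have e := rad_sqr uu; set r := rad u in r0 e.
have ne : r != 0 := lt0r_neq0 r0.
have uv : unit_vec ((u.1 - k) / r, u.2 / r).
  rewrite /unit_vec /= !expr_div_n -mulrDl e; move: uu; rewrite /unit_vec => uu.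
  have -> : (u.1 - k) ^+ 2 + u.2 ^+ 2 = 1 - 2 * k * u.1 + k ^+ 2 by lra.
  by rewrite -e divff // expf_neq0.
have [t [tpi ct st]] := unit_angle uv; exists t => //; move: ct st => /= ct st.
have sp := sin_phase t; have p0 := cos_phase_ge0 t.
have kp : 0 <= (1 - k * u.1) / r.
  have /andP[u1 u2] := unit_vec_le1 uu; have h1 : 0 <= k * (1 - u.1) by apply: mulr_ge0; [exact: ltW|rewrite subr_ge0].
  by apply: divr_ge0; [have := k1; lra|exact: ltW].
have cp : cos (phase t) = (1 - k * u.1) / r.
  apply/eqP; rewrite -(eqrXn2 (n := 2)) //.
  have := cos2Dsin2 (phase t); rewrite sp st => h.
  have -> : cos (phase t) ^+ 2 = 1 - (k * (u.2 / r)) ^+ 2 by lra.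
  have -> : 1 - (k * (u.2 / r)) ^+ 2 = (r ^+ 2 - k ^+ 2 * u.2 ^+ 2) / r ^+ 2 by field.
  rewrite expr_div_n e; apply/eqP; congr (_ / _).
  have -> : u.2 ^+ 2 = 1 - u.1 ^+ 2 by move: uu; rewrite /unit_vec; lra.
  ring.
have u22 : u.2 ^+ 2 = 1 - u.1 ^+ 2 by move: uu; rewrite /unit_vec; lra.
rewrite /contact cosB sinB sp cp ct st [RHS]surjective_pairing; congr pair.
  have -> : (u.1 - k) / r * ((1 - k * u.1) / r) + u.2 / r * (k * (u.2 / r)) =
    ((u.1 - k) * (1 - k * u.1) + k * u.2 ^+ 2) / r ^+ 2 by field.
  rewrite u22 e.
  have -> : (u.1 - k) * (1 - k * u.1) + k * (1 - u.1 ^+ 2) =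
    u.1 * (1 - 2 * k * u.1 + k ^+ 2) by ring.
  by rewrite -e mulfK // expf_neq0.
have -> : u.2 / r * ((1 - k * u.1) / r) - (u.1 - k) / r * (k * (u.2 / r)) =
  u.2 * (1 - 2 * k * u.1 + k ^+ 2) / r ^+ 2 by field.
by rewrite -e mulfK // expf_neq0.
Qed.

Variable W : set (R * R).
Hypotheses (cW : convex_plane W)
  (W_le : forall z u, W z -> unit_vec u -> dot u z <= supportf u)
  (W_ge : forall u (e : R), unit_vec u -> 0 < e ->
    exists2 z, W z & supportf u - e <= dot u z).

(** The candidate for the interior of [W]. As [W] need not be closed, it is only trapped between
    this set and the closed region cut out by the weak inequalities. *)
Let Ust z := forall u, unit_vec u -> dot u z < supportf u.

(** A point outside [W] would be separated from it in some direction [u], which contradicts [W]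
    having supremum [supportf u] there. *)
Lemma Ust_W z : Ust z -> W z.
Proof.
move=> Uz; apply: contrapT => nWz.
have W0 : W !=set0.
  by have [w Ww _] := W_ge (unit_cossin 0) ltr01; exists w.
have [u uu hu] := weak_separation cW W0 nWz.
have dz : 0 < supportf u - dot u z by rewrite subr_gt0; exact: Uz.
have [w Ww] := W_ge uu (divr_gt0 dz (ltr0Sn R 1)).
by have := hu w Ww; lra.
Qed.

(** The gap between the support function and [dot u z] is continuous in the angle, so by compactness
    it has a positive minimum. *)
Lemma Ust_open z : Ust z -> exists2 e : R, 0 < e & forall w,
  `|z.1 - w.1| < e -> `|z.2 - w.2| < e -> Ust w.
Proof.
move=> Uz; pose f (t : R) := supportf (cos t, sin t) - dot (cos t, sin t) z.
have cf : continuous f.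
  move=> t; rewrite /f /supportf /rad /dot /=.
  have cc : cos x @[x --> t] --> cos t by exact: continuous_cos.
  have cs : sin x @[x --> t] --> sin t by exact: continuous_sin.
  apply: cvgB; last by apply: cvgD; apply: cvgMl.
  apply: cvgD; first by apply: cvgD; [exact: cvgMr|exact: cvg_cst].
  apply: cvgMr.
  apply: (cvg_comp (fun x => (cos x - k) ^+ 2 + sin x ^+ 2) Num.sqrt); last exact: sqrt_continuous.
  by apply: cvgD; apply: cvgM => //; apply: cvgB => //; exact: cvg_cst.
have p0 : 0 <= 2 * pi :> R by rewrite mulr_ge0 // pi_ge0.
have [t0 _ tmin] := EVT_min p0 (continuous_subspaceT cf).
pose m := f t0; have m0 : 0 < m by rewrite subr_gt0; exact/Uz/unit_cossin.
exists (m / 2); first by rewrite divr_gt0.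
move=> w w1 w2 u uu; have [t [/andP[t1 t2] ct st]] := unit_angle uu.
have := tmin t; rewrite in_itv /= t1 ltW // => /(_ erefl); rewrite -/m /f ct st.
rewrite -surjective_pairing => h.
have u1 : `|u.1| <= 1 by rewrite ler_norml; exact: unit_vec_le1.
have u2 : `|u.2| <= 1.
  by rewrite ler_norml; apply: (@unit_vec_le1 (u.2, u.1)); rewrite /unit_vec /= addrC.
have b1 : `|u.1 * (z.1 - w.1)| < m / 2.
  rewrite normrM; apply: le_lt_trans w1; rewrite -[leRHS]mul1r ler_wpM2r //.
have b2 : `|u.2 * (z.2 - w.2)| < m / 2.
  rewrite normrM; apply: le_lt_trans w2; rewrite -[leRHS]mul1r ler_wpM2r //.
move: b1 b2; rewrite !ltr_norml => /andP[b1 _] /andP[b2 _].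
by move: h b1 b2; rewrite /dot; lra.
Qed.

Lemma boundary_env : boundary W = [set z | exists t, 0 <= t < 2 * pi /\ z = env t].
Proof.
have ballE (z w : R * R) (e : R) : ball z e w <-> `|z.1 - w.1| < e /\ `|z.2 - w.2| < e by [].
have clK z u : closure W z -> unit_vec u -> dot u z <= supportf u.
  move=> clz uu; rewrite leNgt; apply/negP => lt.
  pose e := (dot u z - supportf u) / 2.
  have e0 : 0 < e by rewrite divr_gt0 // subr_gt0.
  have [w [Ww]] := clz _ (nbhsx_ballx z _ e0); move=> /ballE [w1 w2].
  have u1 : `|u.1| <= 1 by rewrite ler_norml; exact: unit_vec_le1.
  have u2 : `|u.2| <= 1.
    by rewrite ler_norml; apply: (@unit_vec_le1 (u.2, u.1)); rewrite /unit_vec /= addrC.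
  have b1 : `|u.1 * (z.1 - w.1)| < e.
    rewrite normrM; apply: le_lt_trans w1; rewrite -[leRHS]mul1r ler_wpM2r //.
  have b2 : `|u.2 * (z.2 - w.2)| < e.
    rewrite normrM; apply: le_lt_trans w2; rewrite -[leRHS]mul1r ler_wpM2r //.
  move: b1 b2; rewrite !ltr_norml => /andP[_ b1] /andP[_ b2].
  by have := W_le Ww uu; move: b1 b2; rewrite /e /dot; lra.
have UI z : Ust z -> interior W z.
  move=> /Ust_open[e e0 he]; apply/nbhs_ballP; exists e => // w /ballE[w1 w2].
  by apply: Ust_W; exact: he.
have IU z : interior W z -> Ust z.
  move=> /nbhs_ballP[e /= e0 he] u uu.
  (* Moving an interior point outwards along [u] stays in [W] and strictly increases [dot u]. *)
  pose w : R * R := (z.1 + e / 2 * u.1, z.2 + e / 2 * u.2).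
  have Ww : W w.
    apply: he; apply/ballE; rewrite /= !opprD !addrA !subrr !sub0r !normrN !(normrM (e / 2)).
    have e2 : `|e / 2| = e / 2 by rewrite ger0_norm // divr_ge0 // ltW.
    have u1 : `|u.1| <= 1 by rewrite ler_norml; exact: unit_vec_le1.
    have u2 : `|u.2| <= 1.
      by rewrite ler_norml; apply: (@unit_vec_le1 (u.2, u.1)); rewrite /unit_vec /= addrC.
    rewrite e2; split; nra.
  have := W_le Ww uu; rewrite /dot /= => h.
  have : e / 2 * (u.1 ^+ 2 + u.2 ^+ 2) = e / 2 by rewrite uu mulr1.
  by move: h; rewrite /dot; lra.
apply/seteqP; split=> [z [clz nIz]|z [t [tpi ->]]].
- have nU : ~ Ust z by move=> /UI.
  have [u [uu hu]] : exists u, unit_vec u /\ supportf u <= dot u z.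
    apply: contrapT => no; apply: nU => u uu; rewrite ltNge; apply/negP => le.
    by apply: no; exists u.
  have eu : dot u z = supportf u by apply: le_anti; rewrite hu clK.
  have [t tpi ctu] := contact_surj uu; exists t; split=> //.
  apply: (support_unique uu) => //.
  + by move=> u' uu'; exact: clK.
  + by move=> u' uu'; exact: env_le_support.
  + by rewrite -ctu env_support.
- split; last first.
    move=> /IU /(_ _ (unit_cossin (t - phase t))).
    by rewrite -/(contact t) env_support ltxx.
  (* A convenient interior point: points of the curve are limits of points moved slightly towards
     it. *)
  have UK : Ust (k, 0).
    move=> u uu; rewrite /supportf /dot /= mulr0 addr0 mulrC -addrA ltrDl.
    by rewrite addr_gt0 ?mulr_gt0 ?subr_gt0 // rad_gt0.
  move=> B /nbhs_ballP[e /= e0 he].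
  pose M := `|(env t).1 - k| + `|(env t).2| + 1.
  have M0 : 0 < M by rewrite ltr_pwDr // addr_ge0.
  pose s := Num.min 1 (e / (2 * M)).
  have s0 : 0 < s by rewrite lt_min ltr01 divr_gt0 // mulr_gt0.
  have s1 : s <= 1 by rewrite ge_min lexx.
  have sM : s * M < e.
    apply: le_lt_trans (_ : e / 2 < e); last by lra.
    have : s <= e / (2 * M) by rewrite ge_min lexx orbT.
    move=> /(ler_wpM2r (ltW M0)) h; apply: (le_trans h); rewrite le_eqVlt; apply/orP; left.
    by apply/eqP; field; exact: lt0r_neq0.
  exists (convex_comb s (env t) (k, 0)); split.
    apply: Ust_W => u uu; rewrite dot_convex.
    have := env_le_support t uu; have := UK u uu => h1 h2.
    have : s * dot u (k, 0) < s * supportf u by rewrite ltr_pM2l.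
    have : (1 - s) * dot u (env t) <= (1 - s) * supportf u by rewrite ler_wpM2l // subr_ge0.
    lra.
  apply: he; apply/ballE; rewrite /=.
  have n1 := normr_ge0 ((env t).1 - k); have n2 := normr_ge0 (env t).2.
  have -> : (env t).1 - ((1 - s) * (env t).1 + s * k) = s * ((env t).1 - k) by ring.
  have -> : (env t).2 - ((1 - s) * (env t).2 + s * 0) = s * (env t).2 by ring.
  rewrite !normrM (ger0_norm (ltW s0)); split; apply: le_lt_trans sM.
    by rewrite ler_pM2l // /M; lra.
  by rewrite ler_pM2l // /M; lra.
Qed.

End Envelope.

(** * The model space *)

Section ParameterRelation.
Variables (R : realType) (a c : R).
Hypotheses (a0 : 0 < a) (c0 : 0 < c).
Local Notation Re := complex.Re.
Local Notation Im := complex.Im.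

Lemma norm_cabs2 (z : R[i]) : `|z| = Complex (Num.sqrt (cabs2 z)) 0.
Proof. exact: normc_def. Qed.

Lemma p_eval_rc (x y : R) : p_eval a c (rc x) (rc y) = rc (a - x + c * y).
Proof. by apply: complexP; rewrite /p_eval !ReImE /= ?mul0r; ring. Qed.

Lemma norm_rc_lt1 (x : R) : -1 < x < 1 -> `|rc x| < 1.
Proof.
move=> /andP[x1 x2]; rewrite norm_cabs2 ltcE /= eqxx /= -sqrtr1 ltr_sqrt //.
rewrite /cabs2 !ReImE; nra.
Qed.

(** If [a - c < 1], then [p] has a real zero in the bidisk; a zero on the torus gives
    [(a - c) ^+ 2 <= 1]. *)
Lemma a_eq_c1 :
  (forall z1 z2 : R[i], `|z1| < 1 -> `|z2| < 1 -> p_eval a c z1 z2 != 0) ->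
  (exists z1 z2 : R[i], [/\ `|z1| = 1, `|z2| = 1 & p_eval a c z1 z2 = 0]) ->
  a = c + 1.
Proof.
move=> nz [z1 [z2 [n1 n2 p0]]].
have norm1 z : `|z| = 1 :> R[i] -> Re z ^+ 2 + Im z ^+ 2 = 1.
  by move=> h; have := add_Re2_Im2 z; rewrite h expr1n => -[].
have ge1 : 1 <= a - c.
  rewrite leNgt; apply/negP => lt1.
  have root (x y : R) : -1 < x < 1 -> -1 < y < 1 -> a - x + c * y = 0 -> False.
    move=> hx hy e; have := nz _ _ (norm_rc_lt1 hx) (norm_rc_lt1 hy).
    by rewrite p_eval_rc e rc0 eqxx.
  have ca := a0; have cc := c0.
  have [lt|ge] := ltrP a c.
    have q0 : 0 < a / c by rewrite divr_gt0.
    have q1 : a / c < 1 by rewrite ltr_pdivrMr // mul1r.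
    apply: (root 0 (- (a / c))); [by lra|by lra|].
    by field; exact: lt0r_neq0.
  (* The zero has [z2 = - (1 + m) / 2] and [z1] solved from [p = 0]. Then [z1 < 1] because
     [(1 + m) / 2] exceeds [(a - 1) / c], and [z1 > -1] because [c <= a]. *)
  pose m := Num.max 0 ((a - 1) / c).
  have m1 : m < 1 by rewrite gt_max ltr01 ltr_pdivrMr // mul1r; lra.
  have m0 : 0 <= m by rewrite le_max lexx.
  have m2 : a - 1 <= m * c by rewrite -ler_pdivrMr // le_max lexx orbT.
  clearbody m; have h : 0 < c * (1 - m) by rewrite mulr_gt0 // subr_gt0.
  apply: (root (a - c * ((1 + m) / 2)) (- ((1 + m) / 2))); [by lra|by lra|by ring].
have := norm1 _ n1; have := norm1 _ n2.
have -> : Re z1 = a + c * Re z2.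
  by have := congr1 (@complex.Re R) p0; rewrite /p_eval !ReImE /=; lra.
have -> : Im z1 = c * Im z2.
  by have := congr1 (@complex.Im R) p0; rewrite /p_eval !ReImE /=; lra.
move: (Re z2) (Im z2) => x y n2' n1'.
have x1 : 0 <= x + 1 by nra.
have h : 0 <= a * c * (x + 1) by rewrite !mulr_ge0 // ltW.
(* The relation [|a + c z2| = 1] reads [(a - c) ^+ 2 + 2 * a * c * (x + 1) = 1]. *)
have e : (a - c) ^+ 2 <= 1 by move: h n1' n2'; nra.
nra.
Qed.
End ParameterRelation.

#[local] Hint Extern 0 (@H2 _ _) => solve [h2] : core.

Section Multipliers.
Variables (R : realType) (a c : R).
Hypotheses (c0 : 0 < c) (ac : a = c + 1).
Local Notation E := (nat * nat -> R[i]^o).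
Local Notation Re := complex.Re.
Local Notation Im := complex.Im.
Implicit Types (f g h : E) (z w : R[i]).

Definition kap : R := a / (a + c).
Definition del : R := kap * (1 - kap).
Local Notation A := (rc a).
Local Notation C := (rc c).
Local Notation K := (rc kap).
Local Notation D := (rc del).

(* Multiplication by [a + c z2], [c + a z2] and [1 / (a + c z2)]. The operators below are locked
   to keep unification from unfolding them to coefficient arrays. *)
Definition bet f : E := locked (A *: f + C *: Sz f).
Definition gam f : E := locked (C *: f + A *: Sz f).
Local Notation X := (divz A C).
(* [V] is multiplication by the inner function [- gam / bet] of [z2]; up to the affine
   change of parameter [X = K + (1 - K) V] it is the parameter [e^{i theta}] of the curve. *)
Definition V f : E := locked ((1 - K)^-1 *: (X f - K *: f)).
Lemma betE f : bet f = A *: f + C *: Sz f. Proof. by rewrite /bet -lock. Qed.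
Lemma gamE f : gam f = C *: f + A *: Sz f. Proof. by rewrite /gam -lock. Qed.
Lemma VE f : V f = (1 - K)^-1 *: (X f - K *: f). Proof. by rewrite /V -lock. Qed.


Fact bet_linear : linear bet.
Proof.
move=> l f g; apply/funext => k; rewrite !betE [Sz _]linearP /= !evE; ring.
Qed.
Fact gam_linear : linear gam.
Proof.
move=> l f g; apply/funext => k; rewrite !gamE [Sz _]linearP /= !evE; ring.
Qed.
Fact V_linear : linear V.
Proof.
move=> l f g; apply/funext => k; rewrite !VE [divz _ _ _]linearP /= !evE; ring.
Qed.
HB.instance Definition _ := GRing.isLinear.Build _ _ _ _ bet bet_linear.
HB.instance Definition _ := GRing.isLinear.Build _ _ _ _ gam gam_linear.
HB.instance Definition _ := GRing.isLinear.Build _ _ _ _ V V_linear.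

Lemma betL : (forall f g, bet (f - g) = bet f - bet g) *
  (forall f g, bet (f + g) = bet f + bet g) * (forall f, bet (- f) = - bet f) *
  (forall (l : R[i]) f, bet (l *: f) = l *: bet f) * (bet 0 = 0).
Proof. exact: lin_rules. Qed.
Lemma gamL : (forall f g, gam (f - g) = gam f - gam g) *
  (forall f g, gam (f + g) = gam f + gam g) * (forall f, gam (- f) = - gam f) *
  (forall (l : R[i]) f, gam (l *: f) = l *: gam f) * (gam 0 = 0).
Proof. exact: lin_rules. Qed.
Lemma VL : (forall f g, V (f - g) = V f - V g) *
  (forall f g, V (f + g) = V f + V g) * (forall f, V (- f) = - V f) *
  (forall (l : R[i]) f, V (l *: f) = l *: V f) * (V 0 = 0).
Proof. exact: lin_rules. Qed.
Lemma XL : (forall f g, X (f - g) = X f - X g) *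
  (forall f g, X (f + g) = X f + X g) * (forall f, X (- f) = - X f) *
  (forall (l : R[i]) f, X (l *: f) = l *: X f) * (X 0 = 0).
Proof. exact: lin_rules. Qed.

Let a0 : 0 < a. Proof. by rewrite ac ltr_wpDl // ltW. Qed.
Lemma AE : A = C + 1. Proof. by rewrite ac rcD rc1. Qed.
Lemma C_neq0 : C != 0. Proof. by rewrite rc_eq0 gt_eqF. Qed.
Lemma A_neq0 : A != 0. Proof. by rewrite rc_eq0 gt_eqF. Qed.
Lemma AC_neq0 : A + C != 0. Proof. by rewrite -rcD rc_eq0 gt_eqF // addr_gt0. Qed.
Lemma KE : K = A / (A + C). Proof. by rewrite /kap rcM rcV rcD. Qed.
Lemma DE : D = K * (1 - K). Proof. by rewrite /del rcM rcD rcN rc1. Qed.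
Lemma K1E : 1 - K = C / (A + C). Proof. by rewrite KE; field; exact: AC_neq0. Qed.
Lemma K1_neq0 : 1 - K != 0.
Proof. by rewrite K1E mulf_neq0 ?invr_eq0 ?C_neq0 ?AC_neq0. Qed.
Lemma kap_gt0 : 0 < kap. Proof. by rewrite divr_gt0 // addr_gt0. Qed.
Lemma kap_lt1 : kap < 1. Proof. by rewrite ltr_pdivrMr ?addr_gt0 // mul1r ltrDl. Qed.
Lemma del_gt0 : 0 < del. Proof. by rewrite mulr_gt0 ?kap_gt0 // subr_gt0 kap_lt1. Qed.
Lemma D_neq0 : D != 0. Proof. by rewrite rc_eq0 gt_eqF // del_gt0. Qed.

Lemma betX f : bet (X f) = f. Proof. rewrite betE; exact/divzK/A_neq0. Qed.
Lemma Xbet f : X (bet f) = f. Proof. rewrite betE; exact/mulzK/A_neq0. Qed.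
Lemma XE f : X f = K *: f + (1 - K) *: V f.
Proof. by apply/funext => k; rewrite !VE !evE; field; exact: K1_neq0. Qed.

Lemma V_gam f : V f = - gam (X f).
Proof.
have AC0 := AC_neq0; rewrite !VE -{2}[f]betX !gamE !betE K1E KE AE in AC0 *.
by apply/funext => k; rewrite !evE; field; rewrite AC0 C_neq0.
Qed.

(** [1 - V] is multiplication by [(a + c) (1 + z2) / (a + c z2)]: its only zero is at [z2 = -1], the
    second coordinate of the zero of [p] on the torus. *)
Lemma oneV f : f - V f = (A + C) *: (X f + Sz (X f)).
Proof.
rewrite V_gam -{1}[f]betX !gamE !betE; apply/funext => k; rewrite !evE AE; ring.
Qed.

Lemma XSz f : X (Sz f) = Sz (X f).
Proof. by rewrite (comm_divz (T := @Sz R)) // A_neq0. Qed.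
Lemma XL1 f : X (L1 f) = L1 (X f).
Proof. by rewrite (comm_divz (T := @L1 R)) ?A_neq0 // => g; exact: L1Sz. Qed.
Lemma Xrow0 f : X (row0 f) = row0 (X f).
Proof. by rewrite (comm_divz (T := @row0 R)) ?A_neq0 // => g; exact: row0Sz. Qed.

Lemma VT (T : {linear E -> E}) f : (forall g, T (Sz g) = Sz (T g)) -> V (T f) = T (V f).
Proof.
move=> TS; have XT g : X (T g) = T (X g) by rewrite (comm_divz (T := T)) ?A_neq0.
by rewrite !VE XT [in RHS]linearZ [T (_ - _)]linearB [T (_ *: _)]linearZ.
Qed.
Lemma VSz f : V (Sz f) = Sz (V f). Proof. exact: VT. Qed.
Lemma VL1 f : V (L1 f) = L1 (V f). Proof. by apply: VT => g; exact: L1Sz. Qed.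
Lemma Vrow0 f : V (row0 f) = row0 (V f). Proof. by apply: VT => g; exact: row0Sz. Qed.
Lemma VX f : V (X f) = X (V f). Proof. by apply: VT => g; exact: XSz. Qed.

(** Since [a - c = 1], [|a x + c y|^2 = a |x|^2 - c |y|^2 + a c |x + y|^2]. The estimate is made on
    partial sums because [X f] is not yet known to lie in [H2]. *)
Lemma H2_X f : H2 f -> H2 (X f) /\ nrm2 (X f) <= nrm2 f.
Proof.
move=> hf; apply: bounded_H2 => N; apply: le_trans (psum_le_nrm2 N hf).
set u := X f; have fu : f = bet u by rewrite /u betX.
apply: (@le_trans _ _ (a * psum u N - c * psum (Sz u) N)).
  have /andP[/(ler_wpM2l (ltW c0)) h _] := psum_Sz u N; move: h; rewrite ac; lra.
rewrite fu /psum !mulr_sumr -sumrB; apply: ler_sum => j _.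
rewrite !mulr_sumr -sumrB; apply: ler_sum => l _ /=.
rewrite !betE !evE; set x := u _; set y := Sz u _.
have -> : cabs2 (A * x + C * y) = a * cabs2 x - c * cabs2 y + a * c * cabs2 (x + y).
  by rewrite /cabs2 !ReImE ac; ring.
by rewrite lerDl mulr_ge0 ?cabs2_ge0 // mulr_ge0 // ltW.
Qed.

Lemma H2X f : H2 f -> H2 (X f). Proof. by case/H2_X. Qed.
Lemma nrm2X f : H2 f -> nrm2 (X f) <= nrm2 f. Proof. by case/H2_X. Qed.

Lemma H2_V f : H2 f -> H2 (V f).
Proof. by move=> hf; have hX := H2X hf; rewrite VE; h2. Qed.

Lemma nrm2_V f : H2 f -> nrm2 (V f) = nrm2 f.
Proof.
move=> hf; have hu := H2X hf; set u := X f in hu *; have hS := H2_Sz hu.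
have -> : nrm2 f = nrm2 (bet u) by rewrite betX.
rewrite V_gam -/u nrm2N; last by rewrite !gamE; h2.
rewrite !gamE !betE !nrm2D; try h2.
rewrite !nrm2Z // nrm2_Sz // !(ipZl, ipZr) //; try h2.
by rewrite !rcJ !ReImE; ring.
Qed.

Lemma ip_V f g : H2 f -> H2 g -> ip (V f) (V g) = ip f g.
Proof. by apply: isometry_ip; [exact: H2_V|exact: nrm2_V]. Qed.

Lemma rcK1 : 1 - K = rc (1 - kap). Proof. by rewrite rcD rcN rc1. Qed.

(** On the circle [V] is unimodular, so [1 - |k + (1 - k) V|^2 = k (1 - k) |1 - V|^2]; this is where
    [del] comes from. *)
Lemma nrm2X_defect f : H2 f -> nrm2 (X f) = nrm2 f - del * nrm2 (f - V f).
Proof.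
move=> hf; have hV := H2_V hf; rewrite XE rcK1 nrm2B // nrm2D; try h2.
rewrite !nrm2Z // nrm2_V // !(ipZl, ipZr) //; try h2.
by rewrite !rcJ /cabs2 !ReImE /del; ring.
Qed.

(** * Powers of [X] tend strongly to zero *)

Lemma iterX_comm n f : iter n X (V f) = V (iter n X f).
Proof. by elim: n => //= n ->; rewrite VX. Qed.

Lemma iterX_Sz n f : iter n X (Sz f) = Sz (iter n X f).
Proof. by elim: n => //= n ->; rewrite XSz. Qed.

Lemma iterX_iterSz n m f : iter n X (iter m (@Sz R) f) = iter m (@Sz R) (iter n X f).
Proof. by elim: m => //= m IH; rewrite iterX_Sz IH. Qed.

Lemma iterXSr n f : iter n X (X f) = X (iter n X f).
Proof. by rewrite -iterSr. Qed.

Lemma H2_iterX n f : H2 f -> H2 (iter n X f).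
Proof. by elim: n => //= n IH hf; apply: H2X; exact: IH. Qed.

Lemma nrm2_iterX n f : H2 f -> nrm2 (iter n X f) <= nrm2 f.
Proof.
move=> hf; elim: n => //= n IH; apply: le_trans IH; exact/nrm2X/H2_iterX.
Qed.

(** The defects of the successive powers telescope. They decrease, so [n] times the last is at most
    their sum. *)
Lemma iterX_oneV_le n f : H2 f ->
  del * n%:R * nrm2 (iter n X (f - V f)) <= nrm2 f.
Proof.
move=> hf; have hV := H2_V hf.
suff h : del * n%:R * nrm2 (iter n X (f - V f)) <= nrm2 f - nrm2 (iter n X f).
  by apply: le_trans h _; rewrite lerBlDr lerDl; exact/nrm2_ge0/H2_iterX.
elim: n => [|n IH]; first by rewrite mulr0 mul0r subrr.
rewrite iterS (iterS n X f) (nrm2X_defect (H2_iterX n hf)) -iterX_comm -linearB /=.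
have hn : H2 (iter n X (f - V f)) by apply: H2_iterX; h2.
have := nrm2X hn; have := nrm2_ge0 hn; have := nrm2_ge0 (H2X hn).
rewrite mulrSr mulrDr mulr1 mulrDl; move: IH; have d0 := del_gt0.
have n0 : 0 <= n%:R :> R by [].
move: (nrm2 (X (iter n X (f - V f)))) (nrm2 (iter n X (f - V f)))
  (nrm2 (iter n X f)) (nrm2 f) (n%:R : R) n0 => x y u v m m0 IH x0 y0 xy.
have : del * m * x <= del * m * y by rewrite ler_wpM2l // mulr_ge0 // ltW.
have : del * x <= del * y by rewrite ler_wpM2l // ltW.
lra.
Qed.

Lemma iterX_oneV f : H2 f -> null (fun n => nrm2 (iter n X (f - V f))).
Proof.
move=> hf; have hV := H2_V hf.
apply: (@null_le _ _ (fun n => (nrm2 f + nrm2 (f - V f) * del) / n.+1%:R) del^-1); last exact: null_harmonic.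
  move=> n; rewrite mulrA ler_pdivlMr // ler_pdivlMl ?del_gt0 //.
  have := iterX_oneV_le n hf; have := @nrm2_iterX n (f - V f) (H2B hf hV).
  rewrite -natr1; have d0 := del_gt0.
  move: (nrm2 (iter n X (f - V f))) (nrm2 (f - V f)) (nrm2 f) => x y z xy.
  have : del * x <= del * y by rewrite ler_wpM2l // ltW.
  lra.
move=> n; apply: divr_ge0 => //; apply: addr_ge0; first exact: nrm2_ge0.
by apply: mulr_ge0; [apply: nrm2_ge0; h2|exact/ltW/del_gt0].
Qed.

Lemma iterX_oneS f : H2 f -> null (fun n => nrm2 (iter n X (f + Sz f))).
Proof.
move=> hf; have hS := H2_Sz hf.
suff -> : f + Sz f = (A + C)^-1 *: bet f - V ((A + C)^-1 *: bet f).
  by apply: iterX_oneV; rewrite !betE; h2.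
rewrite oneV [X _]linearZ /= Xbet linearZ /=.
apply/funext => k; rewrite !evE; field; exact: AC_neq0.
Qed.

Lemma null_nrm2D (u v : nat -> E) : (forall n, H2 (u n)) -> (forall n, H2 (v n)) ->
  null (fun n => nrm2 (u n)) -> null (fun n => nrm2 (v n)) ->
  null (fun n => nrm2 (u n + v n)).
Proof.
move=> hu hv nu nv.
apply: (@null_le _ _ (fun n => nrm2 (u n) + nrm2 (v n)) 2); last exact: nullD.
  by move=> n; rewrite mulrDr; exact: nrm2D_le.
by move=> n; rewrite addr_ge0 // nrm2_ge0.
Qed.

Lemma null_approx (u : nat -> R) : (forall e, 0 < e ->
  exists2 v, null v & forall n, u n <= v n + e) -> null u.
Proof.
move=> h e e0; have [v hv uv] := h (e / 2) (divr_gt0 e0 (ltr0Sn R 1)).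
have [N hN] := hv (e / 2) (divr_gt0 e0 (ltr0Sn R 1)); exists N => n /hN vn.
by apply: le_lt_trans (uv n) _; rewrite {2}(splitr e) ltrD2r.
Qed.

(** [e] times the first [m] terms of [1 - z2 + z2^2 - ...]. It is congruent to [m e] modulo
    [1 + z2], on whose multiples [X^n] tends to [0]. For [e] free of [z2] its squared norm grows
    like [m] while that of [m e] grows like [m^2], so dividing by [m] makes it negligible. *)
Fixpoint altsum (e : E) m : E := if m is m'.+1 then e - Sz (altsum e m') else 0.

Lemma altsum_H2 e m : H2 e -> H2 (altsum e m).
Proof. by move=> he; elim: m => [|m IH] /=; [h2|apply: H2B => //; exact: H2_Sz]. Qed.

Lemma nrm2_altsum e m : H2 e -> L2 e = 0 -> (forall j l, e (j, l.+1) = 0) ->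
  nrm2 (altsum e m) = m%:R * nrm2 e.
Proof.
move=> he _ e0; elim: m => [|m IH] /=.
  rewrite mul0r; apply: le_anti; rewrite nrm2_ge0 ?andbT; last exact: H20.
  by have := nrm2Z (0 : R[i]) (H20 R); rewrite cabs20 mul0r scaler0 => ->.
have hm := altsum_H2 m he; rewrite nrm2B //; last exact: H2_Sz.
rewrite nrm2_Sz // IH ip_disjoint; last by case=> j [|l]; [right|left].
by rewrite -natr1; ring.
Qed.

Lemma iterX_altsum e m : H2 e ->
  null (fun n => nrm2 (iter n X (m%:R *: e - altsum e m))).
Proof.
move=> he; have alt m' : m'%:R *: e - altsum e m' = m'%:R *: e - altsum e m' by [].
have step g : H2 g -> null (fun n => nrm2 (iter n X g)) ->
    null (fun n => nrm2 (iter n X (- Sz g))).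
  move=> hg; suff -> : (fun n => nrm2 (iter n X (- Sz g))) = fun n => nrm2 (iter n X g) by [].
  apply/funext => n; rewrite linearN /= nrm2N; last exact/H2_iterX/H2_Sz.
  by rewrite iterX_Sz nrm2_Sz //; exact: H2_iterX.
elim: m => [|m IH].
  rewrite scale0r subr0 => e' e'0; exists 0%N => n _.
  rewrite linear0; have := nrm2Z (0 : R[i]) (H20 R); rewrite cabs20 mul0r scaler0 => ->.
  by [].
have hm := altsum_H2 m he; have hS := H2_Sz he; have hSm := H2_Sz hm.
have -> : m.+1%:R *: e - altsum e m.+1 =
    - Sz (m%:R *: e - altsum e m) + m%:R *: (e + Sz e).
  rewrite /= [Sz (_ - _)]linearB /= [Sz (_ *: _)]linearZ /=; apply/funext => k.
  by rewrite !evE /= -natr1; ring.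
have h1 : H2 (m%:R *: e - altsum e m) by h2.
have h3 : H2 (- Sz (m%:R *: e - altsum e m)) by apply: H2N; exact: H2_Sz.
have h4 : H2 (m%:R *: (e + Sz e)) by h2.
apply: (@null_eq _ (fun n => nrm2 (iter n X (- Sz (m%:R *: e - altsum e m)) +
    iter n X (m%:R *: (e + Sz e))))); first by move=> n; rewrite -linearD.
apply: null_nrm2D; [by move=> n; exact: H2_iterX|by move=> n; exact: H2_iterX|exact: step|].
apply: (@null_le _ _ (fun n => nrm2 (iter n X (e + Sz e))) (cabs2 m%:R)).
- by move=> n; rewrite linearZ /= nrm2Z //; apply: H2_iterX; h2.
- by move=> n; apply: nrm2_ge0; apply: H2_iterX; h2.
- exact: iterX_oneS.
Qed.

Lemma cabs2_nat m : cabs2 (m%:R : R[i]) = m%:R ^+ 2.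
Proof.
suff -> : (m%:R : R[i]) = rc m%:R by rewrite cabs2C.
by elim: m => [|m IH]; rewrite ?rc0 // -!natr1 IH rcD rc1.
Qed.

Lemma iterX_col e : H2 e -> (forall j l, e (j, l.+1) = 0) ->
  null (fun n => nrm2 (iter n X e)).
Proof.
move=> he e0; apply: null_approx => eps eps0.
have [M hM] := @null_harmonic R (2 * nrm2 e) eps eps0; have {hM} := hM M (leqnn M).
set m := M.+1 => hm; have hA := altsum_H2 m he.
have hw : H2 (m%:R *: e - altsum e m) by h2.
exists (fun n => (m%:R ^+ 2)^-1 * (2 * nrm2 (iter n X (m%:R *: e - altsum e m)))).
  apply: (@null_le _ _ _ ((m%:R ^+ 2)^-1 * 2)) (iterX_altsum m he) => n.
    by rewrite mulrA.
  by apply: nrm2_ge0; apply: H2_iterX.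
move=> n; have m0 : 0 < m%:R ^+ 2 :> R by rewrite exprn_gt0.
have -> : nrm2 (iter n X e) = (m%:R ^+ 2)^-1 * nrm2 (iter n X (m%:R *: e)).
  by rewrite linearZ /= nrm2Z ?cabs2_nat ?mulKf ?gt_eqF //; exact: H2_iterX.
rewrite -lerBlDl -mulrBr ler_pdivrMl // lerBlDl.
have -> : iter n X (m%:R *: e) = iter n X (m%:R *: e - altsum e m) + iter n X (altsum e m).
  by rewrite -linearD subrK.
apply: le_trans (nrm2D_le (H2_iterX n hw) (H2_iterX n hA)) _.
rewrite lerD2l; apply: le_trans (_ : 2 * (m%:R * nrm2 e) <= _).
  rewrite ler_pM2l //; apply: le_trans (nrm2_iterX n hA) _.
  by rewrite nrm2_altsum // /L2; apply/funext => -[j l]; exact: e0.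
move: hm => /ltW; rewrite ler_pdivrMr // => hm.
by rewrite expr2 -mulrA mulrCA ler_pM2l // [leRHS]mulrC.
Qed.

Lemma H2_iter_L2 n f : H2 f -> H2 (iter n (@L2 R) f).
Proof. by move=> hf; elim: n => //= n; exact: H2_L2. Qed.
Lemma H2_iter_Sz n f : H2 f -> H2 (iter n (@Sz R) f).
Proof. by move=> hf; elim: n => //= n; exact: H2_Sz. Qed.
Lemma nrm2_iter_Sz n f : H2 f -> nrm2 (iter n (@Sz R) f) = nrm2 f.
Proof. by move=> hf; elim: n => //= n <-; rewrite nrm2_Sz //; exact: H2_iter_Sz. Qed.

Lemma iter_SzL2 n f j l :
  iter n (@Sz R) (iter n (@L2 R) f) (j, l) = if (l < n)%N then 0 else f (j, l).
Proof.
elim: n f j l => [|n IH] f j l //.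
rewrite iterS; case: l => [|l] //; rewrite Sz_S iterSr IH ltnS.
by case: ifP.
Qed.

Lemma tail_L2 f : H2 f -> null (fun n => nrm2 (iter n (@L2 R) f)).
Proof.
move=> hf e e0; have /cvgrPdist_lt/(_ e e0)[N _ hN] := psum_cvg_nrm2 hf.
exists N => n /hN; rewrite ger0_norm ?subr_ge0 ?psum_le_nrm2 //.
apply: le_lt_trans; have hL := H2_iter_L2 n hf; have hS := H2_iter_Sz n hL.
set t := iter n (@Sz R) _ in hS.
have ht : H2 (f - t) by h2.
have := nrm2D ht hS; rewrite subrK ip_disjoint; last first.
  case=> j l; rewrite !evE /t !iter_SzL2; case: ifP => _; [by right|left].
  by rewrite subrr.
rewrite mulr0 addr0 nrm2_iter_Sz // => ->.
suff : psum f n <= nrm2 (f - t) by lra.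
apply: le_trans (psum_le_nrm2 n ht); apply: ler_sum => j _; apply: ler_sum => l _.
by rewrite !evE /t !iter_SzL2 ltn_ord subr0.
Qed.

(** Up to a small tail [f] is a finite sum of columns shifted in [z2]. [X] commutes with the
    isometry [Sz], so each column falls under [iterX_col]; the tail stays small because [X] is a
    contraction. *)
Lemma iterX_null f : H2 f -> null (fun n => nrm2 (iter n X f)).
Proof.
move=> hf; apply: null_approx => e e0.
have [m hm] := @tail_L2 f hf (e / 2) (divr_gt0 e0 (ltr0Sn R 1)).
have {hm} := hm m (leqnn m); set t := iter m (@L2 R) f => ht.
have hL := H2_iter_L2 m hf : H2 t; have hS := H2_iter_Sz m hL.
have hw : H2 (f - iter m (@Sz R) t) by h2.
exists (fun n => 2 * nrm2 (iter n X (f - iter m (@Sz R) t))); last first.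
  move=> n; rewrite -{1}[f](subrK (iter m (@Sz R) t)) linearD.
  apply: le_trans (nrm2D_le (H2_iterX n hw) (H2_iterX n hS)) _.
  rewrite lerD2l; have := nrm2_iterX n hS; rewrite nrm2_iter_Sz // => h.
  by move: ht h; lra.
apply: (@null_le _ _ (fun n => nrm2 (iter n X (f - iter m (@Sz R) t))) 2) => // [n|].
  by apply: nrm2_ge0; exact: H2_iterX.
rewrite /t {hw hS hL ht t}; elim: m => [|m IH] //=.
  rewrite subrr => e' e'0; exists 0%N => n _; rewrite linear0.
  by have := nrm2Z (0 : R[i]) (H20 R); rewrite cabs20 mul0r scaler0 => ->.
set t := iter m (@L2 R) f in IH *.
have ht : H2 t by exact: H2_iter_L2.
have hw : H2 (f - iter m (@Sz R) t) by apply: H2B => //; exact: H2_iter_Sz.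
have hS := H2_Sz (H2_L2 ht); have he : H2 (t - Sz (L2 t)) by h2.
have -> : f - Sz (iter m (@Sz R) (L2 t)) =
    f - iter m (@Sz R) t + iter m (@Sz R) (t - Sz (L2 t)).
  by rewrite [iter m _ (t - _)]linearB -iterS iterSr addrA subrK.
apply: (@null_eq _ (fun n => nrm2 (iter n X (f - iter m (@Sz R) t) +
    iter n X (iter m (@Sz R) (t - Sz (L2 t)))))); first by move=> n; rewrite -linearD.
apply: null_nrm2D => //.
- by move=> n; exact: H2_iterX.
- by move=> n; apply: H2_iterX; exact: H2_iter_Sz.
suff -> : (fun n => nrm2 (iter n X (iter m (@Sz R) (t - Sz (L2 t))))) =
    fun n => nrm2 (iter n X (t - Sz (L2 t))).
  by apply: iterX_col => // j l; rewrite !evE /= subrr.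
apply/funext => n.
rewrite iterX_iterSz.
by rewrite nrm2_iter_Sz //; exact: H2_iterX.
Qed.

Lemma divz_local f g j l : (forall i, (i <= l)%N -> f (j, i) = g (j, i)) ->
  X f (j, l) = X g (j, l).
Proof.
rewrite /divz /=; elim: l => [|l IH] fg /=; first by rewrite fg.
by rewrite fg // IH // => i il; rewrite fg // ltnW.
Qed.

(** A coefficient of [X^n f] depends only on the coefficients of [f] in the same row up to the same
    column, so [f] may be truncated to a polynomial. This serves states not yet known to lie in
    [H2]. *)
Lemma iterX_coef f k : null (fun n => cabs2 (iter n X f k)).
Proof.
case: k => j l; pose g : E := fun k => if (k.1 <= j)%N && (k.2 <= l)%N then f k else 0.
have hg : H2 g.
  apply/H2P; exists (psum g (maxn j l).+1) => N.
  have [N1|N1] := leqP N (maxn j l).+1; first exact: psum_nd.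
  rewrite /psum -(subnKC (ltnW N1)) big_split_ord /= [X in _ + X]big1 ?addr0; last first.
    move=> i _; rewrite big1 // => i' _; rewrite /g /= leqNgt.
    by rewrite (leq_trans _ (leq_addr _ _)) ?cabs20 // ltnS leq_maxl.
  apply: ler_sum => i _; rewrite big_split_ord /= [X in _ + X]big1 ?addr0 // => i' _.
  rewrite /g /= andbC leqNgt.
  by rewrite (leq_trans _ (leq_addr _ _)) ?cabs20 // ltnS leq_maxr.
have e n : forall i, (i <= l)%N -> iter n X f (j, i) = iter n X g (j, i).
  elim: n => [|n IH] i il /=; first by rewrite /g /= leqnn il.
  by apply: divz_local => i' i'i; apply: IH; exact: leq_trans il.
move=> eps /(iterX_null hg)[N hN]; exists N => n /hN; apply: le_lt_trans.
by rewrite e //; apply: coef_le_nrm2; exact: H2_iterX.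
Qed.



(** * The conservative realisation and its observability map *)

Definition W f : E := locked (f - V f).
Lemma WE f : W f = f - V f. Proof. by rewrite /W -lock. Qed.
Fact W_linear : linear W.
Proof.
by move=> l f g; apply/funext => k; rewrite !WE [V _]linearP /= !evE; ring.
Qed.
HB.instance Definition _ := GRing.isLinear.Build _ _ _ _ W W_linear.
Lemma WL : (forall f g, W (f - g) = W f - W g) *
  (forall f g, W (f + g) = W f + W g) * (forall f, W (- f) = - W f) *
  (forall (l : R[i]) f, W (l *: f) = l *: W f) * (W 0 = 0).
Proof. exact: lin_rules. Qed.

(** Multiplication by [theta1(0, z2) = - z2 / (a + c z2)], the term from input to output. *)
Definition Y f : E := locked ((1 - K) *: f + K *: V f).
Lemma YE f : Y f = (1 - K) *: f + K *: V f. Proof. by rewrite /Y -lock. Qed.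
Fact Y_linear : linear Y.
Proof.
by move=> l f g; apply/funext => k; rewrite !YE [V _]linearP /= !evE; ring.
Qed.
HB.instance Definition _ := GRing.isLinear.Build _ _ _ _ Y Y_linear.
Lemma YL : (forall f g, Y (f - g) = Y f - Y g) *
  (forall f g, Y (f + g) = Y f + Y g) * (forall f, Y (- f) = - Y f) *
  (forall (l : R[i]) f, Y (l *: f) = l *: Y f) * (Y 0 = 0).
Proof. exact: lin_rules. Qed.

Lemma H2_W f : H2 f -> H2 (W f).
Proof. by move=> hf; have hV := H2_V hf; rewrite WE. Qed.
Lemma H2_Y f : H2 f -> H2 (Y f).
Proof. by move=> hf; have hV := H2_V hf; rewrite YE. Qed.

(* The realisation [theta1 = Y + z1 D W (1 - z1 X)^-1 W] of [theta1], with coefficients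
   analytic in [z2], is conservative; [Aop], [Cop] are the state and output operators of
   the cascade realising [theta1^2], so that [J] is an observability map and hence, up to
   the factor [del], an isometry. *)
Lemma colligation (w u : E) : H2 w -> H2 u ->
  nrm2 (X w + D *: W u) + del * nrm2 (W w + Y u) = nrm2 w + del * nrm2 u.
Proof.
move=> hw hu; have hVw := H2_V hw; have hVu := H2_V hu.
(* Both outputs are combinations of [w], [V w], [u], [V u]. With [V] isometric, the claim becomes an
   identity between the coefficients of the remaining inner products. *)
have four (r1 r2 r3 r4 : R) :
  nrm2 ((rc r1 *: w + rc r2 *: V w) + (rc r3 *: u + rc r4 *: V u)) =
  (r1 ^+ 2 + r2 ^+ 2) * nrm2 w + (r3 ^+ 2 + r4 ^+ 2) * nrm2 u +
  2 * (r1 * r2 * Re (ip w (V w)) + r3 * r4 * Re (ip u (V u)) +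
       (r1 * r3 + r2 * r4) * Re (ip w u) + r1 * r4 * Re (ip w (V u)) +
       r2 * r3 * Re (ip (V w) u)).
  rewrite (nrm2D (f := rc r1 *: w + rc r2 *: V w)) //.
  rewrite (nrm2D (f := rc r1 *: w)) // (nrm2D (f := rc r3 *: u)) // !nrm2Z //.
  rewrite !nrm2_V // ipDl // !ipDr // !ipZl // !ipZr // ip_V //.
  by rewrite !rcJ !cabs2C !ReImE; ring.
have -> : X w + D *: W u = (K *: w + rc (1 - kap) *: V w) + (D *: u + rc (- del) *: V u).
  by rewrite XE WE rcK1 rcN; apply/funext => k; rewrite !evE; ring.
have -> : W w + Y u = (rc 1 *: w + rc (-1) *: V w) + (rc (1 - kap) *: u + K *: V u).
  by rewrite YE WE rcK1 rcN rc1; apply/funext => k; rewrite !evE; ring.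
rewrite !four /del; ring.
Qed.

Local Notation state := (E * E)%type.
Implicit Types x y : state.

(** In a state [(F, G)], [G] belongs to the first copy of [theta1], run with zero input; its output
    [W G] is the input of the second copy, whose state is [F]. *)
Definition Aop x : state := (X x.1 + D *: W (W x.2), X x.2).
Definition Cop x : E := W (x.1 + Y x.2).
Definition J x : E := locked (fun k => Cop (iter k.1 Aop x) (0%N, k.2)).
Lemma JkE x k : J x k = Cop (iter k.1 Aop x) (0%N, k.2).
Proof. by rewrite /J -lock. Qed.
Definition nrmx x := nrm2 x.1 + nrm2 x.2.
Definition H2x x := H2 x.1 /\ H2 x.2.
Definition mapx (T : E -> E) x : state := (T x.1, T x.2).

Lemma pairP x y : x.1 = y.1 -> x.2 = y.2 -> x = y.
Proof. by case: x y => ? ? [? ?] /= -> ->. Qed.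

Fact Aop_linear : linear Aop.
Proof.
move=> l x y; apply: pairP; rewrite /Aop /=; last by rewrite [X _]linearP.
rewrite [X _]linearP [W (_ + _)]linearP [W (_ + _)]linearP /=.
by apply/funext => k; rewrite !evE; ring.
Qed.
Fact Cop_linear : linear Cop.
Proof.
move=> l x y; rewrite /Cop -[RHS]linearP; apply: (congr1 W); rewrite [Y _]linearP /=.
by apply/funext => k; rewrite !evE; ring.
Qed.
HB.instance Definition _ := GRing.isLinear.Build _ _ _ _ Aop Aop_linear.
HB.instance Definition _ := GRing.isLinear.Build _ _ _ _ Cop Cop_linear.
Fact J_linear : linear J.
Proof. by move=> l x y; apply/funext => k; rewrite !evE !JkE !linearP. Qed.
HB.instance Definition _ := GRing.isLinear.Build _ _ _ _ J J_linear.

Lemma H2x_A x : H2x x -> H2x (Aop x).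
Proof.
move=> [h1 h2']; split; last exact: H2X.
apply: H2D; first exact: H2X.
by apply: H2Z; apply: H2_W; exact: H2_W.
Qed.
Lemma H2x_iterA n x : H2x x -> H2x (iter n Aop x).
Proof. by move=> hx; elim: n => //= n; exact: H2x_A. Qed.
Lemma H2_Cop x : H2x x -> H2 (Cop x).
Proof. by move=> [h1 h2']; apply: H2_W; apply: H2D => //; exact: H2_Y. Qed.

Lemma WY f : W (Y f) = Y (W f).
Proof.
rewrite !WE !YE [V ((1 - K) *: f + _)]linearD [V (f - V f)]linearB /=.
rewrite [V ((1 - K) *: f)]linearZ [V (K *: V f)]linearZ /=.
by apply/funext => k; rewrite !evE; ring.
Qed.

(** The energy balance of the second copy with input [W G] is added to the defect identity for [G];
    the energy of [W G] passed between the copies cancels. *)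
Lemma nrmx_A x : H2x x -> nrmx (Aop x) + del * nrm2 (Cop x) = nrmx x.
Proof.
move=> [h1 h2']; have hW := H2_W h2'; rewrite /nrmx /= /Cop linearD /= WY.
have := colligation h1 hW; have := nrm2X_defect h2'; rewrite -WE => -> e.
by rewrite addrAC e; ring.
Qed.

Lemma nrmx_ge0 x : H2x x -> 0 <= nrmx x.
Proof. by move=> [h1 h2']; apply: addr_ge0; exact: nrm2_ge0. Qed.

Lemma nrmx_A_le x : H2x x -> nrmx (Aop x) <= nrmx x.
Proof.
move=> hx; rewrite -(nrmx_A hx) lerDl mulr_ge0 ?nrm2_ge0 //; first exact/ltW/del_gt0.
exact: H2_Cop.
Qed.

Lemma nrmx_iterA_le n x : H2x x -> nrmx (iter n Aop x) <= nrmx x.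
Proof.
move=> hx; elim: n => //= n; apply: le_trans; exact/nrmx_A_le/H2x_iterA.
Qed.

Lemma nrmxD_le x y : H2x x -> H2x y -> nrmx (x + y) <= 2 * nrmx x + 2 * nrmx y.
Proof.
move=> [x1 x2] [y1 y2]; rewrite /nrmx.
have := nrm2D_le x1 y1; have := nrm2D_le x2 y2; rewrite /=; lra.
Qed.

Lemma nrm20 : nrm2 (0 : E) = 0.
Proof. by have := nrm2Z (0 : R[i]) (H20 R); rewrite cabs20 mul0r scaler0. Qed.

Lemma iterA_inl n f : iter n Aop (f, 0) = (iter n X f, 0).
Proof. by elim: n => //= n ->; rewrite /Aop /= !linear0 ?scaler0 ?addr0. Qed.

Lemma iterA_snd n x : (iter n Aop x).2 = iter n X x.2.
Proof. by elim: n => //= n ->. Qed.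

(** [Aop] is triangular. Once [X^m G] is small, its later contribution stays small since [Aop] is
    contractive, and the first component alone evolves by powers of [X]. *)
Lemma iterA_null x : H2x x -> null (fun n => nrmx (iter n Aop x)).
Proof.
move=> hx.
have inl f : H2 f -> null (fun n => nrmx (iter n Aop (f, 0))).
  move=> hf; apply: (null_eq (u := fun n => nrm2 (iter n X f))); last exact: iterX_null.
  by move=> n; rewrite iterA_inl /nrmx /= nrm20 addr0.
apply: null_approx => e e0; have e4 : 0 < e / 2 by rewrite divr_gt0.
have [m hm] := iterX_null hx.2 e4; have {hm} := hm m (leqnn m).
set w := iter m Aop x => ht; have [w1 w2] : H2x w by exact: H2x_iterA.
have hw1 : H2x (w.1, 0) by split; [exact: w1|exact: H20].
have hw2 : H2x (0, w.2) by split; [exact: H20|exact: w2].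
have le n : nrmx (iter n Aop x) <= 2 * nrmx (iter (n - m) Aop (w.1, 0)) +
    (if (n < m)%N then nrmx x else 0) + e.
  have [nm|mn] := ltnP n m.
    have := nrmx_ge0 (H2x_iterA (n - m) hw1).
    have := nrmx_iterA_le n hx; lra.
  rewrite addr0 -{1}(subnK mn) iterD -/w.
  have ew : w = (w.1, 0) + (0, w.2) by apply: pairP; rewrite /= ?addr0 ?add0r.
  rewrite {1}ew.
  rewrite linearD /=.
  apply: le_trans (nrmxD_le (H2x_iterA (n - m) hw1) (H2x_iterA (n - m) hw2)) _.
  have e2 : nrmx (0, w.2) = nrm2 (iter m X x.2).
    by rewrite /nrmx /= nrm20 add0r /w iterA_snd.
  by rewrite lerD2l; have := nrmx_iterA_le (n - m) hw2; rewrite e2; move: ht; lra.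
exists (fun n => 2 * nrmx (iter (n - m) Aop (w.1, 0)) + (if (n < m)%N then nrmx x else 0)).
  move=> e' e'0; have [N hN] := inl _ w1 (e' / 2) (divr_gt0 e'0 (ltr0Sn R 1)).
  exists (N + m)%N => n Nn; have mn : (m <= n)%N := leq_trans (leq_addl _ _) Nn.
  rewrite ltnNge mn addr0; have := hN (n - m)%N; rewrite leq_subRL // addnC => /(_ Nn).
  by lra.
exact: le.
Qed.

(** States are functions of [z2] alone, encoded as arrays supported on the row of degree [0] in [z1]
    so that the operators on [E] apply to them. *)
Definition st0 x := row0 x.1 = x.1 /\ row0 x.2 = x.2.

Lemma Wrow0 f : row0 (W f) = W (row0 f).
Proof. by rewrite !WE linearB /= Vrow0. Qed.
Lemma Yrow0 f : row0 (Y f) = Y (row0 f).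
Proof. by rewrite !YE linearD /= !linearZ /= Vrow0. Qed.

Lemma st0_A x : st0 x -> st0 (Aop x).
Proof.
move=> [h1 h2']; split; rewrite /Aop /=; last by rewrite -Xrow0 h2'.
by rewrite linearD linearZ /= !Wrow0 -Xrow0 h1 h2'.
Qed.
Lemma st0_iterA n x : st0 x -> st0 (iter n Aop x).
Proof. by move=> hx; elim: n => //= n; exact: st0_A. Qed.
Lemma row0_Cop x : st0 x -> row0 (Cop x) = Cop x.
Proof. by move=> [h1 h2']; rewrite /Cop Wrow0 linearD /= Yrow0 h1 h2'. Qed.

Lemma L1J x : L1 (J x) = J (Aop x).
Proof. by apply/funext => -[j l]; rewrite /L1 !JkE /= -iterSr. Qed.
Lemma iter_L1J n x : iter n (@L1 R) (J x) = J (iter n Aop x).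
Proof. by elim: n => //= n ->; rewrite L1J. Qed.
Lemma row0J x : st0 x -> row0 (J x) = Cop x.
Proof.
move=> hx; rewrite -(row0_Cop hx); apply/funext => -[[|j] l] //.
by rewrite !row0_0 JkE.
Qed.

Lemma L1_eq0 n f : H2 f -> nrm2 (iter n (@L1 R) f) =
  nrm2 f - \sum_(j < n) nrm2 (row0 (iter j (@L1 R) f)).
Proof.
move=> hf; have hL m : H2 (iter m (@L1 R) f) by elim: m => //= m; exact: H2_L1.
elim: n => [|n IH]; first by rewrite big_ord0 subr0.
rewrite big_ord_recr /= opprD addrA -IH (nrm2_L1 (hL n)); ring.
Qed.

Lemma sum_Cop n x : H2x x ->
  del * (\sum_(j < n) nrm2 (Cop (iter j Aop x))) = nrmx x - nrmx (iter n Aop x).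
Proof.
move=> hx; elim: n => [|n IH]; first by rewrite big_ord0 mulr0 subrr.
rewrite big_ord_recr mulrDr IH /= -(nrmx_A (H2x_iterA n hx)) /=; ring.
Qed.

(** The energies of the outputs telescope to [nrmx x] minus the energy of the [n]-th state, which
    tends to [0]. *)
Lemma J_isometry x : H2x x -> st0 x -> H2 (J x) /\ del * nrm2 (J x) = nrmx x.
Proof.
move=> hx h0; have d0 := del_gt0.
have [hJ le1] : H2 (J x) /\ nrm2 (J x) <= nrmx x / del.
  apply: bounded_H2 => N; rewrite ler_pdivlMr // mulrC.
  apply: le_trans (_ : del * (\sum_(j < N) nrm2 (Cop (iter j Aop x))) <= _).
    rewrite ler_pM2l //; apply: ler_sum => j _ /=.
    apply: le_trans (psum_le_nrm2 N.+1 (H2_Cop (H2x_iterA j hx))).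
    rewrite (eq_bigr (fun l : 'I_N => cabs2 (Cop (iter j Aop x) (0%N, l : nat)))); last first.
      by move=> l _; rewrite JkE.
    rewrite /psum [leRHS]big_ord_recl /= -[leLHS]addr0; apply: lerD.
      by rewrite [leRHS]big_ord_recr /= lerDl cabs2_ge0.
    by apply: sumr_ge0 => *; apply: sumr_ge0 => *; exact: cabs2_ge0.
  by rewrite sum_Cop // gerBl; exact/nrmx_ge0/H2x_iterA.
split=> //; apply: le_anti; move: le1; rewrite ler_pdivlMr // mulrC => -> /=.
apply: null_const (iterA_null hx) => n.
rewrite -lerBlDr -sum_Cop // ler_pM2l //.
have := L1_eq0 n hJ; have hL m : H2 (iter m (@L1 R) (J x)).
  by elim: m => //= m; exact: H2_L1.
have := nrm2_ge0 (hL n).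
have -> : \sum_(j < n) nrm2 (row0 (iter j (@L1 R) (J x))) =
          \sum_(j < n) nrm2 (Cop (iter j Aop x)).
  by apply: eq_bigr => j _; rewrite iter_L1J row0J //; exact: st0_iterA.
lra.
Qed.

Lemma H2J x : H2x x -> st0 x -> H2 (J x). Proof. by move=> hx /(J_isometry hx)[]. Qed.
Lemma nrm2J x : H2x x -> st0 x -> del * nrm2 (J x) = nrmx x.
Proof. by move=> hx /(J_isometry hx)[]. Qed.

Lemma st0D x y : st0 x -> st0 y -> st0 (x + y).
Proof. by move=> [x1 x2] [y1 y2]; split; rewrite linearD /= ?x1 ?x2 ?y1 ?y2. Qed.
Lemma st0Z (l : R[i]) x : st0 x -> st0 (l *: x).
Proof. by move=> [x1 x2]; split; rewrite linearZ /= ?x1 ?x2. Qed.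
Lemma H2xD x y : H2x x -> H2x y -> H2x (x + y).
Proof. by move=> [x1 x2] [y1 y2]; split; apply: H2D. Qed.
Lemma H2xZ (l : R[i]) x : H2x x -> H2x (l *: x).
Proof. by move=> [x1 x2]; split; apply: H2Z. Qed.

Lemma ipJ x y : H2x x -> st0 x -> H2x y -> st0 y ->
  D * ip (J x) (J y) = ip x.1 y.1 + ip x.2 y.2.
Proof.
have re x' y' : H2x x' -> st0 x' -> H2x y' -> st0 y' ->
    Re (D * ip (J x') (J y')) = Re (ip x'.1 y'.1 + ip x'.2 y'.2).
  move=> hx x0 hy y0; have := nrm2J (H2xD hx hy) (st0D x0 y0).
  rewrite linearD nrm2D; [|exact: H2J|exact: H2J].
  rewrite /nrmx (nrm2D hx.1 hy.1) (nrm2D hx.2 hy.2).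
  have := nrm2J hx x0; have := nrm2J hy y0; rewrite /nrmx Re_rcM ReD.
  move: (nrm2 (J x')) (nrm2 (J y')) (Re (ip (J x') (J y'))) (nrm2 x'.1) (nrm2 x'.2).
  move: (nrm2 y'.1) (nrm2 y'.2) (Re (ip x'.1 y'.1)) (Re (ip x'.2 y'.2)).
  by move=> *; lra.
move=> hx x0 hy y0.
apply: (@polarization R state (fun x => H2x x /\ st0 x) (fun x => D * ip (J x) (J y))
  (fun x => ip x.1 y.1 + ip x.2 y.2)) => //.
- by move=> x' [hx' x0']; split; [exact: H2xZ|exact: st0Z].
- by move=> x' [hx' x0']; rewrite linearZ ipZl; [ring|exact: H2J|exact: H2J].
- move=> x' [[hx1 hx2] _]; rewrite mulrDr; congr (_ + _); apply: ipZl => //; by case: hy.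
- by move=> x' [hx' x0']; exact: re.
Qed.

Lemma comm_J (T : {linear E -> E}) x : st0 x ->
  (forall g, T (Sz g) = Sz (T g)) -> (forall g, T (row0 g) = row0 (T g)) ->
  (forall g, T (L1 g) = L1 (T g)) -> T (J x) = J (mapx T x).
Proof.
move=> x0 TS Tr TL.
have VTc g : V (T g) = T (V g) by exact: VT.
have WTc g : W (T g) = T (W g) by rewrite !WE linearB /= VTc.
have YTc g : Y (T g) = T (Y g) by rewrite !YE linearD /= !linearZ /= VTc.
have XTc g : X (T g) = T (X g) by rewrite (comm_divz (T := T)) ?A_neq0.
have A1 y : Aop (mapx T y) = mapx T (Aop y).
  by apply: pairP; rewrite /= ?XTc // !WTc linearD linearZ.
have An n : iter n Aop (mapx T x) = mapx T (iter n Aop x).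
  by elim: n => //= n ->; exact: A1.
have C1 y : Cop (mapx T y) = T (Cop y) by rewrite /Cop /= YTc -linearD WTc.
have TLn n g : T (iter n (@L1 R) g) = iter n (@L1 R) (T g).
  by elim: n => //= n <-; rewrite TL.
apply/funext => -[j l]; rewrite [RHS]JkE /= An C1.
have -> : T (J x) (j, l) = row0 (iter j (@L1 R) (T (J x))) (0%N, l).
  rewrite row0_0; elim: j (T _) => [//|j IH] g; by rewrite iterSr -IH.
by rewrite -TLn -Tr iter_L1J row0J //; exact: st0_iterA.
Qed.

Lemma XJ x : st0 x -> X (J x) = J (mapx X x).
Proof. by move=> x0; apply: comm_J x0 _ _ _; [exact: XSz|exact: Xrow0|exact: XL1]. Qed.
Lemma WJ x : st0 x -> W (J x) = J (mapx W x).
Proof.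
move=> x0; apply: comm_J x0 _ _ _ => g /=; first by rewrite !WE linearB /= VSz.
  by rewrite Wrow0.
by rewrite !WE linearB /= VL1.
Qed.

(* As [p = (1 - z1 X) / X], the equation [Nop (Nop f) = 0] says that [p^2 f] has degree at most
   [1] in [z1]. *)
Definition Nop f : E := locked (L1 f - X f).
Lemma NE f : Nop f = L1 f - X f. Proof. by rewrite /Nop -lock. Qed.
Fact N_linear : linear Nop.
Proof.
move=> l f g; apply/funext => k.
by rewrite !NE [X _]linearP [L1 _]linearP /= !evE; ring.
Qed.
HB.instance Definition _ := GRing.isLinear.Build _ _ _ _ Nop N_linear.
Lemma NL : (forall f g, Nop (f - g) = Nop f - Nop g) *
  (forall f g, Nop (f + g) = Nop f + Nop g) * (forall f, Nop (- f) = - Nop f) *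
  (forall (l : R[i]) f, Nop (l *: f) = l *: Nop f) * (Nop 0 = 0).
Proof. exact: lin_rules. Qed.

(** On states [L1] acts as [Aop] and [X] acts diagonally, so [Nop] sees only the nilpotent
    off-diagonal part of [Aop]. *)
Lemma NJ x : st0 x -> Nop (J x) = J (D *: W (W x.2), 0).
Proof.
move=> x0; rewrite NE L1J XJ // -linearB; congr J; apply: pairP; rewrite /= ?subrr //.
by rewrite addrC addrA addNr add0r.
Qed.

Lemma NNJ x : st0 x -> Nop (Nop (J x)) = 0.
Proof.
move=> [x1 x2]; rewrite NJ // NJ /=; last first.
  by split; rewrite /= ?linear0 // linearZ /= !Wrow0 x2.
have -> : (D *: W (W 0), 0) = 0 :> state by apply: pairP; rewrite /= ?linear0.
by rewrite linear0.
Qed.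

(** * Recovering the state of a solution of [Nop (Nop f) = 0] *)

Lemma NX f : Nop (X f) = X (Nop f).
Proof. by rewrite !NE linearB /= XL1. Qed.

(** [Nop u = 0] makes the [j]-th row of [u] equal to [X^j] applied to the row of degree [0]. *)
Lemma L1X_eq0 u : Nop u = 0 -> row0 u = 0 -> u = 0.
Proof.
rewrite NE => /eqP; rewrite subr_eq0 => /eqP Lu r0.
have Ln n : iter n (@L1 R) u = iter n X u.
  elim: n => //= n ->; elim: n => [|n IH] //=.
  by rewrite -XL1 IH.
have rX n : row0 (iter n X u) = 0.
  by elim: n => //= n IH; rewrite -Xrow0 IH linear0.
apply/funext => -[j l].
have -> : u (j, l) = row0 (iter j (@L1 R) u) (0%N, l).
  rewrite row0_0; elim: j u {Lu r0 Ln rX} => [//|j IH] u; by rewrite iterSr -IH.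
by rewrite Ln rX.
Qed.

Lemma NN_unique f g : Nop (Nop f) = 0 -> Nop (Nop g) = 0 -> row0 f = row0 g ->
  row0 (Nop f) = row0 (Nop g) -> f = g.
Proof.
move=> nf ng r0 r1; apply/eqP; rewrite -subr_eq0; apply/eqP.
apply: L1X_eq0; last by rewrite linearB /= r0 subrr.
apply: L1X_eq0; first by rewrite !linearB /= nf ng subrr.
by rewrite !linearB /= r1 subrr.
Qed.

(* The formal inverse of [W], which does not preserve [H2]. *)
Definition Winv f : E := (A + C)^-1 *: bet (divz 1 1 f).

Lemma WinvK f : W (Winv f) = f.
Proof.
rewrite WE oneV /Winv [X _]linearZ /= Xbet [Sz _]linearZ /= -[RHS](divzK 1 f (oner_neq0 _)).
by apply/funext => k; rewrite !evE; field; exact: AC_neq0.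
Qed.

Lemma row0_Winv f : row0 (Winv f) = Winv (row0 f).
Proof.
rewrite /Winv linearZ /= !betE linearD !linearZ /= row0Sz.
by rewrite (comm_divz (T := @row0 R)) ?oner_eq0 // => g; exact: row0Sz.
Qed.

(** A solution is determined by the rows of degree [0] of [f] and [Nop f]. These two rows are
    triangular in the state, with diagonal factors [W] and [D W^3], and are solved by formal
    division; the state obtained need not lie in [H2]. *)
Lemma JE f : Nop (Nop f) = 0 -> exists x, [/\ st0 x, f = J x,
   D *: W (W (W x.2)) = row0 (Nop f) & W (x.1 + Y x.2) = row0 f].
Proof.
move=> nf; pose G := D^-1 *: Winv (Winv (Winv (row0 (Nop f)))).
pose F := Winv (row0 f) - Y G.
have rG : row0 G = G by rewrite linearZ /= !row0_Winv row0K.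
have rF : row0 F = F by rewrite linearB /= Yrow0 rG row0_Winv row0K.
have x0 : st0 (F, G) by [].
have eG : D *: W (W (W G)) = row0 (Nop f).
  rewrite /G 3!linearZ /= !WinvK scalerA divff ?scale1r //; exact: D_neq0.
have eF : W (F + Y G) = row0 f by rewrite subrK WinvK.
clearbody F; clearbody G; exists (F, G); split=> //; apply: NN_unique => //.
- exact: NNJ.
- by rewrite row0J.
- rewrite NJ // row0J; last by split; rewrite /= ?linear0 // linearZ /= !Wrow0 rG.
  by rewrite /Cop /= linear0 addr0 [W (_ *: _)]linearZ /= eG.
Qed.

Lemma st0_map (T : {linear E -> E}) x : (forall g, T (row0 g) = row0 (T g)) ->
  st0 x -> st0 (mapx T x).
Proof. by move=> Tr [x1 x2]; split; rewrite /= -Tr ?x1 ?x2. Qed.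
Lemma st0_W x : st0 x -> st0 (mapx W x).
Proof. by apply: st0_map => g; exact: esym (Wrow0 g). Qed.
Lemma oneX f : f - X f = (1 - K) *: W f.
Proof. by rewrite XE WE; apply/funext => k; rewrite !evE; ring. Qed.

(** [1 - X^n] is a multiple of [1 - X = (1 - K) W] by a polynomial in [X]. *)
Lemma H2_oneXn n f : H2 (W f) -> H2 (f - iter n X f).
Proof.
move=> hW; have h1 : H2 (f - X f) by rewrite oneX.
elim: n => [|n IH] /=; first by rewrite subrr.
have -> : f - X (iter n X f) = (f - iter n X f) + iter n X (f - X f).
  by rewrite [iter n X (f - X f)]linearB /= iterXSr addrA subrK.
by apply: H2D => //; exact: H2_iterX.
Qed.

(** Cancels one factor [W]. The truncations [(1 - X^n) x] lie in [H2]; by the isometry their norms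
    are controlled by those of [(1 - X^n) (J x)], hence bounded, and they converge to [x]
    coefficientwise. *)
Lemma state_H2 x : st0 x -> H2 (J x) -> H2x (mapx W x) -> H2x x.
Proof.
move=> x0 hJ [w1 w2].
pose xn n : state := (x.1 - iter n X x.1, x.2 - iter n X x.2).
have hxn n : H2x (xn n) by split; exact: H2_oneXn.
have x0n n : st0 (xn n).
  have r g : row0 (iter n X g) = iter n X (row0 g).
    by elim: n => //= n <-; rewrite -Xrow0.
  by split; rewrite /= linearB /= r ?x0.1 ?x0.2.
have JX n : J (iter n X x.1, iter n X x.2) = iter n X (J x).
  elim: n => [|n IH]; first by rewrite /= -surjective_pairing.
  rewrite /= -IH XJ //; split; rewrite /=.
    by elim: n {IH} => [|n IH] /=; rewrite ?x0.1 // -Xrow0 IH.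
  by elim: n {IH} => [|n IH] /=; rewrite ?x0.2 // -Xrow0 IH.
have Jn n : J (xn n) = J x - iter n X (J x) by rewrite -JX -linearB.
have bound n : nrmx (xn n) <= del * (4 * nrm2 (J x)).
  rewrite -(nrm2J (hxn n) (x0n n)) Jn ler_pM2l ?del_gt0 //.
  have := nrm2B_le hJ (H2_iterX n hJ); have := nrm2_iterX n hJ; lra.
have cv g k : null (fun n => cabs2 ((g - iter n X g) k - g k)).
  apply: null_eq (iterX_coef g k) => n; rewrite -cabs2N; congr cabs2.
  by rewrite !evE; ring.
split.
- have [] // := fatou (fun n => (hxn n).1) _ (cv x.1) (C := del * (4 * nrm2 (J x))).
  move=> n; apply: le_trans (bound n); rewrite /nrmx lerDl; exact/nrm2_ge0/(hxn n).2.
- have [] // := fatou (fun n => (hxn n).2) _ (cv x.2) (C := del * (4 * nrm2 (J x))).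
  move=> n; apply: le_trans (bound n); rewrite /nrmx lerDr; exact/nrm2_ge0/(hxn n).1.
Qed.

(** The formal state becomes square-summable after multiplication by [W^3], and the three factors
    are then cancelled one at a time. *)
Theorem state_exists f : H2 f -> Nop (Nop f) = 0 ->
  exists x, [/\ H2x x, st0 x & f = J x].
Proof.
move=> hf nf; have [x [x0 fJ eG eF]] := JE nf; exists x; split=> //.
have hN : H2 (Nop f).
  by have hL := H2_L1 hf; have hX := H2X hf; rewrite NE.
have h3 : H2x (mapx W (mapx W (mapx W x))).
  have h2' : H2 (W (W (W x.2))).
    have -> : W (W (W x.2)) = D^-1 *: row0 (Nop f).
      by rewrite -eG scalerA mulVf ?scale1r //; exact: D_neq0.
    by apply: H2Z; exact: H2_row0.
  split; last exact: h2'.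
  suff : H2 (W (W (W x.1))) by [].
  have -> : W (W (W x.1)) = W (W (row0 f)) - Y (W (W (W x.2))).
    by rewrite -eF !linearD /= !WY addrK.
  apply: H2B; last exact: H2_Y.
  by apply: H2_W; apply: H2_W; exact: H2_row0.
have s1 := st0_W x0; have s2 := st0_W s1.
have j1 : H2 (J (mapx W x)) by rewrite -WJ // -fJ; exact: H2_W.
have j2 : H2 (J (mapx W (mapx W x))) by rewrite -WJ //; exact: H2_W.
have j0 : H2 (J x) by rewrite -fJ.
exact: state_H2 x0 j0 (state_H2 s1 j1 (state_H2 s2 j2 h3)).
Qed.

(** * Multiplication by [p] and membership in [KTheta] *)

Lemma rcC (r : R) : (r%:C)%C = rc r. Proof. by rewrite /rc -lock. Qed.

Definition Pm f : E := locked (bet f - S1 f).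
Lemma PmE f : Pm f = bet f - S1 f. Proof. by rewrite /Pm -lock. Qed.
Definition Pt f : E := locked (C *: S1 f - Sz f + A *: S1 (Sz f)).
Lemma PtE f : Pt f = C *: S1 f - Sz f + A *: S1 (Sz f).
Proof. by rewrite /Pt -lock. Qed.
(** The adjoint of [Pm]. *)
Definition Ps f : E := locked (A *: f - L1 f + C *: L2 f).
Lemma PsE f : Ps f = A *: f - L1 f + C *: L2 f. Proof. by rewrite /Ps -lock. Qed.

Lemma mul_pE f : mul_p a c f = Pm f.
Proof.
apply/funext => k; rewrite PmE betE /mul_p -[Mz1 f]/(S1 f) -[Mz2 f]/(Sz f) !rcC !evE; ring.
Qed.
Lemma mul_ptE f : mul_pt a c f = Pt f.
Proof. by apply/funext => k; rewrite PtE /mul_pt !rcC. Qed.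

Fact Pm_linear : linear Pm.
Proof.
move=> l f g; apply/funext => k.
by rewrite !PmE [bet _]linearP [S1 _]linearP /= !evE; ring.
Qed.
HB.instance Definition _ := GRing.isLinear.Build _ _ _ _ Pm Pm_linear.
Lemma PmL : (forall f g, Pm (f - g) = Pm f - Pm g) *
  (forall f g, Pm (f + g) = Pm f + Pm g) * (forall f, Pm (- f) = - Pm f) *
  (forall (l : R[i]) f, Pm (l *: f) = l *: Pm f) * (Pm 0 = 0).
Proof. exact: lin_rules. Qed.
Fact Ps_linear : linear Ps.
Proof.
move=> l f g; apply/funext => k.
by rewrite !PsE [L1 _]linearP [L2 _]linearP /= !evE; ring.
Qed.
HB.instance Definition _ := GRing.isLinear.Build _ _ _ _ Ps Ps_linear.
Lemma H2_bet f : H2 f -> H2 (bet f).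
Proof. by move=> hf; have hS := H2_Sz hf; rewrite betE. Qed.
Lemma H2_gam f : H2 f -> H2 (gam f).
Proof. by move=> hf; have hS := H2_Sz hf; rewrite gamE. Qed.
Lemma H2_Pm f : H2 f -> H2 (Pm f).
Proof. by move=> hf; have h1 := H2_bet hf; have hS := H2_S1 hf; rewrite PmE. Qed.
Lemma H2_Ps f : H2 f -> H2 (Ps f).
Proof. by move=> hf; have h1 := H2_L1 hf; have hS := H2_L2 hf; rewrite PsE. Qed.
Lemma H2_Pt f : H2 f -> H2 (Pt f).
Proof.
move=> hf; have h1 := H2_S1 hf; have h2' := H2_Sz hf; have h3 := H2_S1 h2'.
by rewrite PtE.
Qed.

Lemma ip_Pm f g : H2 f -> H2 g -> ip (Pm f) g = ip f (Ps g).
Proof.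
move=> hf hg; have h1 := H2_S1 hf; have h2' := H2_Sz hf; have h3 := H2_L1 hg.
have h4 := H2_L2 hg; rewrite PmE betE PsE.
rewrite ipBl // ipDl // !ipZl // ipDr // ipBr // !ipZr // ip_S1l // ip_Szl //.
by rewrite !rcJ; ring.
Qed.

Lemma L2S1 f : L2 (S1 f) = S1 (L2 f). Proof. by apply/funext => -[[|j] l]. Qed.
Lemma PtPs f : Pt f = Ps (S1 (Sz f)).
Proof.
rewrite PtE PsE L1S1 L2S1 L2Sz; apply/funext => k; rewrite !evE; ring.
Qed.
Lemma betSz f : bet (Sz f) = Sz (bet f).
Proof. by rewrite !betE !SzL. Qed.
Lemma betS1 f : bet (S1 f) = S1 (bet f).
Proof. by rewrite !betE !S1L S1Sz. Qed.
Lemma betL1 f : bet (L1 f) = L1 (bet f).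
Proof. by rewrite !betE -L1Sz. Qed.
Lemma betrow0 f : row0 (bet f) = bet (row0 f).
Proof. by rewrite !betE !row0L row0Sz. Qed.
Lemma PmSz f : Pm (Sz f) = Sz (Pm f).
Proof. by rewrite !PmE SzL betSz S1Sz. Qed.
Lemma PmS1 f : Pm (S1 f) = S1 (Pm f).
Proof. by rewrite !PmE S1L betS1. Qed.
Lemma PtS1 f : Pt (S1 f) = S1 (Pt f).
Proof.
by rewrite !PtE !S1L !S1Sz.
Qed.
Lemma PtSz f : Pt (Sz f) = Sz (Pt f).
Proof.
by rewrite !PtE !SzL !S1Sz.
Qed.
Lemma PmPt f : Pm (Pt f) = Pt (Pm f).
Proof.
by rewrite !PtE !PmL !PmS1 !PmSz.
Qed.
Lemma PtPt f : Pt (Pt f) = Ps (Ps (S1 (S1 (Sz (Sz f))))).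
Proof.
by rewrite {1}PtPs -PtSz -PtS1 PtPs !S1Sz.
Qed.

Definition delta (k0 : nat * nat) : E := fun k => (k == k0)%:R.
Lemma H2_delta k0 : H2 (delta k0).
Proof. by have [] := ip_delta k0 (H20 R). Qed.
Lemma S1delta j l : S1 (delta (j, l)) = delta (j.+1, l).
Proof. by apply/funext => -[[|j'] l']. Qed.
Lemma Szdelta j l : Sz (delta (j, l)) = delta (j, l.+1).
Proof.
by apply/funext => -[j' [|l']]; rewrite /delta /Sz /= !xpair_eqE ?andbF.
Qed.

(* Testing against [Theta p^2 z1^j z2^l = p~^2 z1^j z2^l], where
   [p~ = z1 z2 conj(p)] on the torus. *)
Lemma KTheta_coef f j l : KTheta a c f -> Pm (Pm f) (j.+2, l.+2) = 0.
Proof.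
move=> [hf fK]; have he := H2_delta (j, l); set e := delta (j, l) in he.
have : ip f (Pt (Pt e)) = 0.
  apply: fK; split; first exact/H2_Pt/H2_Pt.
  exists (Pm (Pm e)); split; first exact/H2_Pm/H2_Pm.
  by rewrite !mul_pE !mul_ptE !PmPt.
have hd : H2 (delta (j.+2, l.+2)) by exact: H2_delta.
rewrite PtPt /e !Szdelta !S1delta -ip_Pm -?ip_Pm //; first last.
  exact: H2_Ps.
  exact: H2_Pm.
by have [_ ->] := ip_delta (j.+2, l.+2) (H2_Pm (H2_Pm hf)).
Qed.

(** One factor gives [L1 (Pm f) = bet (Nop f)], and all these operators other than [Pm] commute. *)
Lemma NN_Pm f : bet (bet (Nop (Nop f))) = L1 (L1 (Pm (Pm f))).
Proof.
rewrite !NE !PmE ![L1 (_ - _)]linearB /= ![bet (_ - _)]linearB /=.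
rewrite ![X (_ - _)]linearB /= ![S1 (_ - _)]linearB /= ![L1 (_ - _)]linearB /=.
rewrite !betS1 !L1S1 ![bet (_ - _)]linearB /= !XL1 !betL1 ?betX.
by apply/funext => k; rewrite !evE.
Qed.

Lemma NN_coef f : Nop (Nop f) = 0 <-> forall j l, Pm (Pm f) (j.+2, l) = 0.
Proof.
split=> [nf j l|h].
  have := NN_Pm f; rewrite nf !linear0 => /(congr1 (fun g : E => g (j, l))) /= h.
  exact/esym.
have e : bet (bet (Nop (Nop f))) = 0.
  by rewrite NN_Pm; apply/funext => -[j l]; exact: h.
by rewrite -[LHS]Xbet -[bet _]Xbet e !linear0.
Qed.

Lemma NSz f : Nop (Sz f) = Sz (Nop f).
Proof. by rewrite !NE SzL XSz L1Sz. Qed.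
Lemma XW f : X (W f) = W (X f).
Proof. by rewrite !WE XL VX. Qed.
Lemma WL1 f : W (L1 f) = L1 (W f).
Proof. by rewrite !WE L1L VL1. Qed.
Lemma NW f : Nop (W f) = W (Nop f).
Proof. by rewrite !NE WL XW WL1. Qed.
Lemma WSz f : W (Sz f) = Sz (W f).
Proof. by rewrite !WE SzL VSz. Qed.
Definition T1 f : E := locked (f + Sz f).
Lemma T1E f : T1 f = f + Sz f. Proof. by rewrite /T1 -lock. Qed.
Lemma T1Z (l : R[i]) f : T1 (l *: f) = l *: T1 f.
Proof. by rewrite !T1E SzL scalerDr. Qed.
Lemma betT1 f : bet (T1 f) = T1 (bet f).
Proof. by rewrite !T1E betL betSz. Qed.
Lemma betW f : bet (W f) = (A + C) *: T1 f.
Proof. by rewrite T1E WE oneV !betL betSz betX. Qed.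

(** The compression to [H2] of multiplication by [z2 conj(p)] on the torus. *)
Definition Q f : E := locked (gam f - Sz (L1 f)).
Lemma QE f : Q f = gam f - Sz (L1 f). Proof. by rewrite /Q -lock. Qed.

Lemma PsPsQ f : Ps (Ps (Sz (Sz f))) = Q (Q f).
Proof.
have PQ g : Ps (Sz g) = Q g.
  by rewrite PsE QE gamE L1Sz L2Sz; apply/funext => k; rewrite !evE; ring.
have -> : Ps (Sz (Sz f)) = Sz (Ps (Sz f)).
  by rewrite !PsE !L1Sz !L2Sz !SzL.
by rewrite !PQ.
Qed.

(** For [p^2 h = p~^2 g], the inner product of [h] with [Q (Q v)] is that of [p~^2 g] with [z2^2 v],
    hence of [z1^2 z2^2 g] with [p^2 z2^2 v], which vanishes because [p^2 v] has degree at most [1]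
    in [z1]. *)
Lemma QQ_KTheta v : H2 v -> Nop (Nop v) = 0 -> KTheta a c (Q (Q v)).
Proof.
move=> hv nv; rewrite -PsPsQ.
have h1 := H2_Sz hv; have h2' := H2_Sz h1; have h3 := H2_Ps h2'.
split; first exact: H2_Ps.
move=> h [hh [g [hg e]]]; have s1 := H2_S1 hg; have s2 := H2_S1 s1.
have s3 := H2_Sz s2; have s4 := H2_Sz s3; have hP := H2_Pm hh.
have hv1 := H2_Pm hv; have hv2 := H2_Pm hv1; have hL := H2_L1 hv2.
have s5 := H2_Sz s1; have s6 := H2_Ps s4.
rewrite (ipC hh (H2_Ps h3)) -(ip_Pm hh h3) -(ip_Pm hP h2').
rewrite -(ipC (H2_Pm hP) h2'); move: e; rewrite !mul_pE !mul_ptE => ->.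
rewrite PtPt !S1Sz -(ip_Pm h2' (H2_Ps s4)) -(ip_Pm (H2_Pm h2') s4).
rewrite !PmSz (isometry_ip _ _ (H2_Sz hv2) s3) //; [|exact: H2_Sz|exact: nrm2_Sz].
rewrite (isometry_ip _ _ hv2 s2) //; [|exact: H2_Sz|exact: nrm2_Sz].
rewrite (ipC s2 hv2) (ip_S1l s1 hv2) (ip_S1l hg hL) -NN_Pm nv !linear0.
by rewrite ip_disjoint ?rmorph0 // => k; right.
Qed.

Lemma DAC : D * (A + C) ^+ 2 = A * C.
Proof. by rewrite DE K1E // KE; field; exact: AC_neq0. Qed.

Lemma betWC f : W (bet f) = bet (W f).
Proof.
have -> : f = X (bet f) by rewrite Xbet.
by rewrite betX -XW betX.
Qed.

Lemma betWW f : bet (W (W (bet f))) = (A + C) ^+ 2 *: T1 (T1 f).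
Proof.
by rewrite betWC betW betW T1Z scalerA -expr2.
Qed.

Lemma gam_bet f : gam (bet f) - Sz f = (A * C) *: T1 (T1 f).
Proof.
rewrite gamE betE !T1E !SzL; apply/funext => k.
by rewrite !evE AE //; ring.
Qed.

Lemma gam_SX g : gam g - Sz (X g) = D *: bet (W (W g)).
Proof.
by rewrite -{1 3}[g](betX) gam_bet betWW scalerA DAC.
Qed.

(** On the model space [Nop] squares to zero, so [Q] is multiplication by [D (a + c z2) W^2] plus a
    nilpotent term commuting with it, and can be inverted up to powers of [W]. *)
Lemma Q_split g : Q g = D *: bet (W (W g)) - Sz (Nop g).
Proof.
by rewrite -gam_SX QE NE SzL opprB addrA subrK.
Qed.

Lemma H2_N f : H2 f -> H2 (Nop f).
Proof. by move=> hf; have h1 := H2_L1 hf; have h2' := H2X hf; rewrite NE. Qed.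

Lemma W6_KTheta (w : E) : H2 w -> Nop (Nop w) = 0 -> KTheta a c (iter 6 W w).
Proof.
move=> hw nw; pose u := Nop w.
have Nu : Nop u = 0 by [].
have hu : H2 u := H2_N hw.
(* With [M = D bet W^2] and [Nop (Nop w) = 0], the formal inverse of [Q^2] is
   [M^-2 + 2 Sz M^-3 Nop]. Applied to [W^6 w] it gives [v]: the exponent [6] is what clears the
   denominator [W^6] of [M^-3]. *)
pose v := (D ^- 2) *: X (X (W (W w))) + (2 * D ^- 3) *: X (X (X (Sz u))).
have hv : H2 v.
  have h1 := H2X (H2X (H2_W (H2_W hw))).
  by have h3 := H2X (H2X (H2X (H2_Sz hu))); rewrite /v.
have nv : Nop v = (D ^- 2) *: X (X (W (W u))).
  by rewrite /v !NL !NX !NW NSz Nu SzL !XL scaler0 addr0.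
have nnv : Nop (Nop v) = 0 by rewrite nv NL !NX !NW Nu !WL !XL scaler0.
have D0 := D_neq0.
suff -> : iter 6 W w = Q (Q v) by exact: QQ_KTheta.
have bX f : bet (X f) = f := betX f.
pose v1 := (D^-1) *: X (W (W (W (W w)))) + (D ^- 2) *: X (X (W (W (Sz u)))).
have -> : Q v = v1.
  rewrite Q_split nv /v !(WL, betL, SzL, XL) -!XW !bX -!XSz -!WSz.
  apply/funext => k; by rewrite /v1 !evE; field; exact: D0.
have nv1 : Nop v1 = (D^-1) *: X (W (W (W (W u)))).
  by rewrite /v1 !NL !NX !NW NSz Nu SzL !WL !XL scaler0 addr0.
rewrite Q_split nv1 /v1 !(WL, betL, SzL, XL) -!XW !bX -!XSz -!WSz.
by apply/funext => k; rewrite !evE /=; field; exact: D0.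
Qed.

Lemma KTheta_limit (w : nat -> E) f : H2 f -> (forall n, KTheta a c (w n)) ->
  null (fun n => nrm2 (f - w n)) -> KTheta a c f.
Proof.
move=> hf hK hl; split=> // h hh; have hh2 : H2 h by case: hh.
have hw n : H2 (w n) by case: (hK n).
apply: cabs2_eq0; apply: le_anti; rewrite cabs2_ge0 andbT.
apply: (@null_const _ _ _ (fun n => nrm2 (f - w n) * nrm2 h)) => [n|].
  rewrite add0r; have -> : ip f h = ip (f - w n) h.
    by rewrite ipBl // [X in _ - X](_ : _ = 0) ?subr0 //; case: (hK n) => _; exact.
  by apply: cauchy_schwarz => //; h2.
apply: (@null_le _ _ _ (nrm2 h)) hl => n; first by rewrite mulrC.
by apply: nrm2_ge0; h2.
Qed.

(** The six factors [W] are removed one at a time. [w - X^n w = W (z n)] with [z n] in the model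
    space, so [W^r (w - X^n w)] is covered by the exponent [r + 1], and [X^n] tends to [0]. *)
Lemma M_KTheta (w : E) : H2 w -> Nop (Nop w) = 0 -> KTheta a c w.
Proof.
suff h m : forall w : E, H2 w -> Nop (Nop w) = 0 -> KTheta a c (iter (6 - m) W w).
  by have := h 6%N w; rewrite subnn.
elim: m => [|m IH] {}w hw nw; first exact: W6_KTheta.
have [m6|m6] := leqP 6 m.
  have := IH w hw nw; have /eqP -> : (6 - m == 0)%N by rewrite subn_eq0.
  by have /eqP -> : (6 - m.+1 == 0)%N by rewrite subn_eq0 (leq_trans m6).
have e : (6 - m)%N = (6 - m.+1).+1 by rewrite subnSK.
rewrite e in IH; move: (6 - m.+1)%N IH => r IH {e m6 m}.
have hr (w' : E) : H2 w' -> H2 (iter r W w').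
  by move=> hw'; elim: r {IH} => //= r; exact: H2_W.
pose z n := \sum_(i < n) (1 - K) *: iter i X w.
have hz n : H2 (z n).
  rewrite /z; elim/big_ind: _; [exact: H20|exact: H2D|move=> i _; apply: H2Z; exact: H2_iterX].
have nX n : Nop (Nop (iter n X w)) = 0.
  by elim: n => //= n IHn; rewrite !NX IHn linear0.
have nz n : Nop (Nop (z n)) = 0.
  rewrite /z; elim: n => [|n IHn]; first by rewrite big_ord0 !NL.
  by rewrite big_ord_recr /= !NL IHn nX scaler0 addr0.
have eW n : W (z n) = w - iter n X w.
  elim: n => [|n IHn]; first by rewrite /z big_ord0 WL subrr.
  rewrite /z big_ord_recr /= !WL IHn -oneX.
  by rewrite addrA subrK.
apply: (@KTheta_limit (fun n => iter r W (w - iter n X w))).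
- exact: hr.
- by move=> n; rewrite -eW -iterSr; exact: IH.
- have e n : iter r W w - iter r W (w - iter n X w) = iter n X (iter r W w).
    rewrite -linearB /= opprB addrCA subrr addr0.
    elim: r {hr IH} => //= r ->; elim: n => //= n <-; by rewrite XW.
  by apply: null_eq (iterX_null (hr _ hw)) => n; rewrite e.
Qed.

(** If [(1 + z2) h] has degree at most [m] in [z2], the coefficients of [h] from degree [m] on
    alternate in sign with constant modulus, so square-summability makes them vanish. *)
Lemma iter_L2_T1 m h : H2 h -> iter m.+1 (@L2 R) (T1 h) = 0 -> iter m (@L2 R) h = 0.
Proof.
move=> hh; rewrite iterSr T1E L2L L2Sz => e.
set u := iter m (@L2 R) h; have hu : H2 u := H2_iter_L2 m hh.
have Lu : L2 u = - u.
  apply/eqP; rewrite -addr_eq0; apply/eqP; move: e.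
  by rewrite [iter m _ _]linearD /= -iterSr.
have Ln n : nrm2 (iter n (@L2 R) u) = nrm2 u.
  elim: n => [//|n IH]; rewrite iterSr Lu linearN nrm2N //; exact: H2_iter_L2.
apply: nrm2_eq0 => //.
by apply: null_const (tail_L2 hu) => n; rewrite add0r Ln.
Qed.

Lemma T1_inj h : H2 h -> iter 3 (@L2 R) (T1 (T1 (T1 h))) = 0 -> h = 0.
Proof.
move=> hh; have h1 : H2 (T1 h) by rewrite T1E; apply: H2D => //; exact: H2_Sz.
have h2' : H2 (T1 (T1 h)) by rewrite [T1 (T1 _)]T1E; apply: H2D => //; exact: H2_Sz.
move=> /(iter_L2_T1 h2')/(iter_L2_T1 h1)/(iter_L2_T1 hh); exact.
Qed.

Lemma row0_PmPm f : row0 (Pm (Pm f)) = bet (bet (row0 f)).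
Proof.
by rewrite !PmE !(betL, row0L) !row0S1 !betrow0 row0S1 !betL !subr0.
Qed.
Lemma row0_L1PmPm f :
  row0 (L1 (Pm (Pm f))) = bet (bet (row0 (L1 f))) - (2 : R[i]) *: bet (row0 f).
Proof.
rewrite !PmE !betL betS1 !(S1L, L1L) !L1S1 -!betL1 !row0L row0S1 !betrow0.
by apply/funext => k; rewrite !evE; ring.
Qed.

Lemma bet3_N f : bet (bet (bet (row0 (Nop f)))) =
  bet (row0 (L1 (Pm (Pm f)))) + row0 (Pm (Pm f)).
Proof.
rewrite row0_PmPm row0_L1PmPm NE row0L -Xrow0 !betL betX.
by apply/funext => k; rewrite !evE; ring.
Qed.

Lemma iter_L2_bet n f : iter n (@L2 R) f = 0 -> iter n.+1 (@L2 R) (bet f) = 0.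
Proof.
move=> nf; rewrite iterSr betE !L2L L2Sz.
have h (h : E) (l : R[i]) m : iter m (@L2 R) h = 0 -> iter m (@L2 R) (l *: h) = 0.
  by move=> e; rewrite linearZ /= e scaler0.
rewrite linearD /= h ?add0r ?h //.
by rewrite -iterSr /= nf L2L.
Qed.
Lemma iter_L2_gam n f : iter n (@L2 R) f = 0 -> iter n.+1 (@L2 R) (gam f) = 0.
Proof.
move=> nf; rewrite iterSr gamE !L2L L2Sz.
have h (h : E) (l : R[i]) m : iter m (@L2 R) h = 0 -> iter m (@L2 R) (l *: h) = 0.
  by move=> e; rewrite linearZ /= e scaler0.
rewrite linearD /= h ?add0r ?h //.
by rewrite -iterSr /= nf L2L.
Qed.

Lemma bet3_W3 f : bet (bet (bet (W (W (W f))))) = (A + C) ^+ 3 *: T1 (T1 (T1 f)).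
Proof.
by rewrite !(betW, betL, betT1, T1Z) !scalerA !exprS expr0 mulr1 !mulrA.
Qed.

Lemma L2row0 f : L2 (row0 f) = row0 (L2 f). Proof. by apply/funext => -[[|j] l]. Qed.
(* An element of both model spaces is [q / p^2] with [q] of bidegree at most [(1, 1)]; its
   state [(F, G)] then satisfies that [(1 + z2)^3 F] and [(1 + z2)^3 G] have degree at most
   2, which is impossible in [H2] unless both vanish. *)
Lemma M1_M2_disjoint f : H2 f -> Nop (Nop f) = 0 -> L2 (L2 (Pm (Pm f))) = 0 -> f = 0.
Proof.
move=> hf nf mf; have [x [[hF hG] x0 fJ]] := state_exists hf nf.
have [rF rG] := x0.
set q := Pm (Pm f) in mf; pose q0 := row0 q; pose q1 := row0 (L1 q).
have q00 : iter 2 (@L2 R) q0 = 0 by rewrite /= /q0 !L2row0 mf row0L.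
have q10 : iter 2 (@L2 R) q1 = 0.
  rewrite /= /q1 !L2row0; have -> : L2 (L2 (L1 q)) = L1 (L2 (L2 q)) by [].
  by rewrite mf L1L row0L.
have AC0 := AC_neq0; have D0 := D_neq0.
have scale0 (l : R[i]) (h g : E) : l != 0 -> h = l *: g ->
    iter 3 (@L2 R) h = 0 -> iter 3 (@L2 R) g = 0.
  move=> l0 -> /=; rewrite !L2L => e; apply: (scalerI l0); by rewrite e scaler0.
have iD n (u v : E) : iter n (@L2 R) (u + v) = iter n (@L2 R) u + iter n (@L2 R) v.
  exact: linearD.
have G0 : x.2 = 0.
  (* [bet q1 + q0] is [bet^3] times the row of degree [0] of [Nop f], which is [D W^3 G], while
     [bet W] is multiplication by [(a + c) (1 + z2)]. *)
  apply: T1_inj => //; apply: (scale0 (D * (A + C) ^+ 3) (bet q1 + q0)).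
  - by rewrite mulf_neq0 // expf_neq0.
  - rewrite /q1 /q0 /q -bet3_N fJ NJ // row0J; last first.
      by split; rewrite /= row0L // !Wrow0 rG.
    by rewrite /Cop /= YL addr0 WL !betL bet3_W3 scalerA.
  - rewrite iD (iter_L2_bet q10) add0r.
    by rewrite iterS q00 L2L.
have eF : row0 f = W x.1 by rewrite fJ row0J // /Cop G0 YL addr0.
have eL : row0 (L1 f) = W (X x.1).
  rewrite fJ L1J row0J; last exact: st0_A.
  by rewrite /Cop /= G0 !(XL, YL, WL) scaler0 !addr0.
have F0 : x.1 = 0.
  (* With [G = 0] and [u = (1 + z2) F], [q0 = (a + c) bet u] and [q1 = - (a + c) u]. This
     combination yields [gam bet - z2 = a c (1 + z2)^2], the two missing factors. *)
  apply: T1_inj => //; apply: (scale0 ((A + C) * (A * C)) (gam q0 + Sz q1)).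
  - by rewrite !mulf_neq0 ?A_neq0 ?C_neq0.
  - rewrite /q1 /q0 /q row0_PmPm row0_L1PmPm eF eL -!XW betX !betW.
    rewrite !betL; set u := T1 x.1; rewrite -scalerA -gam_bet.
    have -> : (A + C) *: u - (2 : R[i]) *: ((A + C) *: u) = - ((A + C) *: u).
      by apply/funext => k; rewrite !evE; ring.
    by rewrite !(gamL, SzL) scalerBr.
  - rewrite iD (iter_L2_gam q00) add0r.
    by rewrite iterSr L2Sz q10.
by rewrite fJ (_ : x = 0) ?linear0 //; exact: pairP.
Qed.

(** * Identification of the second summand *)

Section Decomposition.
Variables SS1 SS2 : set (coef2 R).
Hypotheses (cS1 : closed_subspace SS1) (cS2 : closed_subspace SS2)
  (S1K : SS1 `<=` KTheta a c) (S2K : SS2 `<=` KTheta a c)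
  (dec : forall f, KTheta a c f -> exists f1 f2,
    [/\ SS1 f1, SS2 f2 & f = coef_add f1 f2])
  (inv1 : forall f, SS1 f -> SS1 (Mz1 f))
  (inv2 : forall f, SS2 f -> SS2 (Mz2 f)).

(** [KTheta_coef] is applied to [z2^2 g], resp. [z1^2 g], so that it covers every degree in the
    shifted variable. A model function then splits with its first component in both model spaces,
    hence zero. *)
Lemma S2_model f : SS2 f <-> H2 f /\ Nop (Nop f) = 0.
Proof.
have S2N g : SS2 g -> Nop (Nop g) = 0.
  move=> Sg; apply/NN_coef => j l.
  have := KTheta_coef j l (S2K (inv2 (inv2 Sg))).
  by rewrite -[Mz2 (Mz2 g)]/(Sz (Sz g)) !PmSz.
have S1N g : SS1 g -> L2 (L2 (Pm (Pm g))) = 0.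
  move=> Sg; apply/funext => -[j l].
  have := KTheta_coef j l (S1K (inv1 (inv1 Sg))).
  by rewrite -[Mz1 (Mz1 g)]/(S1 (S1 g)) !PmS1.
split=> [Sf|[hf nf]]; first by split; [case: (S2K Sf)|exact: S2N].
have [f1 [f2 [S1f S2f e]]] := dec (M_KTheta hf nf).
have ef1 : f1 = f - f2 by rewrite e -[coef_add f1 f2]/((f1 : E) + f2) addrK.
have f10 : f1 = 0.
  apply: M1_M2_disjoint; [by case: (S1K S1f)| |exact: S1N].
  by rewrite ef1 !NL nf (S2N _ S2f) subrr.
suff -> : f = f2 by [].
by apply/eqP; rewrite -subr_eq0 -ef1 f10.
Qed.

End Decomposition.

(** * Sharp bounds for the quadratic form on states *)

Definition cmod z : R := Num.sqrt (cabs2 z).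
Lemma cmod_ge0 z : 0 <= cmod z. Proof. exact: sqrtr_ge0. Qed.
Lemma cmodM z w : cmod (z * w) = cmod z * cmod w.
Proof. by rewrite /cmod cabs2M sqrtrM // cabs2_ge0. Qed.
Lemma cmod_sqr z : cmod z ^+ 2 = cabs2 z.
Proof. by rewrite sqr_sqrtr // cabs2_ge0. Qed.
Lemma Re_le_cmod z : Re z <= cmod z.
Proof.
apply: le_trans (ler_norm _) _; rewrite -sqrtr_sqr ler_sqrt ?cabs2_ge0 //.
by rewrite lerDl sqr_ge0.
Qed.
Lemma cmod_le z (r : R) : 0 <= r -> cabs2 z <= r ^+ 2 -> cmod z <= r.
Proof.
move=> r0 zr; rewrite -(ger0_norm r0) -sqrtr_sqr ler_sqrt // ; exact: sqr_ge0.
Qed.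

(** The form on states of the backward shift [L1], which leaves the model space invariant and is
    therefore the adjoint of the compression. *)
Definition num x : R[i] := ip (Aop x).1 x.1 + ip (Aop x).2 x.2.
Definition supp z : R := kap * Re z + del + (1 - kap) * cmod (z - K).

Lemma ip_V_le f v : H2 f -> Re (v * ip (V f) f) <= cmod v * nrm2 f.
Proof.
move=> hf; apply: le_trans (Re_le_cmod _) _; rewrite cmodM ler_wpM2l ?cmod_ge0 //.
apply: cmod_le; first exact: nrm2_ge0.
by rewrite expr2 -{1}(nrm2_V hf); apply: cauchy_schwarz => //; exact: H2_V.
Qed.

Lemma nrm2_W f : H2 f -> nrm2 (W f) = 2 * nrm2 f - 2 * Re (ip (V f) f).
Proof.
move=> hf; have hV := H2_V hf.
by rewrite WE nrm2BC // nrm2B // nrm2_V //; ring.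
Qed.

(** As [V] is isometric, the inner product of [W (W g)] with [f] is minus that of [V (W g)] with
    [W f]; Cauchy-Schwarz and the arithmetic-geometric mean inequality conclude. *)
Lemma ip_WW_le f g z : H2 f -> H2 g -> cabs2 z = 1 ->
  Re (z * ip (W (W g)) f) <= (nrm2 (W f) + nrm2 (W g)) / 2.
Proof.
move=> hf hg z1; have hW := H2_W hg; have hWf := H2_W hf; have hV := H2_V hW.
have hVf := H2_V hf.
have -> : ip (W (W g)) f = - ip (V (W g)) (W f).
  by rewrite WE ipBl // [W f]WE ipBr // ip_V // opprB.
apply: le_trans (Re_le_cmod _) _; apply: cmod_le.
  by rewrite divr_ge0 // addr_ge0 // nrm2_ge0.
rewrite cabs2M z1 mul1r cabs2N.
apply: le_trans (cauchy_schwarz hV hWf) _; rewrite nrm2_V //.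
rewrite -subr_ge0; have -> : ((nrm2 (W f) + nrm2 (W g)) / 2) ^+ 2 -
  nrm2 (W g) * nrm2 (W f) = ((nrm2 (W f) - nrm2 (W g)) / 2) ^+ 2 by field.
exact: sqr_ge0.
Qed.

Lemma numE x : H2x x -> num x = K * rc (nrmx x) +
  (1 - K) * (ip (V x.1) x.1 + ip (V x.2) x.2) + D * ip (W (W x.2)) x.1.
Proof.
move=> [h1 h2']; have v1 := H2_V h1; have v2 := H2_V h2'; have hX := H2X h1.
have hW := H2_W (H2_W h2'); rewrite /num /Aop /nrmx /=.
rewrite ipDl // ipZl // !XE !ipDl // !ipZl // !ipff // rcD; ring.
Qed.

(** The bound for the off-diagonal term equals [del] times the norm minus [del] times the real part
    of the form of [V]. Writing [z (1 - K) = (1 - K) (z - K) + D] absorbs the latter, so [V] is left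
    with the coefficient [z - K]. *)
Lemma num_upper x z : H2x x -> cabs2 z = 1 -> Re (z * num x) <= supp z * nrmx x.
Proof.
move=> hx z1; have [h1 h2'] := hx; rewrite numE //.
have := ip_WW_le h1 h2' z1; rewrite !nrm2_W // => hP.
have e1 := ip_V_le (z - K) h1; have e2 := ip_V_le (z - K) h2'.
have -> : z * (K * rc (nrmx x) + (1 - K) * (ip (V x.1) x.1 + ip (V x.2) x.2) +
    D * ip (W (W x.2)) x.1) =
  rc (kap * nrmx x) * z + rc (1 - kap) * ((z - K) * ip (V x.1) x.1) +
  rc (1 - kap) * ((z - K) * ip (V x.2) x.2) +
  rc del * (z * ip (W (W x.2)) x.1) + rc del * (ip (V x.1) x.1 + ip (V x.2) x.2).
  by rewrite DE rcM -rcK1 -/(1 - K); ring.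
rewrite !ReD !Re_rcM ReD /supp.
have k1 : 0 <= 1 - kap by rewrite subr_ge0 ltW // kap_lt1.
have d1 : 0 <= del by exact/ltW/del_gt0.
have := ler_wpM2l k1 e1; have := ler_wpM2l k1 e2; have := ler_wpM2l d1 hP.
rewrite /nrmx; set a1 := Re _; set a2 := nrm2 _; set a3 := nrm2 _.
set a4 := Re _; set a5 := Re _; set a6 := Re _; set a7 := Re _; set a8 := cmod _.
lra.
Qed.

Section LowerBound.
Variables (z e : R[i]).
Hypotheses (ez : cabs2 e = 1).

Definition wand : E := X (delta (0%N, 0%N)).
(* [ray n] is the sum of [conj e ^ i V^i wand] for [i < n], an approximate eigenvector of [V] for
   the eigenvalue [e]. *)
Fixpoint ray n : E := if n is n'.+1 then wand + e^* *: V (ray n') else 0.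

Lemma H2_wand : H2 wand. Proof. by apply: H2X; exact: H2_delta. Qed.
Lemma H2_ray n : H2 (ray n).
Proof.
elim: n => [|n IH] /=; first exact: H20.
by apply: H2D; [exact: H2_wand|apply: H2Z; exact: H2_V].
Qed.

Lemma row0_wand : row0 wand = wand.
Proof.
by rewrite /wand -Xrow0; congr (X _); apply/funext => -[[|j] l].
Qed.
Lemma row0_ray n : row0 (ray n) = ray n.
Proof.
elim: n => [|n IH] /=; first by rewrite row0L.
by rewrite !row0L row0_wand -Vrow0 IH.
Qed.

(* [wand] is orthogonal to the range of [V]: it is the kernel function of [H2] at the zero
   of the inner function [V]. *)
Lemma ip_V_wand f : H2 f -> ip (V f) wand = 0.
Proof.
move=> hf; have hX := H2X hf; have hS := H2_Sz hX; have hw := H2_wand.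
have hg := H2_gam hX; have hL := H2_L2 hw.
rewrite V_gam ipNl // gamE ipDl // !ipZl // ip_Szl //.
have -> : C * ip (X f) wand + A * ip (X f) (L2 wand) = ip (X f) (L2 (bet wand)).
  rewrite betE !L2L L2Sz ipDr // !ipZr // !rcJ; ring.
rewrite /wand betX ip_disjoint ?oppr0 // => -[j l]; right.
by rewrite /L2 /delta /= xpair_eqE andbF.
Qed.

Lemma nrm2_wand_gt0 : 0 < nrm2 wand.
Proof.
rewrite lt_def nrm2_ge0 ?andbT; last exact: H2_wand.
apply/eqP => w0; have : wand = 0 by apply: nrm2_eq0; [exact: H2_wand|rewrite w0].
rewrite /wand => /(congr1 bet); rewrite betX betL => /(congr1 (fun g : E => g (0%N, 0%N))).
by rewrite /delta eqxx => /eqP; rewrite oner_eq0.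
Qed.

Lemma nrm2_ray n : nrm2 (ray n) = n%:R * nrm2 wand.
Proof.
elim: n => [|n IH] /=; first by rewrite nrm20 mul0r.
have hr := H2_ray n; have hV := H2_V hr; have hw := H2_wand.
rewrite nrm2D // nrm2Z // cabs2J ez nrm2_V // IH ipZr // (ipC hV hw) ip_V_wand //.
by rewrite rmorph0 mulr0 -natr1 /=; ring.
Qed.

Lemma nrm2_ray_diff n : nrm2 (ray n.+1 - ray n) = nrm2 wand.
Proof.
elim: n => [|n IH]; first by rewrite /= VL scaler0 addr0 subr0.
have -> : ray n.+2 - ray n.+1 = e^* *: V (ray n.+1 - ray n).
  by rewrite VL scalerBr /= opprD addrACA subrr add0r.
have hd : H2 (ray n.+1 - ray n) by apply: H2B; exact: H2_ray.
by rewrite nrm2Z; [rewrite cabs2J ez mul1r nrm2_V|exact: H2_V].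
Qed.

Definition err n : E := V (ray n) - e *: ray n.

Lemma H2_err n : H2 (err n).
Proof.
by have hr := H2_ray n; have hV := H2_V hr; rewrite /err.
Qed.

(** Multiplying the recursion of [ray] by [e] writes the error as a difference of two vectors with
    the norm of [wand]; it stays bounded while [nrm2 (ray n)] grows linearly. *)
Lemma nrm2_err n : nrm2 (err n) <= 4 * nrm2 wand.
Proof.
have e1 : e * e^* = 1 by rewrite mulcJ ez rc1.
have -> : err n = e *: (ray n.+1 - ray n) - e *: wand.
  apply/funext => k; rewrite /err /= !evE.
  rewrite -{1}[V (ray n) k]mul1r -e1; ring.
have hd : H2 (ray n.+1 - ray n) by apply: H2B; exact: H2_ray.
have hw := H2_wand; have h1 := H2Z e hd; have h2' := H2Z e hw.
apply: le_trans (nrm2B_le h1 h2') _.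
by rewrite !nrm2Z // ez !mul1r nrm2_ray_diff; lra.
Qed.
End LowerBound.

(** Substituting [V f = e f + d] leaves a multiple of [nrm2 f] and terms linear in the error [d].
    The phase [al] of the second component remains free to align the off-diagonal term. *)
Lemma num_ray (e al : R[i]) n : cabs2 e = 1 -> cabs2 al = 1 ->
  let f := ray e n in let d := err e n in
  num (f, al *: f) = (2 * (K + (1 - K) * e) + al * D * (1 - e) ^+ 2) * rc (nrm2 f) +
   (2 * (1 - K) + al * D * (e - 2)) * ip d f + al * D * ip (V d) f.
Proof.
move=> e1 al1 f d; have hf : H2 f := H2_ray e n; have hd : H2 d := H2_err e n.
have hVd := H2_V hd; have hx : H2x (f, al *: f) by split; [|apply: H2Z].
have hW : H2 (W (W f)) by apply: H2_W; exact: H2_W.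
have hVf := H2_V hf.
have eV : V f = e *: f + d by rewrite addrC subrK.
have eW : W (W f) = (1 - e) ^+ 2 *: f + (e - 2) *: d + V d.
  rewrite !WE VL eV !VL eV; apply/funext => k; rewrite !evE; ring.
have h1 : H2 (al *: V f) by apply: H2Z.
have h2' : H2 (al *: f) by apply: H2Z.
have e1' : ip (V (al *: f)) (al *: f) = e * ip f f + ip d f.
  by rewrite VL ipZl // ipZr // mulrA mulcJ al1 rc1 mul1r eV ipDl // ?ipZl.
have e2' : ip (W (W (al *: f))) f =
    al * ((1 - e) ^+ 2 * ip f f + (e - 2) * ip d f + ip (V d) f).
  by rewrite !WL ipZl // eW ipDl // ipDl // !ipZl.
have e3' : ip (V f) f = e * ip f f + ip d f.
  by rewrite eV ipDl // ipZl.
rewrite numE // /nrmx [(f, _).1]/= [(f, _).2]/= nrm2Z // al1 mul1r e1' e2' e3'.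
by rewrite ipff // rcD; ring.
Qed.

Lemma rc2 : rc 2 = 2 :> R[i].
Proof. by rewrite -[2 : R]/(1 + 1) rcD rc1. Qed.

Lemma num_lower z (eps : R) : cabs2 z = 1 -> 0 < eps ->
  exists x, [/\ H2x x, st0 x, 0 < nrmx x &
    (supp z - eps) * nrmx x <= Re (z * num x)].
Proof.
move=> z1 eps0; pose v := z - K; pose r := cmod v.
have r0 : 0 < r.
  rewrite lt_def cmod_ge0 andbT; apply/eqP => r0.
  have : cabs2 v = 0 by rewrite -cmod_sqr -/r r0 expr0n.
  move=> /cabs2_eq0/eqP; rewrite subr_eq0 => /eqP zK; move: z1; rewrite zK cabs2C => k1.
  have := kap_lt1; have := kap_gt0; nra.
(* The eigenvalue making [v * e] equal to [|v|], where the bound for the form of [V] is attained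
   approximately. *)
pose e := v^* * rc r^-1.
have e1 : cabs2 e = 1.
  by rewrite cabs2M cabs2J cabs2C -cmod_sqr -exprMn divff ?gt_eqF // expr1n.
have ve : v * e = rc r.
  rewrite mulrA mulcJ -cmod_sqr -rcM; congr rc.
  by rewrite -/r expr2 mulfK // gt_eqF.
(* The phase turning the off-diagonal term into its modulus; when [e = 1] that term vanishes and any
   phase works. *)
have [al al1 zal] : exists2 al, cabs2 al = 1 &
    z * al * (1 - e) ^+ 2 = rc (cabs2 (1 - e)).
  have [->|ne] := eqVneq e 1.
    by exists 1; rewrite ?cabs21 // subrr expr0n /= mulr0 cabs20 rc0.
  have n0 : cabs2 (1 - e) != 0.
    apply: contra ne => /eqP/cabs2_eq0/eqP; rewrite subr_eq0 => /eqP h.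
    by rewrite -h.
  exists (z^* * ((1 - e)^*) ^+ 2 * rc (cabs2 (1 - e))^-1).
    rewrite !cabs2M !cabs2J z1 cabs2C mul1r -expr2 -exprMn.
    by rewrite divff // expr1n.
  have -> : z * (z^* * (1 - e)^* ^+ 2 * rc (cabs2 (1 - e))^-1) * (1 - e) ^+ 2 =
    (z * z^*) * ((1 - e) * (1 - e)^*) ^+ 2 * rc (cabs2 (1 - e))^-1 by ring.
  by rewrite !mulcJ z1 rc1 mul1r expr2 -!rcM mulfK.
pose p := 2 * (1 - K) + al * D * (e - 2); pose q := al * D.
(* Cauchy-Schwarz and [nrm2_err] bound the squared error by [c' * m * w2 ^+ 2], which has to stay
   below [(2 * eps * m * w2) ^+ 2]. *)
pose c' := 8 * (cabs2 p + cabs2 q).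
have [n hn] := @null_harmonic R c' (4 * eps ^+ 2) (mulr_gt0 (ltr0Sn R 3) (exprn_gt0 2 eps0)).
have {hn} := hn n (leqnn n); set m := n.+1; set f := ray e m => hn.
pose w2 := nrm2 wand; have w0 : 0 < w2 := nrm2_wand_gt0.
have hf : H2 f := H2_ray e m; pose d := err e m; have hd : H2 d := H2_err e m.
have hVd := H2_V hd; have hal := H2Z al hf.
have nf : nrm2 f = m%:R * w2 := nrm2_ray e1 m.
have nx : nrmx (f, al *: f) = 2 * (m%:R * w2).
  by rewrite /nrmx [(f, _).1]/= [(f, _).2]/= nrm2Z // al1 nf; ring.
have m0 : 0 < m%:R :> R by [].
have hx : H2x (f, al *: f) by [].
have rf : row0 f = f := row0_ray e m.
have rf2 : row0 (al *: f) = al *: f by rewrite row0L rf.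
exists (f, al *: f); split; [exact: hx|exact: (conj rf rf2)|by rewrite nx !mulr_gt0|].
rewrite nx num_ray // -/f -/d -/p -/q nf.
have -> : z * ((2 * (K + (1 - K) * e) + q * (1 - e) ^+ 2) * rc (m%:R * w2) +
    p * ip d f + q * ip (V d) f) =
  rc (m%:R * w2) * (rc (2 * kap) * z + rc (2 * (1 - kap)) * (z * e) +
     rc del * (z * al * (1 - e) ^+ 2)) + z * (p * ip d f + q * ip (V d) f).
  by rewrite (rcM m%:R) (rcM 2 kap) (rcM 2 (1 - kap)) -!rcK1 /q rc2; ring.
have eqr : z * e = rc r + K * e by rewrite -ve /v; ring.
rewrite zal eqr ReD Re_rcM !ReD !Re_rcM.
clearbody p q; set y := p * _ + _.
have hy : cabs2 (z * y) <= (eps * (2 * (m%:R * w2))) ^+ 2.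
  rewrite cabs2M z1 mul1r; apply: le_trans (cabs2D_le _ _) _; rewrite !cabs2M.
  have cs g : H2 g -> nrm2 g <= 4 * w2 -> cabs2 (ip g f) <= 4 * m%:R * w2 ^+ 2.
    move=> hg le; apply: le_trans (cauchy_schwarz hg hf) _; rewrite nf.
    apply: le_trans (ler_wpM2r _ le) _; first by rewrite mulr_ge0 // ltW.
    by rewrite le_eqVlt; apply/orP; left; apply/eqP; ring.
  have c1 := cs d hd (nrm2_err e1 m).
  have c2 : cabs2 (ip (V d) f) <= 4 * m%:R * w2 ^+ 2.
    by apply: cs => //; rewrite nrm2_V //; exact: nrm2_err.
  have := ler_wpM2l (cabs2_ge0 p) c1; have := ler_wpM2l (cabs2_ge0 q) c2.
  move: hn; rewrite /c' ltr_pdivrMr // => hn h1 h2'.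
  have : 8 * (cabs2 p + cabs2 q) * (m%:R * w2 ^+ 2) <=
         4 * eps ^+ 2 * m%:R * (m%:R * w2 ^+ 2).
    by rewrite ler_wpM2r ?mulr_ge0 ?sqr_ge0 // ltW.
  have -> : (eps * (2 * (m%:R * w2))) ^+ 2 = 4 * eps ^+ 2 * m%:R * (m%:R * w2 ^+ 2) by ring.
  move: (cabs2 p) (cabs2 q) (cabs2 _) (cabs2 _) h1 h2' => *; lra.
have hRe : - (eps * (2 * (m%:R * w2))) <= Re (z * y).
  have := Re_le_cmod (- (z * y)); rewrite ReN.
  have : cmod (- (z * y)) <= eps * (2 * (m%:R * w2)).
    apply: cmod_le; last by rewrite cabs2N.
    by rewrite ltW // !mulr_gt0.
  lra.
have k1 := kap_lt1; have k0 := kap_gt0.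
have e2 : cabs2 (1 - e) = 2 - 2 * Re e.
  by move: e1; rewrite /cabs2 !ReImE => h; nra.
rewrite [Re (rc r + _)]ReD Re_rcM !ReC e2 /supp -/v -/r /del.
move: (Re (z * y)) hRe => Y hY.
suff -> : (kap * Re z + kap * (1 - kap) + (1 - kap) * r - eps) * (2 * (m%:R * w2)) =
  m%:R * w2 * (2 * kap * Re z + 2 * (1 - kap) * (r + kap * Re e) +
    kap * (1 - kap) * (2 - 2 * Re e)) - eps * (2 * (m%:R * w2)).
  by rewrite lerD2l.
ring.
Qed.

Lemma ip_L1J x : H2x x -> st0 x -> D * ip (L1 (J x)) (J x) = num x.
Proof. by move=> hx sx; rewrite L1J ipJ //; [exact: H2x_A|exact: st0_A]. Qed.

Lemma ip_S1J x : H2x x -> st0 x -> D * (ip (S1 (J x)) (J x))^* = num x.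
Proof.
move=> hx sx; have hJ := H2J hx sx; have hL := H2_L1 hJ.
by rewrite ip_S1l // -(ipC hJ hL) ip_L1J.
Qed.

(** * The numerical range and its boundary *)

Section NumericalRange.
Variable SS2 : set E.
Hypotheses (cS2 : closed_subspace SS2)
  (model : forall f, SS2 f <-> H2 f /\ Nop (Nop f) = 0).

(** A projection differs from [z1 h] by a vector orthogonal to [h], so it drops out of the inner
    product; conversely a projection always exists. *)
Lemma numrange_S1E : numrange_S1 SS2 =
  [set w | exists h, [/\ SS2 h, nrm2 h = 1 & w = ip (S1 h) h]].
Proof.
case: (cS2) => SH _ _ _ _.
apply/seteqP; split=> [w [h [y [Sh n1 [Sy py] ->]]]|w [h [Sh n1 ->]]].
  have hh := SH _ Sh; have hy := SH _ Sy; have hS := H2_S1 hh.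
  exists h; split=> //; first by rewrite /nrm2 n1.
  by apply/eqP; rewrite eq_sym -subr_eq0 -ipBl //; apply/eqP; exact: py.
have hh := SH _ Sh; have hS := H2_S1 hh.
have [y yP] := projection_exists cS2 hS; exists h, y; split=> //.
  by rewrite ipff // n1 rc1.
case: yP => Sy py; have hy := SH _ Sy.
by apply/eqP; rewrite -subr_eq0 -ipBl //; apply/eqP; exact: py.
Qed.

Let PW := toR2 @` numrange_S1 SS2.

(** The conjugate turns a value of the compression into one of its adjoint, the operator whose form
    is [num]. *)
Lemma dot_toR2 (u : R * R) (w : R[i]) : dot u (toR2 w) = Re (Complex u.1 u.2 * w^*).
Proof. by rewrite /dot /toR2 ReM ReJ ImJ /=; ring. Qed.

Lemma suppE (u : R * R) : supp (Complex u.1 u.2) = supportf kap u.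
Proof. by rewrite /supp /supportf /cmod /rad /cabs2 !ReImE /= subr0. Qed.

Lemma W_le (w u : R * R) : PW w -> unit_vec u -> dot u w <= supportf kap u.
Proof.
move=> [v]; rewrite numrange_S1E => -[h [Sh n1 ->]] <- uu.
have [hh nn] := (model h).1 Sh; have [x [hx sx hJ]] := state_exists hh nn.
have z1 : cabs2 (Complex u.1 u.2) = 1 by [].
have := num_upper hx z1; rewrite -ip_S1J // -nrm2J // -hJ n1 mulr1 suppE.
rewrite mulrCA Re_rcM -dot_toR2 [leRHS]mulrC ler_pM2l //; exact: del_gt0.
Qed.

Lemma W_ge (u : R * R) (eps : R) : unit_vec u -> 0 < eps ->
  exists2 w, PW w & supportf kap u - eps <= dot u w.
Proof.
move=> uu eps0; have z1 : cabs2 (Complex u.1 u.2) = 1 by [].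
have [x [hx sx nx le]] := num_lower z1 eps0; have d0 := del_gt0.
have hJ := H2J hx sx; have hS := H2_S1 hJ.
have n0 : 0 < nrm2 (J x) by rewrite -(pmulr_rgt0 _ d0) nrm2J.
pose l := rc (Num.sqrt (nrm2 (J x)))^-1.
have l2 : cabs2 l * nrm2 (J x) = 1.
  by rewrite cabs2C exprVn sqr_sqrtr ?mulVf ?gt_eqF // ltW.
pose h : E := l *: J x.
have Sh : SS2 h by case: cS2 => _ _ _ SZ _; apply: SZ; apply/model; split; [|exact: NNJ].
have nh : nrm2 h = 1 by rewrite nrm2Z.
have hh : H2 h by exact: H2Z.
exists (toR2 (ip (S1 h) h)).
  by exists (ip (S1 h) h) => //; rewrite numrange_S1E; exists h.
have -> : ip (S1 h) h = rc (cabs2 l) * ip (S1 (J x)) (J x).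
  by rewrite S1L ipZl ?ipZr // mulrA mulcJ.
rewrite dot_toR2 rmorphM /= rcJ mulrCA Re_rcM -suppE.
rewrite -(ler_pM2r (mulr_gt0 d0 n0)) nrm2J //; apply: le_trans le _.
rewrite -ip_S1J // mulrCA Re_rcM -nrm2J //.
set r := Re _; set d := del; set n := nrm2 _ in l2 *.
have -> : cabs2 l * r * (d * n) = (cabs2 l * n) * (d * r) by ring.
by rewrite l2 mul1r.
Qed.

Lemma W_convex : convex_plane PW.
Proof.
case: (cS2) => SH _ SD SZ _ v w t t01.
rewrite /PW numrange_S1E => -[_ [h1 [S1h n1 ->]] <-] [_ [h2' [S2h n2 ->]] <-].
have [h [Sh nh e]] := toeplitz_hausdorff SH SD SZ t01 S1h n1 S2h n2.
exists (ip (S1 h) h); first by exists h.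
rewrite e /toR2 /convex_comb ReD ImD !Re_rcM !Im_rcM; reflexivity.
Qed.

Lemma kapE : kap = a / (a + c). Proof. by []. Qed.

Lemma curveE_env : curveE a c = [set z | exists t, 0 <= t < 2 * pi /\ z = env kap t].
Proof.
have n0 : a + c != 0 by rewrite gt_eqF // addr_gt0.
have e t : (curve_x a c t, curve_y a c t) = env kap t.
  rewrite /curve_x /curve_y /env /phase kapE.
  set s := t - asin _; congr pair; by field.
by apply/seteqP; split=> z [t [tpi ->]]; exists t; split; rewrite ?e.
Qed.

Lemma boundary_numrange : boundary PW = curveE a c.
Proof.
rewrite curveE_env; apply: boundary_env; [exact: kap_gt0|exact: kap_lt1|exact: W_convex| |].
  exact: W_le.
exact: W_ge.
Qed.

End NumericalRange.

End Multipliers.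

Theorem theorem6p3 (R : realType) (a c : R) (S1 S2 : set (coef2 R)) :
  0 < a -> 0 < c ->
  (forall z1 z2 : R[i], `|z1| < 1 -> `|z2| < 1 -> p_eval a c z1 z2 != 0) ->
  (exists z1 z2 : R[i], [/\ `|z1| = 1, `|z2| = 1 & p_eval a c z1 z2 = 0]) ->
  closed_subspace S1 -> closed_subspace S2 ->
  S1 `<=` KTheta a c -> S2 `<=` KTheta a c ->
  (forall f g, S1 f -> S2 g -> ip f g = 0) ->
  (forall f, KTheta a c f -> exists f1 f2, [/\ S1 f1, S2 f2 & f = coef_add f1 f2]) ->
  (forall f, S1 f -> S1 (Mz1 f)) ->
  (forall f, S2 f -> S2 (Mz2 f)) ->
  boundary (toR2 @` numrange_S1 S2) = curveE a c.
Proof.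
move=> a0 c0 nz z0 cS1 cS2 S1K S2K ort dec inv1 inv2.
have ac := a_eq_c1 a0 c0 nz z0.
apply: (boundary_numrange c0 ac cS2) => f.
exact: (S2_model c0 ac S1K S2K dec inv1 inv2).
Qed.
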